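(* The limit $J:=-\lim_{n\to\infty}\frac1n\log\mathbb{P}(Q_{2,n}>nb)$ exists and $$J=\inf_{f\in\overline{\mathcal S}}I(f)=\inf_{f\in\mathcal S}I(f),$$ where $\overline{\mathcal S}$ is the closure of $\mathcal S$ in $\Omega$.
   Context: Let $v:[0,\infty)\to[0,\infty)$ be continuous with $v(0)=0$ and $\lim_{t\to\infty}v(t)/t^{\alpha}=0$ for some $\alpha<2$. Let $A=(A(t))_{t\in\mathbb R}$ be a centered Gaussian process with continuous sample paths, $A(0)=0$, stationary increments and $\mathrm{Var}(A(t)-A(s))=v(|t-s|)$; write $A(s,t):=A(t)-A(s)$ and $\Gamma(s,t):=\mathrm{Cov}(A(s),A(t))=\tfrac12\big(v(|s|)+v(|t|)-v(|t-s|)\big)$ for $s,t\in\mathbb R$. Let $A_1,A_2,\dots$ be i.i.d. copies of $A$. Path space: $\Omega$ is the set of continuous $\omega:\mathbb R\to\mathbb R$ with $\omega(0)=0$ and $\omega(t)/(1+|t|)\to0$ as $t\to\pm\infty$, a separable Banach space under $\|\omega\|_\Omega:=\sup_{t\in\mathbb R}|\omega(t)|/(1+|t|)$; the $A_i$ are realized in $\Omega$. $R\subseteq\Omega$ is the reproducing kernel Hilbert space of $\Gamma$: the closure of the span of $\{\Gamma(s,\cdot):s\in\mathbb R\}$ under the inner product determined by $\langle\Gamma(s,\cdot),\Gamma(u,\cdot)\rangle_R=\Gamma(s,u)$. The rate function is $I(\omega):=\frac12\|\omega\|_R^2$ if $\omega\in R$ and $I(\omega):=\infty$ otherwise (by the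 generalized Schilder theorem, $\frac1n\sum_{i=1}^nA_i$ satisfies a large deviation principle in $\Omega$ with rate function $I$). Fix $b>0$, $c_1>c_2>0$, $t_0:=b/(c_1-c_2)$, and define $$Q_{2,n}:=\sup_{t>0}\Big(\sum_{i=1}^nA_i(-t,0)-nc_2t\Big)-\sup_{s>0}\Big(\sum_{i=1}^nA_i(-s,0)-nc_1s\Big),$$ $$\mathcal S:=\{f\in\Omega:\ \exists t>t_0\ \forall s\in(0,t):\ f(-s)-f(-t)>b+c_2t-c_1s\}.$$ *)

(* Defs.v *)
From HB Require Import structures.
From mathcomp Require Import all_boot all_order all_algebra.
From mathcomp Require Import all_classical all_reals all_analysis.
Set Implicit Arguments. Unset Strict Implicit. Unset Printing Implicit Defensive.
Import Order.TTheory GRing.Theory Num.Theory.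
Import numFieldNormedType.Exports.
Local Open Scope classical_set_scope.
Local Open Scope ring_scope.

Section Defs.
Variable R : realType.

Definition Gam (v : R -> R) (s t : R) : R :=
  (v `|s| + v `|t| - v `|t - s|) / 2.

Definition in_Omega (f : R -> R) : Prop :=
  continuous f /\ f 0 = 0 /\
  ((fun t => f t / (1 + `|t|)) @ +oo --> (0:R)) /\
  ((fun t => f t / (1 + `|t|)) @ -oo --> (0:R)).

Definition Omega_norm (f : R -> R) : R :=
  sup [set `|f t| / (1 + `|t|) | t in [set: R]].

Definition Omega_closure (S : set (R -> R)) : set (R -> R) :=
  [set f | in_Omega f /\
     forall e : R, 0 < e -> exists g, S g /\ Omega_norm (f \- g) < e].

Definition kfun (v : R -> R) (l : seq (R * R)) (t : R) : R :=
  \sum_(p <- l) p.2 * Gam v p.1 t.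

Definition knorm2 (v : R -> R) (l : seq (R * R)) : R :=
  \sum_(p <- l) \sum_(q <- l) p.2 * q.2 * Gam v p.1 q.1.

Definition kdiff (l1 l2 : seq (R * R)) : seq (R * R) :=
  l1 ++ [seq (p.1, - p.2) | p <- l2].

(* L is the limit of the squared R-norms of a sequence of finite combinations
   that is Cauchy in the R-norm and converges pointwise to f
   (i.e. f is in the completion R and ||f||_R^2 = L) *)
Definition rkhs_approx (v : R -> R) (f : R -> R) (L : R) : Prop :=
  exists u : nat -> seq (R * R),
    (forall e : R, 0 < e -> exists N : nat, forall m k : nat,
        (N <= m)%N -> (N <= k)%N -> knorm2 v (kdiff (u m) (u k)) < e) /\
    (forall t : R, (fun m => kfun v (u m) t) @ \oo --> f t) /\
    ((fun m => knorm2 v (u m)) @ \oo --> L).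

(* rate function: I(f) = ||f||_R^2 / 2 if f in R, +oo otherwise
   (the value of the limit L is independent of the approximating sequence,
    so the infimum below is just that value; empty set gives +oo) *)
Definition rate (v : R -> R) (f : R -> R) : \bar R :=
  ereal_inf [set ((L / 2)%:E) | L in rkhs_approx v f].

Definition setS (b c1 c2 : R) : set (R -> R) :=
  [set f | in_Omega f /\
     exists t : R, b / (c1 - c2) < t /\
       forall s : R, 0 < s -> s < t -> f (- s) - f (- t) > b + c2 * t - c1 * s].

Definition centered_gaussian d (T : measurableType d) (P : probability T R)
    (X : T -> R) (s2 : R) : Prop :=
  measurable_fun setT X /\
  ((s2 = 0 /\ P [set w | X w != 0] = 0%E) \/
   (0 < s2 /\ forall B : set R, measurable B ->
       P (X @^-1` B) = normal_prob 0 (Num.sqrt s2) B)).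

(* (A_i)_i is a sequence of i.i.d. copies of the centered Gaussian process with
   covariance Gamma: the family (A_i(t))_{i,t} is jointly Gaussian, i.e. every
   finite linear combination sum_k c_k A_{i_k}(t_k) is centered Gaussian with
   variance sum_{j,k} c_j c_k [i_j = i_k] Gamma(t_j,t_k). *)
Definition iid_gaussian_family d (T : measurableType d) (P : probability T R)
    (v : R -> R) (A : nat -> T -> R -> R) : Prop :=
  forall l : seq (nat * R * R),
    centered_gaussian P (fun w => \sum_(p <- l) p.2 * A p.1.1 w p.1.2)
      (\sum_(p <- l) \sum_(q <- l)
          p.2 * q.2 * (if p.1.1 == q.1.1 then Gam v p.1.2 q.1.2 else 0)).

Definition workload d (T : measurableType d) (A : nat -> T -> R -> R)
    (n : nat) (c : R) (w : T) : R :=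
  sup [set (\sum_(i < n) (A i w 0 - A i w (- t))) - n%:R * c * t
      | t in [set t : R | 0 < t]].

Definition Q2 d (T : measurableType d) (A : nat -> T -> R -> R)
    (n : nat) (c1 c2 : R) (w : T) : R :=
  workload A n c2 w - workload A n c1 w.

End Defs.

(* Main.v *)
(** The averaged path [M_n = (A_1 + ... + A_n) / n] satisfies [Q_{2,n} > n b] exactly
    when some time [t] beats every [s] by more than [b], i.e. [exceeds b c1 c2 M_n],
    and no general large deviation principle is needed.

    Linear functionals of the family are Gaussian, so boxes have probabilities
    determined by covariances (uniqueness of characteristic functions, obtained by
    approximating indicators with products of cosines).  The rotation argument of
    Fernique then bounds the oscillation of [M_n] off a finite grid by [e] up to
    probability [exp (- r n)], for any [r].

    Upper bound: on the grid, the set of vectors satisfying the constraints is covered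
    by finitely many half spaces [{ y | th y >= a + Var th / 2 }], each of probability
    at most [exp (- n a)] by Chernoff; a point [y] outside all such half spaces would be the
    grid trace of a kernel combination of squared norm at most [2 a].  Lower bound:
    for a kernel combination [g = kfun v l], the projection of [M_n] on [l] lies
    slightly above its value at [g] with the right probability, and the part of [M_n]
    uncorrelated with [l] being large costs a strictly better exponent.

    Scaling a path by [lam > 1] and shifting time turns [reach (b - eps)] into
    [exceeds b] at the price of a factor [lam ^ 2] in the rate, which makes the infima
    over the set, its closure and [{f | exceeds b c1 c2 f}] coincide. *)
Require Import Defs.
From HB Require Import structures.
From mathcomp Require Import all_boot all_order all_algebra.
From mathcomp Require Import all_classical all_reals all_analysis.
From mathcomp Require Import measurable_realfun ring lra.
Set Implicit Arguments. Unset Strict Implicit. Unset Printing Implicit Defensive.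
Import Order.TTheory GRing.Theory Num.Theory.
Import numFieldNormedType.Exports.
Local Open Scope classical_set_scope.
Local Open Scope ring_scope.

(** * Characteristic function of the normal law *)

(** The law of the family is given one linear combination at a time, so joint statements must be
    recovered from means of cosines. Symmetric boxes suffice: the rotation of two copies uses only
    equality in law and independence of boxes, and both come from one weighted transfer principle.
    Fernique's bound does not depend on the number of functionals, which lets it pass to all
    rational times.

    The upper bound rests on Gaussian duality: a grid vector in the range of the covariance matrix
    is separated by its own coefficient vector.

    The obstacle in comparing the infima is that [setS] compares [t] only with earlier [s], whereas
    the event compares it with all [s > 0], and that strictness is lost in the closure. Late times
    are handled by moving [t] to a maximizer of the path drifted by [c1], which wins because
    [t > b / (c1 - c2)]. Strictness is regained by scaling; this alone may fail when the workload at
    rate [c1] is positive, and then a time shift by [h], an isometry by stationarity of the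
    increments, raises the level by [(c1 - c2) * h]. *)

Lemma cvgn_invn (R : realType) : (fun n : nat => n%:R^-1 : R) @ \oo --> (0 : R).
Proof.
apply/gtr0_cvgV0; last exact: cvgr_idn.
by near=> n; rewrite ltr0n; near: n; exact: nbhs_infty_gt.
Unshelve. all: by end_near. Qed.

Lemma normal_pdf0E (R : realType) (s : R) (s0 : s != 0) (x : R) :
  normal_pdf 0 s x = normal_peak s * expR (- x ^+ 2 / (s ^+ 2 *+ 2)).
Proof. by rewrite normal_pdfE// /normal_fun subr0. Qed.

Section normal_facts.
Variable R : realType.
Variable s : R.
Hypothesis s0 : s != 0.
Local Notation mu := (@lebesgue_measure R).
Local Notation p := (normal_pdf 0 s).

Let s2_gt0 : 0 < s ^+ 2.
Proof. by rewrite exprn_even_gt0. Qed.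

Lemma is_derive_normal_pdf0 (x : R) : is_derive x (1 : R) (p : R -> R) (- x / s ^+ 2 * p x).
Proof.
have -> : p = (fun x => normal_peak s * expR (- x ^+ 2 / (s ^+ 2 *+ 2))).
  by apply/funext => y; rewrite normal_pdf0E.
apply: is_derive_eq.
rewrite /GRing.scale/= !(mulr0, mul0r, addr0, add0r, mulr1, expr1).
field; exact: s0.
Qed.

Lemma integrable_idM_normal_pdf0 :
  mu.-integrable setT (EFin \o (fun x => x * p x)).
Proof.
(* Doubling the variance halves the exponent; the spare half absorbs [|x|] because
   [1 + u <= expR u]. *)
pose t := Num.sqrt 2 * s.
have t0 : t != 0 by rewrite mulf_neq0// gt_eqF// sqrtr_gt0.
have t2 : t ^+ 2 = 2 * s ^+ 2 by rewrite exprMn sqr_sqrtr.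
pose C := (1 + t ^+ 2 *+ 2) * normal_peak s / normal_peak t.
have pt := normal_peak_gt0 t0; have ps := normal_peak_gt0 s0.
have t22 : 0 <= t ^+ 2 *+ 2 by rewrite -mulr_natr mulr_ge0// sqr_ge0.
have C0 : 0 <= C.
  apply: divr_ge0; last exact: ltW.
  by apply: mulr_ge0; [rewrite addr_ge0|exact: ltW].
apply: (@le_integrable _ _ _ mu _ measurableT _
  (fun x => (C * normal_pdf 0 t x)%:E)).
- apply/measurable_EFinP/measurable_funM => //; exact: measurable_normal_pdf.
- move=> x _ /=; rewrite lee_fin [leRHS]ger0_norm; last first.
    by rewrite mulr_ge0// normal_pdf_ge0.
  rewrite normrM (ger0_norm (normal_pdf_ge0 _ _ _)) !normal_pdf0E//.
  have -> y : C * (normal_peak t * y) = normal_peak s * ((1 + t ^+ 2 *+ 2) * y).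
    by rewrite /C; field; rewrite gt_eqF.
  rewrite mulrCA ler_pM2l//.
  have -> : - x ^+ 2 / (s ^+ 2 *+ 2) =
     - x ^+ 2 / (t ^+ 2 *+ 2) - x ^+ 2 / (t ^+ 2 *+ 2).
    by rewrite t2; field; exact: s0.
  rewrite expRD mulrCA [leRHS]mulrC ler_pM2l ?expR_gt0//.
  have := expR_ge1Dx (x ^+ 2 / (t ^+ 2 *+ 2)).
  rewrite expRN => h.
  have e0 := expR_gt0 (x ^+ 2 / (t ^+ 2 *+ 2)).
  rewrite ler_pdivrMr// (le_trans _ (ler_wpM2l _ h))//; last first.
    by rewrite addr_ge0.
  have -> : (1 + t ^+ 2 *+ 2) * (1 + x ^+ 2 / (t ^+ 2 *+ 2)) =
    1 + t ^+ 2 *+ 2 + x ^+ 2 + x ^+ 2 / (t ^+ 2 *+ 2).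
    by field.
  have : 0 <= x ^+ 2 / (t ^+ 2 *+ 2).
    by rewrite divr_ge0 ?sqr_ge0.
  have : `|x| <= 1 + x ^+ 2.
    by rewrite -(real_normK (num_real x)); have := normr_ge0 x; nra.
  nra.
- have -> : (fun x => (C * normal_pdf 0 t x)%:E) =
    (fun x => C%:E * (normal_pdf 0 t x)%:E)%E by [].
  apply: integrableZl => //; exact: integrable_normal_pdf.
Qed.

Lemma integrable_bdM_normal (g h : R -> R) (M : R) :
  measurable_fun setT g -> (forall x, `|g x| <= M) ->
  mu.-integrable setT (EFin \o h) ->
  mu.-integrable setT (EFin \o (fun x => g x * h x)).
Proof.
move=> mg gM ih.
have mh : measurable_fun setT h by move/integrableP : ih => [/measurable_EFinP].
apply: (@le_integrable _ _ _ mu _ measurableT _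
  (fun x => (M%:E * (h x)%:E)%E)).
- exact/measurable_EFinP/measurable_funM.
- move=> x _ /=; rewrite lee_fin !normrM ler_wpM2r//.
  exact: (le_trans (gM x) (ler_norm _)).
- exact: integrableZl.
Qed.

Lemma continuous_sinM (t : R) : continuous (fun x : R => sin (t * x)).
Proof.
move=> x; apply: (@continuous_comp _ _ _ ( *%R t) (@sin R)).
  exact: mulrl_continuous.
exact: continuous_sin.
Qed.

Lemma continuous_cosM (t : R) : continuous (fun x : R => cos (t * x)).
Proof.
move=> x; apply: (@continuous_comp _ _ _ ( *%R t) (@cos R)).
  exact: mulrl_continuous.
exact: continuous_cos.
Qed.

Lemma normr_cos_le1 (x : R) : `|cos x| <= 1.
Proof. by rewrite ler_norml cos_le1 cos_geN1. Qed.

Lemma normr_sin_le1 (x : R) : `|sin x| <= 1.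
Proof. by rewrite ler_norml sin_le1 sin_geN1. Qed.

Lemma integrable_cosM_normal_pdf0 (t : R) :
  mu.-integrable setT (EFin \o (fun x => cos (t * x) * p x)).
Proof.
apply: (@integrable_bdM_normal _ _ 1).
- apply: continuous_measurable_fun; exact: continuous_cosM.
- by move=> x; exact: normr_cos_le1.
- exact: integrable_normal_pdf.
Qed.

Lemma integrable_sinM_idM_normal_pdf0 (t : R) :
  mu.-integrable setT (EFin \o (fun x => sin (t * x) * (x * p x))).
Proof.
apply: (@integrable_bdM_normal _ _ 1).
- apply: continuous_measurable_fun; exact: continuous_sinM.
- by move=> x; exact: normr_sin_le1.
- exact: integrable_idM_normal_pdf0.
Qed.

Lemma cvgn_normal_pdf0 : (fun n : nat => p n%:R) @ \oo --> (0 : R).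
Proof.
pose C := normal_peak s * (s ^+ 2 *+ 2).
apply: (@squeeze_cvgr _ _ _ _ (cst 0) (fun n => C * n%:R^-1)).
- near=> n; rewrite normal_pdf_ge0/= normal_pdf0E// /C -mulrA.
  have n0 : (0 : R) < n%:R by rewrite ltr0n; near: n; exact: nbhs_infty_gt.
  have n1 : (1 : R) <= n%:R by rewrite ler1n -(ltr0n R).
  have ? : 0 < s ^+ 2 *+ 2 by rewrite pmulrn_rgt0.
  rewrite ler_pM2l ?normal_peak_gt0// mulNr expRN -[leRHS]invrK lef_pV2 ?posrE//.
  + rewrite invf_div.
    apply: le_trans (expR_ge1Dx _).
    rewrite -[leLHS]add0r lerD// ler_pM2r ?invr_gt0// expr2 ler_peMl// ltW//.
  + exact: expR_gt0.
  + by rewrite invr_gt0 divr_gt0.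
- exact: cvg_cst.
- rewrite -(mulr0 C); apply: cvgM; first exact: cvg_cst.
  exact: cvgn_invn.
Unshelve. all: by end_near. Qed.

(* Integration by parts, using p' = - x / s^2 * p. *)
Lemma Rintegral_sinM_idM_normal_pdf0 (t : R) :
  \int[mu]_x (sin (t * x) * (x * p x)) =
  s ^+ 2 * t * \int[mu]_x (cos (t * x) * p x).
Proof.
pose h x := sin (t * x) * p x.
pose k x := t * (cos (t * x) * p x) - s ^- 2 * (sin (t * x) * (x * p x)).
have ic := integrable_cosM_normal_pdf0 t.
have isn := integrable_sinM_idM_normal_pdf0 t.
have ic' : mu.-integrable setT (EFin \o (fun x => t * (cos (t * x) * p x))).
  exact: (integrableZl measurableT t ic).
have isn' : mu.-integrable setT
    (EFin \o (fun x => s ^- 2 * (sin (t * x) * (x * p x)))).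
  exact: (integrableZl measurableT (s ^- 2) isn).
have ik : mu.-integrable setT (EFin \o k).
  by apply: (integrableB measurableT ic' isn').
suff k0 : \int[mu]_x k x = 0.
  move: k0; rewrite RintegralB// RintegralZl// RintegralZl//.
  set a := Rintegral _ _ _; set c := Rintegral _ _ _ => /eqP.
  rewrite subr_eq0 => /eqP e; rewrite -mulrA e mulrA divff ?mul1r//.
  by rewrite gt_eqF.
have dh (x : R) : is_derive x (1 : R) (h : R -> R) (k x).
  have ? := is_derive_normal_pdf0 x.
  rewrite /h; apply: is_derive_eq.
  rewrite /k /GRing.scale/=; field; exact: s0.
have ch : continuous h.
  by move=> x; apply: differentiable_continuous; apply/derivable1_diffP; apply: ex_derive.
have ck : continuous k.
  move=> x; apply: (@cvgB _ R^o); apply: cvgM.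
  - exact: cvg_cst.
  - by apply: cvgM; [exact: continuous_cosM|exact: continuous_normal_pdf].
  - exact: cvg_cst.
  - apply: cvgM; first exact: continuous_sinM.
    by apply: cvgM; [exact: cvg_id|exact: continuous_normal_pdf].
have FTC (n : nat) : (\int[mu]_(x in `[(- n.+1%:R)%R, n.+1%:R%R]) (k x)%:E =
    (h n.+1%:R - h (- n.+1%:R))%:E)%E.
  rewrite (@continuous_FTC2 _ k h)//.
  - by rewrite -subr_gt0 opprK addr_gt0.
  - exact: continuous_subspaceT.
  - split => [x _||]; first exact: ex_derive.
    + by apply: cvg_at_right_filter; exact: ch.
    + by apply: cvg_at_left_filter; exact: ch.
  - by move=> x _; rewrite derive1E derive_val.
have mk : measurable_fun setT (EFin \o k) by move/integrableP : ik => [].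
have lim1 : (fun n : nat => \int[mu]_(x in `[(- n.+1%:R)%R, n.+1%:R%R]) (k x)%:E)%E
    @ \oo --> (\int[mu]_x (k x)%:E)%E.
  under eq_fun do rewrite integral_mkcond.
  apply: (@dominated_cvg _ _ _ mu setT measurableT _ _ (fun x => `|k x|%:E)).
  - by move=> n; apply/(measurable_restrictT _ _).1 => //; exact: measurable_funTS.
  - move=> x _; apply: cvg_near_cst; near=> n.
    rewrite patchE mem_set//= in_itv/= -ler_norml.
    have : `|x| <= n%:R by near: n; exact: nbhs_infty_ger.
    by move/le_trans; apply; rewrite ler_nat.
  - by [].
  - exact: integrable_norm.
  - by move=> n x _; rewrite patchE; case: ifPn => //= _; rewrite normr0 lee_fin.
have lim2 : (fun n : nat => (h n.+1%:R - h (- n.+1%:R))%:E) @ \oo --> (0%:E : \bar R).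
  apply: cvg_EFin; first by exact: nearW.
  have : (fun n : nat => 2 * p n.+1%:R) @ \oo --> (0 : R).
    rewrite -[X in _ --> X](mulr0 2); apply: cvgM; first exact: cvg_cst.
    by have := cvgn_normal_pdf0; rewrite -(cvg_shiftS (fun n => p n%:R)).
  move=> lim2; apply/cvgr0Pnorm_le => e e0.
  move/cvgr0Pnorm_le : lim2 => /(_ _ e0); apply: filterS => n /=.
  apply: le_trans; rewrite /h mulrN sinN.
  have -> : p (- n.+1%:R) = p n.+1%:R by rewrite !normal_pdf0E// sqrrN.
  have -> : sin (t * n.+1%:R) * p n.+1%:R - - sin (t * n.+1%:R) * p n.+1%:R =
    sin (t * n.+1%:R) * (2 * p n.+1%:R) by ring.
  by rewrite normrM ler_piMl// normr_sin_le1.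
rewrite /Rintegral.
have -> : (\int[mu]_x (k x)%:E)%E = 0%E.
  apply/esym/(cvg_unique _ lim2); first exact: ereal_hausdorff.
  by rewrite /= -(funext FTC).
by [].
Unshelve. all: by end_near. Qed.

(** As a function of [t], the integral solves [F' = - s ^ 2 * t * F] with [F 0 = 1]: differentiate
    under the integral, with [|x * p x|] as dominating function, and integrate by parts. *)
Lemma Rintegral_cos_normal_pdf0 (t : R) :
  \int[mu]_x (cos (t * x) * p x) = expR (- (s * t) ^+ 2 / 2).
Proof.
pose f (u : R) (x : R) := cos (u * x) * p x.
pose F u := \int[mu]_x f u x.
have dF (u : R) : is_derive u (1 : R) (F : R -> R) (- (s ^+ 2 * u * F u)).
  have d1 (w : R) (x : R) : is_derive w (1 : R) (f^~ x : R -> R) (- (sin (w * x) * (x * p x))).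
    rewrite /f; apply: is_derive_eq.
    by rewrite /GRing.scale/=; ring.
  have d1E : partial1of2 f = (fun w x => - (sin (w * x) * (x * p x))).
    by apply/funext => w; apply/funext => x; rewrite partial1of2E derive_val.
  have uI : `]u - 1, u + 1[%classic u by rewrite /= in_itv/= ltrBlDr ltrDl ltr01.
  have iG : mu.-integrable setT (EFin \o (fun x => `|x * p x|)).
    by have /integrable_norm := integrable_idM_normal_pdf0; exact.
  have G_ub w (x : R) : `]u - 1, u + 1[%classic w -> setT x ->
      `|partial1of2 f w x| <= `|x * p x|.
    by move=> _ _; rewrite d1E normrN normrM ler_piMl// normr_sin_le1.
  have intf w : `]u - 1, u + 1[%classic w -> mu.-integrable setT (EFin \o f w).
    by move=> _; exact: integrable_cosM_normal_pdf0.
  have derf w (x : R) : `]u - 1, u + 1[%classic w -> setT x ->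
      derivable (f^~ x) w 1.
    by move=> _ _; apply: ex_derive.
  apply: DeriveDef.
    apply: (@derivable_under_integral _ _ _ mu f setT measurableT u _ _ uI) iG G_ub => //.
  rewrite -derive1E (@differentiation_under_integral _ _ _ mu f setT measurableT u _ _ uI
    intf derf _ _ iG G_ub) //.
  rewrite d1E /F -Rintegral_sinM_idM_normal_pdf0 -[RHS]mulN1r -RintegralZl//; last first.
    exact: integrable_sinM_idM_normal_pdf0.
  by apply: eq_Rintegral => x _; rewrite mulN1r.
pose H u := expR ((s * u) ^+ 2 / 2) * F u.
have H0 : H t = H 0.
  apply: is_derive_0_is_cst => u; have ? := dF u.
  rewrite /H; apply: is_derive_eq.
  by rewrite /GRing.scale/=; field.
have F0 : F 0 = 1.
  rewrite /F /f; under eq_Rintegral do rewrite mul0r cos0 mul1r.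
  by rewrite /Rintegral integral_normal_pdf.
move: H0; rewrite /H F0 mulr0 expr0n/= mul0r expR0 mulr1 => H1.
rewrite -/(F t) mulNr expRN; apply: (mulfI (lt0r_neq0 (expR_gt0 ((s * t) ^+ 2 / 2)))).
by rewrite H1 divff// gt_eqF// expR_gt0.
Qed.

End normal_facts.

Lemma integral_same_law (d d' : measure_display) (T : measurableType d)
    (U : measurableType d') (R : realType) (P : probability T R)
    (nu : {measure set U -> \bar R}) (X : T -> U) (f : U -> \bar R) :
  measurable_fun setT X -> measurable_fun setT f -> P.-integrable setT (f \o X) ->
  (forall B, measurable B -> P (X @^-1` B) = nu B) ->
  (\int[P]_w f (X w) = \int[nu]_x f x)%E.
Proof.
move=> mX mf iX law; pose Xm : {mfun T >-> U} := mfun_Sub (mem_set mX).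
rewrite -(@integral_distribution _ _ _ _ _ P Xm)//.
by apply: eq_measure_integral => A mA _; exact: law.
Qed.

Section integral_normal_prob.
Variable R : realType.
Local Notation mu := (@lebesgue_measure R).

Lemma integral_normal_prob (m s : R) (f : R -> \bar R) :
  (normal_prob m s).-integrable setT f ->
  (\int[normal_prob m s]_x f x = \int[mu]_x (f x * (normal_pdf m s x)%:E))%E.
Proof.
move=> intf; have mf := measurable_int _ intf.
rewrite -(Radon_Nikodym_change_of_variables (normal_prob_dominates m s))//=.
apply: ae_eq_integral => //.
- apply: emeasurable_funM => //; apply: (measurable_int mu).
  by apply: Radon_Nikodym_integrable; exact: normal_prob_dominates.
- apply: emeasurable_funM => //=; apply/measurableT_comp => //=.
  exact: measurable_normal_pdf.
- apply: ae_eqe_mul2l => /=.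
  rewrite Radon_NikodymE//=; first exact: normal_prob_dominates.
  move=> dom; case: cid => /= h [h1 h2 h3].
  apply: integral_ae_eq => //=.
  + by apply/measurableT_comp =>//; exact: measurable_normal_pdf.
  + by move=> E _ mE; rewrite -h3.
Qed.

End integral_normal_prob.

(** * Characteristic function and tail bounds of a centered Gaussian variable *)

Section gaussian_variable.
Variables (R : realType) (d : measure_display) (T : measurableType d).
Variables (P : probability T R) (X : T -> R) (s2 : R).
Hypothesis gX : centered_gaussian P X s2.
Local Notation mu := (@lebesgue_measure R).

(** The law is symmetric, so its characteristic function is real and the cosine carries all of
    it. *)
Lemma centered_gaussian_cos : \int[P]_w cos (X w) = expR (- s2 / 2).
Proof.
have mX : measurable_fun setT X by case: gX.
have mcos : measurable_fun setT (EFin \o @cos R).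
  by apply/measurable_EFinP; apply: continuous_measurable_fun; exact: continuous_cos.
case: gX => _ [[-> X0]|[s20 lawX]].
  rewrite oppr0 mul0r expR0 /Rintegral.
  rewrite (@ae_eq_integral _ _ _ P setT (cst 1%E))//=.
  - by rewrite integral_cst//= probability_setT mule1.
  - exact: (measurableT_comp mcos mX).
  - have mX0 : measurable [set w | X w != 0].
      rewrite (_ : [set _ | _] = X @^-1` (~` [set 0])).
        by rewrite -[X in measurable X]setTI; apply: mX => //; exact: measurableC.
      by apply/seteqP; split => w /= /eqP.
    exists [set w | X w != 0]; split => //.
    by move=> w /= h; apply/eqP => Xw; apply: h => _; rewrite Xw cos0.
have s0 : Num.sqrt s2 != 0 by rewrite gt_eqF// sqrtr_gt0.
rewrite /Rintegral.
have icosX : P.-integrable setT ((EFin \o cos) \o X).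
  apply: measurable_bounded_integrable => //.
  - by apply: (@le_lt_trans _ _ 1%E); [exact: probability_le1|exact: ltry].
  - by apply/measurable_EFinP; exact: (measurableT_comp mcos mX).
  - exists 1; split => // M M1 w _; exact: (le_trans (normr_cos_le1 _) (ltW M1)).
have icos : (normal_prob 0 (Num.sqrt s2)).-integrable setT (EFin \o @cos R).
  apply: measurable_bounded_integrable => //.
  - by apply: (@le_lt_trans _ _ 1%E); [exact: probability_le1|exact: ltry].
  - exact/measurable_EFinP.
  - exists 1; split => // M M1 w _; exact: (le_trans (normr_cos_le1 _) (ltW M1)).
have -> : (\int[P]_w (cos (X w))%:E = \int[normal_prob 0 (Num.sqrt s2)]_x (cos x)%:E)%E.
  exact: (@integral_same_law _ _ _ (measurableTypeR R) _ P (normal_prob 0 (Num.sqrt s2)) X).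
rewrite integral_normal_prob//.
have := Rintegral_cos_normal_pdf0 s0 1.
rewrite mulr1 sqr_sqrtr ?(ltW s20)// => <-.
by rewrite /Rintegral; congr fine; apply: eq_integral => x _; rewrite mul1r.
Qed.

(** Exponential tilting: for [x >= c] the centered density is at most [expR (s2 / 2 - c)] times the
    density with mean [s2]. The tilting parameter is fixed at 1 because callers rescale [X]
    instead. *)
Lemma centered_gaussian_chernoff (c : R) :
  (P [set w | (c <= X w)%R] <= (expR (s2 / 2 - c))%:E)%E.
Proof.
have mX : measurable_fun setT X by case: gX.
case: gX => _ [[-> X0]|[s20 lawX]].
  rewrite mul0r sub0r; have [c0|c0] := lerP c 0.
    apply: (@le_trans _ _ 1%E); last by rewrite lee_fin -expR0 ler_expR oppr_ge0.
    apply: probability_le1; rewrite -[X in measurable X]setTI.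
    exact: measurable_fun_le.
  apply: (@le_trans _ _ (P [set w | X w != 0])); last by rewrite X0 lee_fin expR_ge0.
  apply: le_measure; rewrite ?inE.
  - by rewrite -[X in measurable X]setTI; exact: measurable_fun_le.
  - rewrite (_ : [set _ | _] = X @^-1` (~` [set 0])).
      by rewrite -[X in measurable X]setTI; apply: mX => //; exact: measurableC.
    by apply/seteqP; split => w /= /eqP.
  - by move=> w /=; move/(lt_le_trans c0) => /lt0r_neq0.
set s := Num.sqrt s2.
have s0 : s != 0 by rewrite gt_eqF// sqrtr_gt0.
have ss : s ^+ 2 = s2 by rewrite sqr_sqrtr// ltW.
have := lawX `[c, +oo[%classic (measurable_itv _).
rewrite (_ : X @^-1` _ = [set w | c <= X w]); last first.
  by apply/seteqP; split => w /=; rewrite in_itv/= andbT.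
rewrite -/s => ->; rewrite /normal_prob.
apply: (@le_trans _ _ (\int[mu]_(x in `[c, +oo[)
    ((expR (s2 / 2 - c))%:E * (normal_pdf s2 s x)%:E))%E).
  apply: ge0_le_integral => //=.
  - by move=> x _; rewrite lee_fin normal_pdf_ge0.
  - apply/measurable_funTS/measurable_EFinP; exact: measurable_normal_pdf.
  - apply/measurable_funTS; apply: emeasurable_funM => //.
    apply/measurable_EFinP; exact: measurable_normal_pdf.
  - move=> x; rewrite in_itv/= andbT => cx.
    rewrite -EFinM lee_fin !normal_pdfE// /normal_fun subr0.
    rewrite mulrCA ler_pM2l ?normal_peak_gt0// -expRD ler_expR ss.
    have -> : s2 / 2 - c + - (x - s2) ^+ 2 / (s2 *+ 2) = - x ^+ 2 / (s2 *+ 2) + (x - c).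
      by field; rewrite gt_eqF.
    by rewrite lerDl subr_ge0.
rewrite ge0_integralZl//.
- rewrite -[leRHS]mule1 lee_wpmul2l ?lee_fin ?expR_ge0//.
  rewrite -(integral_normal_pdf s2 s).
  apply: ge0_subset_integral => //=.
  + apply/measurable_EFinP; exact: measurable_normal_pdf.
  + by move=> x _; rewrite lee_fin normal_pdf_ge0.
- by apply/measurable_funTS/measurable_EFinP; exact: measurable_normal_pdf.
- by move=> x _; rewrite lee_fin normal_pdf_ge0.
Qed.

(** The density decreases on the positive half line, so on [[a, b]] it is least at [b]. *)
Lemma centered_gaussian_itv_ge (a b : R) : 0 < s2 -> 0 <= a -> a <= b ->
  (((b - a) * normal_pdf 0 (Num.sqrt s2) b)%:E <= P [set w | (a <= X w <= b)%R])%E.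
Proof.
move=> s20 a0 ab; case: gX => mX [[s20' _]|[_ lawX]].
  by move: s20; rewrite s20' ltxx.
have s0 : Num.sqrt s2 != 0 by rewrite gt_eqF// sqrtr_gt0.
have := lawX `[a, b]%classic (measurable_itv _).
rewrite (_ : X @^-1` _ = [set w | a <= X w <= b]); last first.
  by apply/seteqP; split => w /=; rewrite in_itv.
move=> ->; rewrite /normal_prob.
apply: (@le_trans _ _ (\int[mu]_(x in `[a, b]) (normal_pdf 0 (Num.sqrt s2) b)%:E)%E).
  rewrite integral_cst//= lebesgue_measure_itv/= lte_fin.
  case: ltP => // ba; first by rewrite -EFinD -EFinM lee_fin mulrC.
  by rewrite mule0 lee_fin mulr_le0_ge0// ?subr_le0// normal_pdf_ge0.
apply: ge0_le_integral => //=.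
- by move=> x _; rewrite lee_fin normal_pdf_ge0.
- apply/measurable_funTS/measurable_EFinP; exact: measurable_normal_pdf.
- move=> x; rewrite in_itv/= => /andP[ax xb].
  rewrite lee_fin !normal_pdf0E// ler_pM2l ?normal_peak_gt0// ler_expR.
  rewrite !mulNr lerN2 ler_pM2r.
    by rewrite ler_pXn2r// nnegrE (le_trans a0)// (le_trans ax).
  by rewrite invr_gt0 pmulrn_rgt0// exprn_even_gt0.
Qed.

End gaussian_variable.

(** * Indicators of symmetric intervals as limits of polynomials in cosines *)

Section step_approximation.
Variable R : realType.
Implicit Types x y q : R.

Lemma bernoulli_ineq (x : R) n : -1 <= x -> 1 + n%:R * x <= (1 + x) ^+ n.
Proof.
move=> x1; elim: n => [|n IH]; first by rewrite mul0r addr0 expr0.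
rewrite exprS -natr1.
have h : 0 <= 1 + x by rewrite addrC -lerBlDr sub0r.
apply: (le_trans _ (ler_wpM2l h IH)).
have : 0 <= n%:R * (x * x) by rewrite mulr_ge0// -expr2 sqr_ge0.
lra.
Qed.

Lemma cvgn_natM_expr q : 0 <= q -> q < 1 ->
  (fun m : nat => m%:R * q ^+ m) @ \oo --> (0 : R).
Proof.
move=> q0 q1; have [->|qn0] := eqVneq q 0.
  apply: cvg_near_cst; near=> m.
  rewrite expr0n gtn_eqF ?mulr0//.
  by near: m; exact: nbhs_infty_gt.
(* In [q ^ m = r ^ m * r ^ m] one factor beats [m] by Bernoulli's inequality and the other still
   tends to 0. *)
pose r := Num.sqrt q.
have r0 : 0 < r by rewrite sqrtr_gt0 lt_neqAle eq_sym qn0.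
have r1 : r < 1 by rewrite -sqrtr1 ltr_sqrt.
have qE : q = r * r by rewrite -expr2 sqr_sqrtr.
pose a := r^-1 - 1.
have a0 : 0 < a by rewrite subr_gt0 invf_gt1.
apply: (@squeeze_cvgr _ _ _ _ (cst 0) (fun m => a^-1 * r ^+ m)).
- near=> m; rewrite /= mulr_ge0 ?exprn_ge0//=.
  rewrite qE exprMn mulrA ler_pM2r ?exprn_gt0//.
  rewrite -ler_pdivlMr ?exprn_gt0// ler_pdivlMl// -exprVn.
  have -> : r^-1 = 1 + a by rewrite /a addrCA subrr addr0.
  have /(bernoulli_ineq m) : -1 <= a by rewrite (le_trans _ (ltW a0))// lerN10.
  by apply: le_trans; rewrite mulrC lerDr.
- exact: cvg_cst.
- rewrite -[X in _ --> X](mulr0 a^-1); apply: cvgM; first exact: cvg_cst.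
  by apply: cvg_expr; rewrite ger0_norm// ltW.
Unshelve. all: by end_near. Qed.

(* The exponent [m * k ^ m] makes the limit at [k * u = 1] vanish too. *)
Lemma cvgn_step (k : nat) (u : R) : 0 <= u <= 1 ->
  (fun m : nat => (1 - u ^+ m) ^+ (m * k ^ m)) @ \oo -->
  (if k%:R * u < 1 then 1 else 0 : R).
Proof.
move=> /andP[u0 u1].
have um m : 0 <= u ^+ m <= 1 by rewrite exprn_ge0//= exprn_ile1.
case: ifPn => [ku|]; last first.
  rewrite -leNgt => ku.
  (* Here [(1 - u ^ m) ^ (k ^ m) <= expR (- (k * u) ^ m) <= expR (- 1)], and the remaining exponent
     [m] sends this to 0. *)
  apply: (@squeeze_cvgr _ _ _ _ (cst 0) (fun m => expR (- 1) ^+ m)).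
  - near=> m; rewrite /= exprn_ge0 ?subr_ge0//=; last by case/andP: (um m).
    rewrite mulnC exprM.
    apply: lerXn2r; rewrite ?nnegrE ?exprn_ge0 ?expR_ge0 ?subr_ge0//.
      by case/andP: (um m).
    apply: (@le_trans _ _ (expR (- u ^+ m) ^+ (k ^ m))).
      apply: lerXn2r; rewrite ?nnegrE ?expR_ge0 ?subr_ge0//.
        by case/andP: (um m).
      exact: expR_ge1Dx.
    rewrite -expRM_natl ler_expR natrX mulrN lerN2 -exprMn.
    exact: exprn_ege1.
  - exact: cvg_cst.
  - by apply: cvg_expr; rewrite ger0_norm ?expR_ge0// -expR0 ltr_expR oppr_lt0.
(* By Bernoulli's inequality the defect from 1 is at most [m * (k * u) ^ m]. *)
apply: (@squeeze_cvgr _ _ _ _ (fun m => 1 - m%:R * (k%:R * u) ^+ m) (cst 1)).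
- near=> m; apply/andP; split.
    apply: le_trans (bernoulli_ineq _ _) => /=; last first.
      by rewrite lerN2; case/andP: (um m).
    by rewrite natrM natrX mulrN exprMn mulrA.
  apply: exprn_ile1; first by rewrite subr_ge0; case/andP: (um m).
  by rewrite lerBlDr lerDl; case/andP: (um m).
- rewrite -[X in _ --> X]subr0; apply: (@cvgB _ R^o); first exact: cvg_cst.
  by apply: cvgn_natM_expr => //; rewrite mulr_ge0.
- exact: cvg_cst.
Unshelve. all: by end_near. Qed.

(** Yields both [|sin y| <= |y|] and, for small [y], a lower bound on [|sin y|] by almost [|y|]; the
    two halves of [cvgn_step_arg] use one each. *)
Lemma sin_mvt y : exists2 c, `|c| <= `|y| & sin y = cos c * y.
Proof.
have main (z : R) : 0 < z -> exists2 c, `|c| <= `|z| & sin z = cos c * z.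
  move=> z0; have [|c] := @MVT R sin cos 0 z z0 (fun x _ => is_derive_sin x).
    exact/continuous_subspaceT/continuous_sin.
  rewrite in_itv/= sin0 !subr0 => /andP[c0 cz] ->; exists c => //.
  by rewrite !ger0_norm ?ltW.
have [y0|y0|<-] := ltgtP 0 y; first exact: main.
- have [|c cy e] := main (- y); first by rewrite oppr_gt0.
  exists c; first by rewrite -[leRHS]normrN.
  by apply: oppr_inj; rewrite -sinN e mulrN.
- by exists 0 => //; rewrite sin0 mulr0.
Qed.

(** A number in [[0, 1]], affine in a cosine of a multiple of [x], such that [k.+1 * step_arg s k x]
    tends to [(x / s) ^ 2]; the threshold 1 in [cvgn_step] thus detects [|x| <= s]. The factor
    [1 + k.+1^-1] puts the boundary [|x| = s] strictly below the threshold. *)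
Definition step_arg (s : R) (k : nat) (x : R) : R :=
  sin (x / (s * (1 + k.+1%:R^-1) * Num.sqrt k.+1%:R)) ^+ 2.

Lemma step_arg01 s k x : 0 <= step_arg s k x <= 1.
Proof.
by rewrite /step_arg sqr_ge0/= -real_normK ?num_real// exprn_ile1// normr_sin_le1.
Qed.

Lemma cvgn_step_arg s x : 0 < s ->
  (fun k : nat => if k.+1%:R * step_arg s k x < 1 then 1 else 0 : R) @ \oo -->
  (if `|x| <= s then 1 else 0 : R).
Proof.
move=> s0.
pose y k := x / (s * (1 + k.+1%:R^-1) * Num.sqrt k.+1%:R).
have k1 k : 0 < 1 + k.+1%:R^-1 :> R by rewrite addr_gt0// invr_gt0.
have sk k : 0 < Num.sqrt k.+1%:R :> R by rewrite sqrtr_gt0.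
have yE k : k.+1%:R * y k ^+ 2 = (`|x| / (s * (1 + k.+1%:R^-1))) ^+ 2.
  rewrite /y !exprMn !exprVn !exprMn sqr_sqrtr// real_normK ?num_real//.
  by field; rewrite !gt_eqF.
case: ifPn => [xs|].
  apply: cvg_near_cst; apply: nearW => k; rewrite ifT//.
  have [c _ e] := sin_mvt (y k).
  rewrite /step_arg -/(y k) e exprMn mulrCA yE.
  apply: (@le_lt_trans _ _ ((`|x| / (s * (1 + k.+1%:R^-1))) ^+ 2)).
    apply: ler_piMl; first exact: sqr_ge0.
    by rewrite -real_normK ?num_real// exprn_ile1// normr_cos_le1.
  rewrite exprn_ilt1// ?divr_ge0// ?mulr_ge0 ?ltW//.
  rewrite ltr_pdivrMr ?mulr_gt0// mul1r (le_lt_trans xs)//.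
  by rewrite ltr_pMr// ltrDl invr_gt0.
rewrite -ltNge => sx.
have x0 : 0 < `|x| by exact: lt_trans sx.
(* Midway between [s / |x|] and 1: then [rho * |x| / s > 1] leaves room for the factor [1 + k.+1^-1]
   once [cos c > rho]. *)
pose rho := (s / `|x| + 1) / 2.
have sx1 : s / `|x| < 1 by rewrite ltr_pdivrMr// mul1r.
have sx0 : 0 < s / `|x| by rewrite divr_gt0.
have rho1 : rho < 1 by rewrite /rho; lra.
have rho0 : 0 < rho by rewrite /rho; lra.
have rhox : 1 < rho * `|x| / s.
  rewrite ltr_pdivlMr// mul1r -ltr_pdivrMr// /rho; lra.
have [e /= e0 He] : exists2 e, 0 < e & forall c : R, `|c| < e -> rho < cos c.
  have /cvgrPdist_lt/(_ (1 - rho)) := @continuous_cos R 0.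
  rewrite subr_gt0 => /(_ rho1) [e /= e0 H]; exists e => // c ce.
  have := H c; rewrite /= sub0r normrN => /(_ ce).
  rewrite cos0 ltr_norml => /andP[_]; rewrite ltrBlDr addrC -ltrBlDr.
  lra.
apply: cvg_near_cst; near=> k; rewrite ifF//; apply/negbTE; rewrite -leNgt.
have [c cy ec] := sin_mvt (y k).
rewrite /step_arg -/(y k) ec exprMn mulrCA yE.
have yk : `|y k| < e.
  have d0 : 0 < s * (1 + k.+1%:R^-1) * Num.sqrt k.+1%:R :> R by rewrite !mulr_gt0.
  rewrite /y normrM normfV (gtr0_norm d0) ltr_pdivrMr// (@lt_le_trans _ _ (e * (s * Num.sqrt k.+1%:R)))//.
    rewrite -ltr_pdivrMl// -ltr_pdivrMl// -[ltLHS]ger0_norm; last first.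
      by rewrite !mulr_ge0// ?invr_ge0// ltW.
    rewrite -sqrtr_sqr ltr_sqrt//.
    apply: (@lt_trans _ _ k%:R); last by rewrite ltr_nat.
    near: k; exact: nbhs_infty_gtr.
  by rewrite ler_pM2l// -mulrA ler_pM2l// ler_peMl ?ltW// ltrDl invr_gt0.
have rc : rho < cos c by apply: He; exact: le_lt_trans yk.
rewrite -exprMn exprn_ege1// mulrA ler_pdivlMr ?mulr_gt0// mul1r.
apply: (@le_trans _ _ (rho * `|x|)); last by rewrite ler_pM2r// ltW.
rewrite -ler_pdivlMl// mulrC.
have -> : rho * `|x| / s = 1 + (rho * `|x| / s - 1) by rewrite addrCA subrr addr0.
rewrite lerD2l -[leRHS]invrK lef_pV2 ?posrE// ?invr_gt0 ?subr_gt0//.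
apply: (@le_trans _ _ k%:R); last by rewrite ler_nat.
near: k; exact: nbhs_infty_ger.
Unshelve. all: by end_near. Qed.

End step_approximation.

(** * Transfer of box probabilities *)

Section bounded_measurable.
Variables (R : realType) (d : measure_display) (T : measurableType d).
Variable P : probability T R.
Implicit Types F G : T -> R.

Definition bdd_meas F := measurable_fun setT F /\ exists M : R, forall w, `|F w| <= M.

Lemma bdd_meas_integrable F : bdd_meas F -> P.-integrable setT (EFin \o F).
Proof.
move=> [mF [M FM]]; apply: measurable_bounded_integrable => //.
- by apply: (@le_lt_trans _ _ 1%E); [exact: probability_le1|exact: ltry].
- by exists M; split => [|N MN w _]; [exact: num_real|exact: (le_trans (FM w) (ltW MN))].
Qed.

Lemma bdd_meas_cst (c : R) : bdd_meas (fun=> c).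
Proof. by split => //; exists `|c|. Qed.

Lemma bdd_measM F G : bdd_meas F -> bdd_meas G -> bdd_meas (fun w => F w * G w).
Proof.
move=> [mF [M FM]] [mG [N GN]]; split; first exact: measurable_funM.
by exists (M * N) => w; rewrite normrM ler_pM.
Qed.

Lemma bdd_measD F G : bdd_meas F -> bdd_meas G -> bdd_meas (fun w => F w + G w).
Proof.
move=> [mF [M FM]] [mG [N GN]]; split; first exact: measurable_funD.
by exists (M + N) => w; rewrite (le_trans (ler_normD _ _))// lerD.
Qed.

Lemma bdd_meas_cos F : measurable_fun setT F -> bdd_meas (fun w => cos (F w)).
Proof.
move=> mF; split; last by exists 1 => w; exact: normr_cos_le1.
apply: (@measurableT_comp _ _ _ _ _ _ (@cos R)) => //.
by apply: continuous_measurable_fun; exact: continuous_cos.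
Qed.

Lemma bdd_meas_indic (A : set T) : measurable A -> bdd_meas (\1_A : T -> R).
Proof.
move=> mA; split; first exact: measurable_indic.
by exists 1 => w; rewrite indicE; case: (_ \in _); rewrite ?normr1 ?normr0.
Qed.

Lemma Rintegral_indic_probability (A : set T) : measurable A ->
  \int[P]_w (\1_A w : R) = fine (P A).
Proof. by move=> mA; rewrite /Rintegral integral_indic// setIT. Qed.

Lemma bdd_meas_cvg (F : nat -> T -> R) G (M : R) :
  (forall n, bdd_meas (F n)) -> (forall n w, `|F n w| <= M) ->
  (forall w, (F^~ w) @ \oo --> G w) ->
  bdd_meas G /\ (fun n => \int[P]_w F n w) @ \oo --> \int[P]_w G w.
Proof.
move=> bF FM FG.
have mG : measurable_fun setT G.
  by apply: (@measurable_fun_cvg _ _ _ _ F) => [n|w _]; [case: (bF n)|exact: FG].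
have bG : bdd_meas G.
  split => //; exists M => w; apply: (closed_cvg (fun x => `|x| <= M)) (FG w).
    exact: (closed_comp (fun x _ => @norm_continuous _ _ x) (@closed_le R M)).
  exact: nearW.
split=> //.
have := @dominated_cvg _ _ _ P setT measurableT (fun n w => (F n w)%:E)
  (fun w => (G w)%:E) (fun=> M%:E).
have iF n := bdd_meas_integrable (bF n).
have iG := bdd_meas_integrable bG.
move=> /(_ _)/wrap[n|]; first by apply/measurable_EFinP; case: (bF n).
move=> /(_ _)/wrap[w _|].
  by apply: cvg_EFin; [exact: nearW|exact: FG].
move=> /(_ _)/wrap[//|]; move=> /(_ _)/wrap[|].
  exact: (bdd_meas_integrable (bdd_meas_cst M)).
move=> /(_ _)/wrap[n w _|]; first by rewrite lee_fin.
have -> : (\int[P]_w (G w)%:E)%E = (\int[P]_w G w)%:E.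
  by rewrite /Rintegral fineK//; exact: integrable_fin_num.
by move/fine_cvg.
Qed.

End bounded_measurable.

Section transfer.
Variables (R : realType) (d : measure_display) (T : measurableType d).
Variable P : probability T R.
Variables (X Y : nat -> T -> R).
Hypotheses (mX : forall i, measurable_fun setT (X i))
           (mY : forall i, measurable_fun setT (Y i)).
Variable kap : R.

Definition lincomb (Z : nat -> T -> R) (r : seq (nat * R)) (w : T) : R :=
  \sum_(p <- r) p.2 * Z p.1 w.

Lemma measurable_lincomb (Z : nat -> T -> R) r :
  (forall i, measurable_fun setT (Z i)) -> measurable_fun setT (lincomb Z r).
Proof. by move=> mZ; apply: measurable_sum => p; exact: measurable_funM. Qed.

(** Equality of the law of [X] weighted by [F] and that of [Y] weighted by [kap * G], tested on
    cosines. The weights cover two uses at once: constant weights compare two laws, while an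
    indicator or a cosine as [F], its mean as [kap] and [G = 1] express independence. *)
Definition matched (F G : T -> R) := [/\ bdd_meas F, bdd_meas G &
  forall r, \int[P]_w (F w * cos (lincomb X r w)) =
    kap * \int[P]_w (G w * cos (lincomb Y r w))].

(* [h] evaluated at the [i]-th coordinate preserves [matched]; such multipliers
   form an algebra closed under bounded pointwise limits. *)
Definition multiplier i (h : R -> R) :=
  forall F G, matched F G ->
    matched (fun w => F w * h (X i w)) (fun w => G w * h (Y i w)).

Let bcos (Z : nat -> T -> R) r : (forall i, measurable_fun setT (Z i)) ->
  bdd_meas (fun w => cos (lincomb Z r w)).
Proof. by move=> mZ; apply: bdd_meas_cos; exact: measurable_lincomb. Qed.

Lemma multiplier_cst i c : multiplier i (fun=> c).
Proof.
move=> F G [bF bG FG]; split.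
- by apply: bdd_measM => //; exact: bdd_meas_cst.
- by apply: bdd_measM => //; exact: bdd_meas_cst.
move=> r; under eq_Rintegral do rewrite mulrAC.
under [in RHS]eq_Rintegral do rewrite mulrAC.
have ? := bcos r mX; have ? := bcos r mY.
rewrite RintegralZr//; last exact/bdd_meas_integrable/bdd_measM.
rewrite RintegralZr//; last exact/bdd_meas_integrable/bdd_measM.
by rewrite FG mulrA.
Qed.

Lemma multiplierD i h1 h2 : multiplier i h1 -> multiplier i h2 ->
  multiplier i (fun x => h1 x + h2 x).
Proof.
move=> m1 m2 F G FG; have [bF1 bG1 e1] := m1 _ _ FG; have [bF2 bG2 e2] := m2 _ _ FG.
split.
- by have := bdd_measD bF1 bF2; congr bdd_meas; apply/funext => w; rewrite mulrDr.
- by have := bdd_measD bG1 bG2; congr bdd_meas; apply/funext => w; rewrite mulrDr.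
move=> r; have ? := bcos r mX; have ? := bcos r mY.
under eq_Rintegral do rewrite mulrDr mulrDl.
under [in RHS]eq_Rintegral do rewrite mulrDr mulrDl.
rewrite RintegralD//; [|exact/bdd_meas_integrable/bdd_measM..].
rewrite RintegralD//; [|exact/bdd_meas_integrable/bdd_measM..].
by rewrite e1 e2 mulrDr.
Qed.

Lemma multiplierM i h1 h2 : multiplier i h1 -> multiplier i h2 ->
  multiplier i (fun x => h1 x * h2 x).
Proof.
move=> m1 m2 F G /m1/m2; congr matched; by apply/funext => w; rewrite mulrA.
Qed.

Lemma multiplierX i h n : multiplier i h -> multiplier i (fun x => h x ^+ n).
Proof.
move=> mh; elim: n => [|n IH]; first exact: multiplier_cst.
have -> : (fun x => h x ^+ n.+1) = (fun x => h x * h x ^+ n).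
  by apply/funext => x; rewrite exprS.
exact: multiplierM.
Qed.

(** Product-to-sum: multiplying by [cos (th * x)] only adds a term [th] or [- th] to the linear
    combination being tested. *)
Lemma multiplier_cos i th : multiplier i (fun x => cos (th * x)).
Proof.
move=> F G [bF bG FG].
have bX : bdd_meas (fun w => cos (th * X i w)).
  by apply: bdd_meas_cos; exact: measurable_funM.
have bY : bdd_meas (fun w => cos (th * Y i w)).
  by apply: bdd_meas_cos; exact: measurable_funM.
split; [exact: bdd_measM..|].
have key (Z : nat -> T -> R) (H : T -> R) r : bdd_meas H ->
    (forall j, measurable_fun setT (Z j)) ->
    \int[P]_w (H w * cos (th * Z i w) * cos (lincomb Z r w)) =
    2^-1 * (\int[P]_w (H w * cos (lincomb Z ((i, th) :: r) w)) +
            \int[P]_w (H w * cos (lincomb Z ((i, - th) :: r) w))).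
  move=> bH mZ; have ? := bcos ((i, th) :: r) mZ; have ? := bcos ((i, - th) :: r) mZ.
  rewrite -RintegralD//; [|exact/bdd_meas_integrable/bdd_measM..].
  rewrite -RintegralZl//; last first.
    by apply: bdd_meas_integrable; apply: bdd_measD; exact: bdd_measM.
  apply: eq_Rintegral => w _.
  rewrite /lincomb !big_cons/= mulNr.
  by rewrite [- _ + _]addrC cosD cosB; field.
move=> r; rewrite key// [in RHS]key// !FG; ring.
Qed.

Lemma multiplier_lim i (h : nat -> R -> R) g (M : R) :
  (forall n, multiplier i (h n)) -> (forall n x, `|h n x| <= M) ->
  (forall x, (h^~ x) @ \oo --> g x) -> multiplier i g.
Proof.
move=> mh hM hg F G FG; have [[mF [MF FMF]] [mG [MG GMG]] _] := FG.
have key (Z : nat -> T -> R) (H : T -> R) MH : (forall j, measurable_fun setT (Z j)) ->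
    (forall w, `|H w| <= MH) -> (forall n, bdd_meas (fun w => H w * h n (Z i w))) ->
    bdd_meas (fun w => H w * g (Z i w)) /\
    forall r, (fun n => \int[P]_w (H w * h n (Z i w) * cos (lincomb Z r w))) @ \oo -->
      \int[P]_w (H w * g (Z i w) * cos (lincomb Z r w)).
  move=> mZ HMH bH.
  have cvgH w : (fun n => H w * h n (Z i w)) @ \oo --> H w * g (Z i w).
    by apply: cvgM; [exact: cvg_cst|exact: hg].
  have HM n w : `|H w * h n (Z i w)| <= MH * M by rewrite normrM ler_pM.
  split; first by have [] := bdd_meas_cvg P bH HM cvgH.
  move=> r.
  have bHc n : bdd_meas (fun w => H w * h n (Z i w) * cos (lincomb Z r w)).
    by apply: bdd_measM => //; exact: bcos.
  have HcM n w : `|H w * h n (Z i w) * cos (lincomb Z r w)| <= MH * M.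
    by rewrite normrM -[leRHS]mulr1 ler_pM// normr_cos_le1.
  have cvgHc w : (fun n => H w * h n (Z i w) * cos (lincomb Z r w)) @ \oo -->
      H w * g (Z i w) * cos (lincomb Z r w).
    by apply: cvgM; [exact: cvgH|exact: cvg_cst].
  by have [] := bdd_meas_cvg P bHc HcM cvgHc.
have [bFg limX] := key X F MF mX FMF (fun n => let: And3 b _ _ := mh n _ _ FG in b).
have [bGg limY] := key Y G MG mY GMG (fun n => let: And3 _ b _ := mh n _ _ FG in b).
split => // r.
apply: (cvg_unique _ (limX r)); first exact: Rhausdorff.
rewrite /= (_ : (fun n => _) = (fun n => kap * \int[P]_w (G w * h n (Y i w) *
    cos (lincomb Y r w)))); first by apply: cvgM; [exact: cvg_cst|exact: limY].
by apply/funext => n; have [_ _ ->] := mh n _ _ FG.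
Qed.

(** Two nested limits: for fixed [k] the powers of [cvgn_step] converge in [m] to the threshold
    indicator, and these indicators converge in [k] to that of the interval. The square of the sine
    enters as [(1 - cos (2 * y)) / 2]. *)
Lemma multiplier_box i s : 0 < s ->
  multiplier i (fun x => if `|x| <= s then 1 else 0).
Proof.
move=> s0.
pose g k (x : R) : R := if k.+1%:R * step_arg s k x < 1 then 1 else 0.
apply: (@multiplier_lim _ g _ 1) => [k|k x|x]; last exact: cvgn_step_arg.
  have mu : multiplier i (step_arg s k).
    pose th : R := 2 / (s * (1 + k.+1%:R^-1) * Num.sqrt k.+1%:R).
    have -> : step_arg s k = (fun x => 2^-1 + (- 2^-1) * cos (th * x)).
      apply/funext => x; rewrite /step_arg; set y := x / _.
      have -> : th * x = y + y by rewrite /th /y; ring.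
      by rewrite cosD -!expr2 cos2sin2; field.
    apply: multiplierD; first exact: multiplier_cst.
    by apply: multiplierM; [exact: multiplier_cst|exact: multiplier_cos].
  apply: (@multiplier_lim _ (fun m x =>
    (1 + (- 1) * step_arg s k x ^+ m) ^+ (m * k.+1 ^ m)) _ 1) => [m|m x|x].
  - apply: multiplierX; apply: multiplierD; first exact: multiplier_cst.
    by apply: multiplierM; [exact: multiplier_cst|exact: multiplierX].
  - rewrite mulN1r; have /andP[u0 u1] := step_arg01 s k x.
    have : 0 <= step_arg s k x ^+ m <= 1 by rewrite exprn_ge0//= exprn_ile1.
    move=> /andP[a0 a1]; rewrite normrX exprn_ile1//.
    rewrite ger0_norm ?subr_ge0//; lra.
  - under eq_fun do rewrite mulN1r.
    exact/cvgn_step/step_arg01.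
by rewrite /g; case: ifP; rewrite ?normr1 ?normr0.
Qed.

Definition box (Z : nat -> T -> R) (k : nat) (s : R) : set T :=
  [set w | forall i, (i < k)%N -> `|Z i w| <= s].

Lemma box_indic (Z : nat -> T -> R) k s w :
  \1_(box Z k s) w = \prod_(i < k) (if `|Z i w| <= s then 1 else 0) :> R.
Proof.
rewrite indicE; case: (boolP (w \in _)) => [|/negP].
  by rewrite inE => h; rewrite big1// => i _; rewrite h.
rewrite inE => /existsNP[i] /not_implyP[ik].
by move=> /negP/negbTE h; rewrite (bigD1 (Ordinal ik))//= h mul0r.
Qed.

Lemma measurable_box (Z : nat -> T -> R) k s :
  (forall i, measurable_fun setT (Z i)) -> measurable (box Z k s).
Proof.
move=> mZ.
have -> : box Z k s = \bigcap_(i in [set i | (i < k)%N]) [set w | `|Z i w| <= s].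
  by apply/seteqP; split => w /= h i /=; exact: h.
apply: bigcap_measurableType => i _; rewrite -[X in measurable X]setTI.
by apply: measurable_fun_le => //; exact: measurableT_comp.
Qed.

Lemma transfer_box (F G : T -> R) k s : 0 < s -> matched F G ->
  \int[P]_w (F w * \1_(box X k s) w) = kap * \int[P]_w (G w * \1_(box Y k s) w).
Proof.
move=> s0 FG.
have : matched (fun w => F w * \1_(box X k s) w) (fun w => G w * \1_(box Y k s) w).
  have e (H : T -> R) (Z : nat -> T -> R) : (fun w => H w * \1_(box Z k s) w) =
      (fun w => H w * \prod_(i < k) (if `|Z i w| <= s then 1 else 0)).
    by apply/funext => w; rewrite box_indic.
  rewrite !e {e}; elim: k => [|k IH].
    have := FG; congr matched; apply/funext => w; by rewrite big_ord0 mulr1.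
  have := multiplier_box k s0 IH.
  by congr matched; apply/funext => w; rewrite big_ord_recr/= mulrA.
(* The empty combination tests against [cos 0 = 1], which leaves the bare integrals. *)
move=> [_ _ /(_ [::])].
have c1 (Z : nat -> T -> R) w : cos (lincomb Z [::] w) = 1.
  by rewrite /lincomb big_nil cos0.
under eq_Rintegral do rewrite c1 mulr1.
by under [in RHS]eq_Rintegral do rewrite c1 mulr1.
Qed.

End transfer.

(** * Linear functionals of the Gaussian family *)

Section gaussian_family.
Variables (R : realType) (v : R -> R).
Variables (d : measure_display) (T : measurableType d) (P : probability T R).
Variable A : nat -> T -> R -> R.
Hypothesis A_law : iid_gaussian_family P v A.
Local Notation V := (seq (nat * R * R)).
Implicit Types l m : V.

Definition ev l (w : T) : R := \sum_(p <- l) p.2 * A p.1.1 w p.1.2.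

Definition cov l m : R := \sum_(p <- l) \sum_(q <- m)
  p.2 * q.2 * (if p.1.1 == q.1.1 then Gam v p.1.2 q.1.2 else 0).

Definition vscale (c : R) l : V := [seq (p.1, c * p.2) | p <- l].

Lemma ev_gaussian l : centered_gaussian P (ev l) (cov l l).
Proof. exact: A_law. Qed.

Lemma measurable_ev l : measurable_fun setT (ev l).
Proof. by have [] := ev_gaussian l. Qed.

Lemma ev_cat l m w : ev (l ++ m) w = ev l w + ev m w.
Proof. by rewrite /ev big_cat. Qed.

Lemma ev_scale c l w : ev (vscale c l) w = c * ev l w.
Proof.
by rewrite /ev /vscale big_map mulr_sumr; apply: eq_bigr => p _; rewrite mulrA.
Qed.

Lemma Gam_sym s t : Gam v s t = Gam v t s.
Proof. by rewrite /Gam (distrC t s) [v `|s| + _]addrC. Qed.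

Lemma cov_sym l m : cov l m = cov m l.
Proof.
rewrite /cov exchange_big; apply: eq_bigr => p _; apply: eq_bigr => q _.
by rewrite [q.2 * _]mulrC eq_sym Gam_sym.
Qed.

Lemma cov_catl l1 l2 m : cov (l1 ++ l2) m = cov l1 m + cov l2 m.
Proof. by rewrite /cov big_cat. Qed.

Lemma cov_catr l1 l2 m : cov m (l1 ++ l2) = cov m l1 + cov m l2.
Proof. by rewrite cov_sym cov_catl !(cov_sym _ m). Qed.

Lemma cov_scalel c l m : cov (vscale c l) m = c * cov l m.
Proof.
rewrite /cov /vscale big_map mulr_sumr; apply: eq_bigr => p _.
by rewrite mulr_sumr; apply: eq_bigr => q _; rewrite /= !mulrA.
Qed.

Lemma cov_scaler c l m : cov l (vscale c m) = c * cov l m.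
Proof. by rewrite cov_sym cov_scalel cov_sym. Qed.

Lemma cov_ge0 l : 0 <= cov l l.
Proof. by have [_ [[->]|[/ltW]]] := ev_gaussian l. Qed.

Definition covE := (cov_catl, cov_catr, cov_scalel, cov_scaler).

Lemma Rintegral_cos_ev l : \int[P]_w cos (ev l w) = expR (- cov l l / 2).
Proof. exact: (centered_gaussian_cos (ev_gaussian l)). Qed.

(** When [cov l m = 0] the sum and the difference of [l] and [m] have the same variance, so the
    product-to-sum formula factorizes. *)
Lemma Rintegral_cosM_ev l m : cov l m = 0 ->
  \int[P]_w (cos (ev l w) * cos (ev m w)) =
  (\int[P]_w cos (ev l w)) * (\int[P]_w cos (ev m w)).
Proof.
move=> lm0.
have bc l' : bdd_meas (fun w => cos (ev l' w)).
  by apply: bdd_meas_cos; exact: measurable_ev.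
transitivity (\int[P]_w (2^-1 * (cos (ev (l ++ m) w) + cos (ev (l ++ vscale (-1) m) w)))).
  apply: eq_Rintegral => w _; rewrite !ev_cat ev_scale mulN1r cosD cosB; by field.
rewrite RintegralZl//; last exact/bdd_meas_integrable/bdd_measD.
rewrite RintegralD//; [|exact/bdd_meas_integrable..].
rewrite !Rintegral_cos_ev -expRD !covE (cov_sym m l) lm0.
have -> : cov l l + -1 * 0 + (-1 * 0 + -1 * (-1 * cov m m)) = cov l l + 0 + (0 + cov m m) by ring.
have -> : - (cov l l + 0 + (0 + cov m m)) / 2 = - cov l l / 2 + - cov m m / 2 by field.
by field.
Qed.

Definition vlin (ls : nat -> V) (r : seq (nat * R)) : V :=
  flatten [seq vscale p.2 (ls p.1) | p <- r].

Lemma lincomb_ev (ls : nat -> V) r w :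
  lincomb (fun i => ev (ls i)) r w = ev (vlin ls r) w.
Proof.
elim: r => [|p r IH]; first by rewrite /lincomb /ev !big_nil.
by rewrite /lincomb big_cons /vlin/= ev_cat ev_scale; congr (_ + _).
Qed.

Lemma cov_vlinl ls r m : cov (vlin ls r) m = \sum_(p <- r) p.2 * cov (ls p.1) m.
Proof.
elim: r => [|p r IH]; first by rewrite big_nil /cov big_nil.
by rewrite big_cons /vlin/= cov_catl cov_scalel; congr (_ + _).
Qed.

Lemma cov_vlin ls ms r r' : cov (vlin ls r) (vlin ms r') =
  \sum_(p <- r) \sum_(q <- r') p.2 * (q.2 * cov (ls p.1) (ms q.1)).
Proof.
rewrite cov_vlinl; apply: eq_bigr => p _.
rewrite cov_sym cov_vlinl mulr_sumr; apply: eq_bigr => q _.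
by rewrite (cov_sym (ms _)).
Qed.

Definition pr (B : set T) : R := fine (P B).

Lemma prE B : measurable B -> P B = (pr B)%:E.
Proof. by move=> mB; rewrite /pr fineK// fin_num_measure. Qed.

Lemma pr_le1 B : measurable B -> pr B <= 1.
Proof. by move=> mB; rewrite -lee_fin -prE// probability_le1. Qed.

Lemma pr_ge0 B : 0 <= pr B.
Proof. by rewrite /pr fine_ge0. Qed.

Lemma pr_le B C : measurable B -> measurable C -> B `<=` C -> pr B <= pr C.
Proof. by move=> mB mC BC; rewrite -lee_fin -!prE// le_measure// inE. Qed.

Lemma prC B : measurable B -> pr (~` B) = 1 - pr B.
Proof.
move=> mB; apply: EFin_inj; rewrite -prE; last exact: measurableC.
by rewrite probability_setC// prE.
Qed.

Lemma prU_le B C : measurable B -> measurable C -> pr (B `|` C) <= pr B + pr C.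
Proof.
move=> mB mC; rewrite -lee_fin EFinD -!prE//; last exact: measurableU.
exact: measureU2.
Qed.

Lemma prDI B C : measurable B -> measurable C -> pr (B `&` ~` C) = pr B - pr (B `&` C).
Proof.
move=> mB mC; apply/eqP; rewrite eq_sym subr_eq; apply/eqP/EFin_inj.
have mBC := measurableI _ _ mB mC; have mBC' := measurableI _ _ mB (measurableC mC).
rewrite EFinD -!prE// -measureU//.
  by rewrite -setIUr setUC setUv setIT.
by rewrite setIACA setICl setI0.
Qed.

Local Notation boxev ls k s := (box (fun i => ev (ls i)) k s).

Lemma measurable_boxev ls k s : measurable (boxev ls k s).
Proof. by apply: measurable_box => i; exact: measurable_ev. Qed.

Lemma pr_box_same_cov ls ms k s : 0 < s ->
  (forall i j, cov (ls i) (ls j) = cov (ms i) (ms j)) ->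
  pr (boxev ls k s) = pr (boxev ms k s).
Proof.
move=> s0 lm.
have := @transfer_box _ _ _ P (fun i => ev (ls i)) (fun i => ev (ms i))
  (fun i => measurable_ev (ls i)) (fun i => measurable_ev (ms i)) 1
  (fun=> 1) (fun=> 1) k s s0.
move=> /(_ _)/wrap[|].
  split; [exact: bdd_meas_cst..|] => r.
  under eq_Rintegral do rewrite mul1r lincomb_ev.
  under [in RHS]eq_Rintegral do rewrite mul1r lincomb_ev.
  rewrite mul1r !Rintegral_cos_ev !cov_vlin.
  by under eq_bigr do under eq_bigr do rewrite lm.
under eq_Rintegral do rewrite mul1r.
under [in RHS]eq_Rintegral do rewrite mul1r.
by rewrite mul1r !Rintegral_indic_probability//; exact: measurable_boxev.
Qed.

(** The transfer is applied twice. Weighting the first family by a cosine of the second decouples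
    that cosine from the first box; weighting the second family by the indicator of the first box
    then decouples the two boxes. *)
Lemma pr_box_indep ls ms k k' s t : 0 < s -> 0 < t ->
  (forall i j, cov (ls i) (ms j) = 0) ->
  pr (boxev ls k s `&` boxev ms k' t) = pr (boxev ls k s) * pr (boxev ms k' t).
Proof.
move=> s0 t0 lm0.
have mls i := measurable_ev (ls i); have mms i := measurable_ev (ms i).
have mB := measurable_boxev ls k s; have mB' := measurable_boxev ms k' t.
have step1 r' : \int[P]_w (cos (ev (vlin ms r') w) * \1_(boxev ls k s) w) =
    (\int[P]_w cos (ev (vlin ms r') w)) * pr (boxev ls k s).
  rewrite (@transfer_box _ _ _ P _ _ mls mls (\int[P]_w cos (ev (vlin ms r') w))
    _ (fun=> 1) k s s0).
    congr (_ * _); under eq_Rintegral do rewrite mul1r.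
    by rewrite Rintegral_indic_probability.
  split; [by apply: bdd_meas_cos; exact: measurable_ev|exact: bdd_meas_cst|] => r.
  under eq_Rintegral do rewrite lincomb_ev.
  under [X in _ = _ * X]eq_Rintegral do rewrite mul1r lincomb_ev.
  rewrite Rintegral_cosM_ev// cov_vlin big1// => p _; rewrite big1// => q _.
  by rewrite cov_sym lm0 !mulr0.
have := @transfer_box _ _ _ P _ _ mms mms (pr (boxev ls k s))
    (\1_(boxev ls k s)) (fun=> 1) k' t t0.
move=> /(_ _)/wrap[|].
  split; [exact: bdd_meas_indic|exact: bdd_meas_cst|] => r.
  under eq_Rintegral do rewrite lincomb_ev mulrC.
  under [X in _ = _ * X]eq_Rintegral do rewrite mul1r lincomb_ev.
  by rewrite step1 mulrC.
under [X in _ = _ * X]eq_Rintegral do rewrite mul1r.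
rewrite [in RHS]Rintegral_indic_probability// => <-.
rewrite /pr -Rintegral_indic_probability; last exact: measurableI.
by apply: eq_Rintegral => w _; rewrite indicI.
Qed.

End gaussian_family.

(** * Fernique's inequality *)

Section fernique.
Variables (R : realType) (v : R -> R).
Variables (d : measure_display) (T : measurableType d) (P : probability T R).
Variable A : nat -> T -> R -> R.
Hypothesis A_law : iid_gaussian_family P v A.
Local Notation ev := (ev A).
Local Notation cov := (cov v).
Local Notation pr := (pr P).
Local Notation boxev ls k s := (box (fun i => ev (ls i)) k s).
Implicit Types l m : seq (R * R).

Definition at_idx (i : nat) l : seq (nat * R * R) := [seq (i, p.1, p.2) | p <- l].

Definition kcov l m : R := \sum_(p <- l) \sum_(q <- m) p.2 * q.2 * Gam v p.1 q.1.

Definition apply_path l (f : R -> R) : R := \sum_(p <- l) p.2 * f p.1.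

Definition mean_path (n : nat) (w : T) (t : R) : R := n%:R^-1 * \sum_(i < n) A i w t.

Definition at_mean (n : nat) l : seq (nat * R * R) :=
  flatten [seq vscale n%:R^-1 (at_idx i l) | i <- iota 0 n].

Lemma ev_at_idx i l w : ev (at_idx i l) w = apply_path l (A i w).
Proof. by rewrite /ev /at_idx big_map. Qed.

Lemma cov_at_idx i j l m :
  cov (at_idx i l) (at_idx j m) = if i == j then kcov l m else 0.
Proof.
rewrite /cov /at_idx big_map; under eq_bigr do rewrite big_map.
case: eqP => [//|_].
by rewrite big1// => p _; rewrite big1// => q _; rewrite mulr0.
Qed.

Lemma ev_at_mean n l w : ev (at_mean n l) w = apply_path l (mean_path n w).
Proof.
have -> : ev (at_mean n l) w = \sum_(i < n) n%:R^-1 * apply_path l (A i w).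
  rewrite /at_mean -(big_mkord xpredT (fun i => n%:R^-1 * apply_path l (A i w))).
  rewrite /index_iota subn0; elim: (iota 0 n) => [|i s IH]/=.
    by rewrite big_nil /ev big_nil.
  by rewrite big_cons ev_cat ev_scale ev_at_idx IH.
rewrite /apply_path /mean_path.
under eq_bigr do rewrite mulr_sumr.
rewrite exchange_big; apply: eq_bigr => p _.
by rewrite mulrCA mulr_sumr mulr_sumr; apply: eq_bigr => i _; rewrite mulrCA.
Qed.

Lemma cov_at_mean n l m : (0 < n)%N ->
  cov (at_mean n l) (at_mean n m) = n%:R^-1 * kcov l m.
Proof.
move=> n0.
have key (s : seq nat) (B : seq (nat * R * R)) :
    cov (flatten [seq vscale n%:R^-1 (at_idx i l) | i <- s]) B =
    \sum_(i <- s) n%:R^-1 * cov (at_idx i l) B.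
  elim: s => [|i s IH]/=; first by rewrite /cov !big_nil.
  by rewrite big_cons cov_catl cov_scalel IH.
have key2 (s : seq nat) (B : seq (nat * R * R)) :
    cov B (flatten [seq vscale n%:R^-1 (at_idx i m) | i <- s]) =
    \sum_(i <- s) n%:R^-1 * cov B (at_idx i m).
  elim: s => [|i s IH]/=; first by rewrite cov_sym /cov !big_nil.
  by rewrite big_cons cov_catr cov_scaler IH.
rewrite /at_mean key.
have e i : i \in iota 0 n -> n%:R^-1 * cov (at_idx i l)
    (flatten [seq vscale n%:R^-1 (at_idx i0 m) | i0 <- iota 0 n]) =
    n%:R^-1 * (n%:R^-1 * kcov l m).
  move=> ii; rewrite key2; congr (_ * _).
  rewrite (bigD1_seq i)//= ?iota_uniq// cov_at_idx eqxx.
  rewrite big1 ?addr0// => j ji; rewrite cov_at_idx eq_sym (negbTE ji) mulr0//.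
rewrite big_seq (eq_bigr _ e) -big_seq big_const_seq count_predT size_iota.
rewrite iter_addr_0 -[LHS]mulr_natl mulrA divff ?mul1r// pnatr_eq0 -lt0n//.
Qed.

Section seminorm.
Variables (ls : nat -> seq (R * R)) (k : nat).

Let F s := pr (boxev (fun j => at_idx 0 (ls j)) k s).

Let mbox ms j s : measurable (boxev ms j s).
Proof. exact: (measurable_boxev A_law). Qed.

(** The rotated copies [U = (A_0 - A_1) / sqrt 2] and [W = (A_0 + A_1) / sqrt 2] are independent
    with the law of [A_0]. If [U] stays within [s] while [W] exceeds [t] at some functional, then
    there both [|A_0|] and [|A_1|] exceed [(t - s) / sqrt 2]. *)
Lemma fernique_step s t : 0 < s -> s < t ->
  F s * (1 - F t) <= (1 - F ((t - s) / Num.sqrt 2)) ^+ 2.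
Proof.
move=> s0 st; have t0 := lt_trans s0 st.
have q0 : 0 < Num.sqrt 2 :> R by rewrite sqrtr_gt0.
have q2 : Num.sqrt 2 * Num.sqrt 2 = 2 :> R by rewrite -expr2 sqr_sqrtr.
set r := (t - s) / _.
have r0 : 0 < r by rewrite divr_gt0// subr_gt0.
pose c : R := (Num.sqrt 2)^-1.
have cc : c * c = 2^-1 by rewrite /c -invfM q2.
pose U j := vscale c (at_idx 0 (ls j) ++ vscale (-1) (at_idx 1 (ls j))).
pose W j := vscale c (at_idx 0 (ls j) ++ at_idx 1 (ls j)).
pose B i := boxev (fun j => at_idx i (ls j)) k r.
have UE : pr (boxev U k s) = F s.
  apply: (pr_box_same_cov A_law) => // i j.
  by rewrite /U cov_scalel cov_scaler mulrA cc !covE !cov_at_idx/=; field.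
have WE : pr (boxev W k t) = F t.
  apply: (pr_box_same_cov A_law) => // i j.
  by rewrite /W cov_scalel cov_scaler mulrA cc !covE !cov_at_idx/=; field.
have UW : pr (boxev U k s `&` boxev W k t) = F s * F t.
  rewrite (pr_box_indep A_law)// ?UE ?WE// => i j.
  by rewrite /U /W !covE !cov_at_idx/=; ring.
have B1 : pr (B 1%N) = F r.
  by apply: (pr_box_same_cov A_law) => // i j; rewrite !cov_at_idx.
have B01 : pr (B 1%N `&` B 0%N) = F r * F r.
  by rewrite (pr_box_indep A_law)// ?B1// => i j; rewrite cov_at_idx.
have -> : F s * (1 - F t) = pr (boxev U k s `&` ~` boxev W k t).
  by rewrite prDI// UE UW mulrBr mulr1.
have -> : (1 - F r) ^+ 2 = pr (~` B 0%N `&` ~` B 1%N).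
  have mB i : measurable (B i) by exact: mbox.
  rewrite prDI//; last exact: measurableC.
  rewrite prC// setIC prDI// B1 B01 /B -/(F r); ring.
apply: pr_le; [by apply: measurableI => //; exact: measurableC|
  by apply: measurableI; apply: measurableC; exact: mbox|].
move=> w [Uw /existsNP[j] /not_implyP[jk] /negP]; rewrite -ltNge => tW.
have := Uw j jk; move: tW; rewrite /U /W !ev_scale !ev_cat ev_scale.
set a0 := ev _ w; set a1 := ev (at_idx 1 _) w => tW Us.
have key (a : R) : c * (a0 + a1) = Num.sqrt 2 * a + c * (a0 + -1 * a1) \/
     c * (a0 + a1) = Num.sqrt 2 * a - c * (a0 + -1 * a1) -> `|a| <= r -> False.
  move=> h ar; suff : `|c * (a0 + a1)| <= t by rewrite leNgt tW.
  have h1 : `|Num.sqrt 2 * a| <= t - s.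
    by rewrite normrM gtr0_norm// mulrC -ler_pdivlMr.
  have -> : t = (t - s) + s by ring.
  case: h => ->; apply: (le_trans (ler_normD _ _)); rewrite ?normrN; exact: lerD.
have qc : Num.sqrt 2 = 2 * c :> R by rewrite /c -{2}q2 mulfK// gt_eqF.
split=> /(_ j jk).
  by rewrite -/a0; apply: key; right; rewrite qc; ring.
by rewrite -/a1; apply: key; left; rewrite qc; ring.
Qed.

Let F_le1 s : F s <= 1.
Proof. exact: pr_le1. Qed.

Let F_nd s t : s <= t -> F s <= F t.
Proof.
move=> st; apply: pr_le => // w h i ik; exact: (le_trans (h i ik)).
Qed.

(** The threshold on [F s] says that the ratio [(1 - F s) / F s] is at most [expR (- 2)]. Along
    [t j.+1 = s + sqrt 2 * t j] each application of [fernique_step] squares the ratio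
    [(1 - F (t j)) / F s], while [t j] grows only like [sqrt 2 ^ j]. *)
Lemma fernique_tail s n : 0 < s -> (1 + expR (- 2))^-1 <= F s -> (0 < n)%N ->
  1 - F (4 * s * Num.sqrt n%:R) <= expR (- n%:R).
Proof.
move=> s0 Fs n0.
have e0 := expR_gt0 (- 2 : R).
have Fs0 : 0 < F s by apply: lt_le_trans Fs; rewrite invr_gt0 addr_gt0.
pose q : R := Num.sqrt 2.
have q0 : 0 < q by rewrite sqrtr_gt0.
have q2 : q * q = 2 by rewrite /q -expr2 sqr_sqrtr.
pose fix t (j : nat) := if j is j'.+1 then s + q * t j' else s.
have t_gt0 j : 0 < t j.
  by elim: j => [//|j IH] /=; rewrite addr_gt0// mulr_gt0.
have x_le j : (1 - F (t j)) / F s <= expR (- (2 * (2 ^ j)%:R)).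
  elim: j => [|j IH].
    rewrite expn0 mulr1 ler_pdivrMr//=.
    have : 1 <= F s * (1 + expR (- 2)) by rewrite -ler_pdivrMr ?addr_gt0// mul1r.
    by rewrite mulrDr mulr1 mulrC lerBlDl.
  have tt : (t j.+1 - s) / q = t j.
    by rewrite /= addrAC subrr add0r mulrAC divff ?mul1r// gt_eqF.
  have ts : s < t j.+1 by rewrite /= ltrDl mulr_gt0.
  have := fernique_step s0 ts; rewrite -/q tt => h.
  have x0 : 0 <= (1 - F (t j)) / F s.
    by apply: divr_ge0; [rewrite subr_ge0|exact: ltW].
  have h2 : (1 - F (t j.+1)) / F s <= ((1 - F (t j)) / F s) ^+ 2.
    have -> : ((1 - F (t j)) / F s) ^+ 2 = (1 - F (t j)) ^+ 2 / F s / F s.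
      by field; rewrite gt_eqF.
    by rewrite ler_pM2r ?invr_gt0// ler_pdivlMr// mulrC.
  apply: (le_trans h2).
  apply: (@le_trans _ _ (expR (- (2 * (2 ^ j)%:R)) ^+ 2)).
    by rewrite lerXn2r// nnegrE expR_ge0.
  by rewrite -expRM_natl ler_expR expnS natrM; lra.
(* The constants 4 and 3 make the induction close, because [4 <= 3 * sqrt 2]. *)
have t_le j : t j <= s * (4 * q ^+ j - 3).
  elim: j => [|j IH]; first by rewrite expr0 /= mulr1; lra.
  rewrite /= exprS; apply: (@le_trans _ _ (s + q * (s * (4 * q ^+ j - 3)))).
    by rewrite lerD2l ler_pM2l.
  have : 4 <= 3 * q by nra.
  have -> : s * (4 * (q * q ^+ j) - 3) = s + q * (s * (4 * q ^+ j - 3)) + s * (3 * q - 4) by ring.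
  by move=> h; rewrite lerDl; apply: mulr_ge0; [exact: ltW|rewrite subr_ge0].
(* From [2 ^ j <= n] comes [t j <= 4 * s * sqrt n], and from [n < 2 ^ j.+1] that the exponent
   [2 * 2 ^ j] is at least [n]. *)
pose j := trunc_log 2 n.
have /andP[jn nj] : (2 ^ j <= n < 2 ^ j.+1)%N by exact: trunc_log_bounds.
have tn : t j <= 4 * s * Num.sqrt n%:R.
  apply: (le_trans (t_le j)).
  have -> : q ^+ j = Num.sqrt (2 ^ j)%:R.
    rewrite natrX -[LHS]ger0_norm ?exprn_ge0 ?(ltW q0)// -sqrtr_sqr; congr Num.sqrt.
    by rewrite -exprM mulnC exprM expr2 q2.
  have h : Num.sqrt (2 ^ j)%:R <= Num.sqrt n%:R :> R by rewrite ler_sqrt ?ler0n// ler_nat.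
  have : s * Num.sqrt (2 ^ j)%:R <= s * Num.sqrt n%:R by rewrite ler_pM2l.
  nra.
apply: (@le_trans _ _ ((1 - F (t j)) / F s)).
  rewrite ler_pdivlMr//; apply: (@le_trans _ _ (1 - F (4 * s * Num.sqrt n%:R))).
    by rewrite ler_piMr// subr_ge0.
  by rewrite lerD2l lerN2; exact: F_nd.
apply: (le_trans (x_le j)); rewrite ler_expR lerN2 -natrM ler_nat.
by rewrite -expnS ltnW.
Qed.

(** [sqrt n] times the mean has the law of one copy, so level [4 * s * sqrt r] for the mean is level
    [4 * s * sqrt (r * n)] for one copy. The bound is uniform in the number [k] of functionals. *)
Lemma fernique_mean s n r : 0 < s -> (1 + expR (- 2))^-1 <= F s ->
  (0 < n)%N -> (0 < r)%N ->
  pr (~` boxev (fun j => at_mean n (ls j)) k (4 * s * Num.sqrt r%:R)) <=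
  expR (- (r * n)%:R).
Proof.
move=> s0 Fs n0 r0; rewrite prC//.
have sn : 0 < Num.sqrt n%:R :> R by rewrite sqrtr_gt0 ltr0n.
have sr : 0 < Num.sqrt r%:R :> R by rewrite sqrtr_gt0 ltr0n.
have -> : pr (boxev (fun j => at_mean n (ls j)) k (4 * s * Num.sqrt r%:R)) =
    F (4 * s * Num.sqrt (r * n)%:R).
  transitivity (pr (boxev (fun j => vscale (Num.sqrt n%:R) (at_mean n (ls j))) k
      (4 * s * Num.sqrt (r * n)%:R))).
    have e i w : (`|ev (vscale (Num.sqrt n%:R) (at_mean n (ls i))) w| <=
        4 * s * Num.sqrt (r * n)%:R) = (`|ev (at_mean n (ls i)) w| <= 4 * s * Num.sqrt r%:R).
      rewrite ev_scale normrM (gtr0_norm sn) natrM sqrtrM ?ler0n//.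
      by rewrite mulrA [leRHS]mulrC ler_pM2l.
    by congr pr; apply/seteqP; split => w /= h i /h; rewrite e.
  apply: (pr_box_same_cov A_law); first by rewrite !mulr_gt0// sqrtr_gt0 ltr0n muln_gt0 r0.
  move=> i j; rewrite cov_scalel cov_scaler cov_at_mean// cov_at_idx/= !mulrA.
  by rewrite -expr2 sqr_sqrtr ?ler0n// divff ?mul1r// pnatr_eq0 -lt0n.
by apply: fernique_tail; rewrite // muln_gt0 r0.
Qed.

End seminorm.
End fernique.

(** * Exponential tightness *)

Section oscillation.
Variable R : realType.
Implicit Types f : R -> R.

Definition gridpt (N : nat) (t : R) : R := (Num.truncn (t * N%:R))%:R / N%:R.

(** Small values of all these functionals control the past of a path, in the weight [1 + t] of the
    [Omega] norm, by its values at the grid times of [[0, T]]. *)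
Definition osc (T N : nat) (t : R) : seq (R * R) :=
  if t < T%:R then [:: (- t, 1); (- gridpt N t, -1)] else [:: (- t, (1 + t)^-1)].

Definition tame T N (e : R) f := forall t : R, 0 <= t -> `|apply_path (osc T N t) f| <= e.

Lemma apply_osc T N t f : apply_path (osc T N t) f =
  if t < T%:R then f (- t) - f (- gridpt N t) else f (- t) / (1 + t).
Proof.
rewrite /apply_path /osc; case: ifP => _; rewrite !big_cons big_nil /= addr0.
  by rewrite mul1r mulN1r.
by rewrite mulrC.
Qed.

Lemma gridpt_itv N t : (0 < N)%N -> 0 <= t ->
  gridpt N t <= t < gridpt N t + N%:R^-1.
Proof.
move=> N0 t0; have n0 : (0 : R) < N%:R by rewrite ltr0n.
have /truncn_itv/andP[h1 h2] : 0 <= t * N%:R by rewrite mulr_ge0.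
rewrite /gridpt ler_pdivrMr// h1 /=.
by rewrite -[X in _ + X]mul1r -mulrDl natr1 ltr_pdivlMr.
Qed.

Lemma gridpt_ge0 N t : 0 <= gridpt N t.
Proof. by rewrite divr_ge0. Qed.

Lemma unif_cont_segment f (M s : R) : continuous f -> 0 < s ->
  \forall N \near \oo, forall t, `|t| <= M -> forall u, `|u - t| <= N%:R^-1 ->
    `|f u - f t| <= s.
Proof.
move=> cf s0.
have /compact_near_coveringP : compact `[- M, M]%classic by exact: segment_compact.
move=> /(_ nat \oo (fun N t => forall u, `|u - t| <= N%:R^-1 -> `|f u - f t| <= s)).
move=> /(_ _ _)/wrap[x _|].
  have s2 : 0 < s / 2 by rewrite divr_gt0.
  have /cvgrPdist_lt/(_ _ s2)[e /= e0 He] := cf x.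
  have e2 : 0 < e / 2 by rewrite divr_gt0.
  near=> t N => u /= ut.
  have tx : `|x - t| < e / 2 by near: t; exists (e / 2).
  have Ne : N%:R^-1 < e / 2.
    near: N; have /cvgrPdist_lt/(_ _ e2) := @cvgn_invn R.
    apply: filterS => N; rewrite sub0r normrN ger0_norm ?invr_ge0//.
  have h1 : `|f x - f t| < s / 2 by apply: He => /=; lra.
  have h2 : `|f x - f u| < s / 2.
    apply: He => /=; have -> : x - u = (x - t) - (u - t) by ring.
    apply: (le_lt_trans (ler_normB _ _)); lra.
  have -> : f u - f t = (f x - f t) - (f x - f u) by ring.
  apply: (le_trans (ler_normB _ _)); lra.
apply: filterS => N h t tM; apply: h => /=.
by rewrite in_itv/= -ler_norml.
Unshelve. all: by end_near. Qed.

Lemma tame_tail f (s : R) : in_Omega f -> 0 < s ->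
  \forall T \near \oo, forall t, T%:R <= t -> `|f (- t) / (1 + t)| <= s.
Proof.
move=> [_ [_ [_ lim]]] s0.
have {lim} /cvgNy_compNP/cvgrPdist_lt/(_ _ s0) [M [_ /= HM]] := lim.
near=> T => t Tt.
have T0 : (0 : R) <= T%:R by [].
have t0 : 0 <= t by exact: le_trans Tt.
have Mt : M < t by apply: lt_le_trans Tt; near: T; exact: nbhs_infty_gtr.
have := HM t Mt; rewrite sub0r normrN normrN (ger0_norm t0) => h.
exact: ltW.
Unshelve. all: by end_near. Qed.

Lemma tame_near f (T : nat) (s : R) : continuous f -> 0 < s ->
  (forall t : R, T%:R <= t -> `|f (- t) / (1 + t)| <= s) ->
  \forall N \near \oo, tame T N s f.
Proof.
move=> cf s0 tail; near=> N => t t0; rewrite apply_osc; case: ltP => [tT|]; last exact: tail.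
have N0 : (0 < N)%N by near: N; exact: nbhs_infty_gt.
have /andP[g1 g2] := gridpt_itv N0 t0; have g0 := gridpt_ge0 N t.
have : forall t, `|t| <= T%:R -> forall u, `|u - t| <= N%:R^-1 -> `|f u - f t| <= s.
  by near: N; exact: unif_cont_segment.
apply; first by rewrite normrN ger0_norm//; lra.
by rewrite opprK addrC distrC ger0_norm; lra.
Unshelve. all: by end_near. Qed.

(** Enumerates the nonnegative rationals, with 0 for indices that code nothing, so that events over
    all times become countable intersections. *)
Definition ratpt (j : nat) : R := `|ratr (odflt 0 (unpickle j))|.

Lemma ratpt_ge0 j : 0 <= ratpt j.
Proof. exact: normr_ge0. Qed.

Lemma ratpt_dense (a b : R) : 0 <= a -> a < b -> exists j, a < ratpt j < b.
Proof.
move=> a0 ab; have [q] := rat_in_itvoo ab; rewrite in_itv/= => /andP[aq qb].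
exists (pickle q); rewrite /ratpt pickleK/= ger0_norm ?aq//.
by rewrite (le_trans a0)// ltW.
Qed.

(** In [t] the functional jumps at grid points and at [T] but is right-continuous: just after [t] it
    agrees with a continuous [h], and rationals are dense there. *)
Lemma tame_ratpt T N e f : (0 < N)%N -> continuous f ->
  (forall j, `|apply_path (osc T N (ratpt j)) f| <= e) -> tame T N e f.
Proof.
move=> N0 cf H t t0.
suff [h [ch ht [dl dl0 hE]]] : exists h : R -> R, [/\ {for t, continuous h},
    h t = apply_path (osc T N t) f & exists2 dl, 0 < dl &
    forall u, t < u < t + dl -> apply_path (osc T N u) f = h u].
  rewrite -ht leNgt; apply/negP => eh.
  have p0 : 0 < `|h t| - e by rewrite subr_gt0.
  have /cvgrPdist_lt/(_ _ p0)[d /= d0 Hd] := ch.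
  have [j /andP[j1 j2]] : exists j, t < ratpt j < t + Num.min d dl.
    by apply: ratpt_dense => //; rewrite ltrDl lt_min d0.
  have jd : ratpt j < t + d.
    by apply: (lt_le_trans j2); rewrite lerD2l ge_min lexx.
  have jdl : ratpt j < t + dl.
    by apply: (lt_le_trans j2); rewrite lerD2l ge_min lexx orbT.
  have := H j; rewrite hE ?j1// => hj.
  have := Hd (ratpt j); rewrite /= distrC gtr0_norm ?subr_gt0// ltrBlDl => /(_ jd).
  have := lerB_dist (h t) (h (ratpt j)); lra.
have [tT|Tt] := ltP t T%:R.
  exists (fun u => f (- u) - f (- gridpt N t)); split.
  - apply: (@cvgB _ R^o); last exact: cvg_cst.
    apply: (@continuous_comp _ _ _ -%R f); [exact: opp_continuous|exact: cf].
  - by rewrite apply_osc tT.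
  - have n0 : (0 : R) < N%:R by rewrite ltr0n.
    have /andP[g1 g2] := gridpt_itv N0 t0.
    exists (Num.min (gridpt N t + N%:R^-1 - t) (T%:R - t)).
      by rewrite lt_min !subr_gt0 g2.
    move=> u /andP[tu]; rewrite -ltrBlDl lt_min => /andP[u1 u2].
    rewrite apply_osc ifT; last lra.
    congr (_ - f (- (_ / _))); congr (_%:R); apply: truncn_def.
    have /truncn_itv/andP[h1 h2] : 0 <= t * N%:R by rewrite mulr_ge0.
    apply/andP; split; first by apply: (le_trans h1); rewrite ler_pM2r// ltW.
    rewrite -natr1 -ltr_pdivlMr// mulrDl mul1r.
    by move: u1; rewrite /gridpt; lra.
exists (fun u => f (- u) / (1 + u)); split.
- apply: cvgM.
    apply: (@continuous_comp _ _ _ -%R f); [exact: opp_continuous|exact: cf].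
  apply: cvgV; first by rewrite gt_eqF//; lra.
  by apply: (@cvgD _ R^o); [exact: cvg_cst|exact: cvg_id].
- by rewrite apply_osc ltNge Tt.
- exists 1 => // u /andP[tu _]; rewrite apply_osc ltNge.
  by rewrite (le_trans Tt (ltW tu)).
Qed.

End oscillation.

Section omega_space.
Variable R : realType.
Implicit Types f g : R -> R.

Lemma in_Omega0 : in_Omega (fun=> 0 : R).
Proof.
split; first by move=> x; exact: cvg_cst.
by split=> //; split; under eq_fun do rewrite mul0r; exact: cvg_cst.
Qed.

Lemma in_OmegaD f g : in_Omega f -> in_Omega g -> in_Omega (fun t => f t + g t).
Proof.
move=> [cf [f0 [fp fm]]] [cg [g0 [gp gm]]]; split.
  by move=> x; apply: (@cvgD _ R^o); [exact: cf|exact: cg].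
split; first by rewrite f0 g0 addr0.
have e : (fun t => (f t + g t) / (1 + `|t|)) =
    (fun t => f t / (1 + `|t|) + g t / (1 + `|t|)).
  by apply/funext => t; rewrite mulrDl.
split; rewrite e -(addr0 (0 : R)); exact: (@cvgD _ R^o).
Qed.

Lemma in_OmegaZ c f : in_Omega f -> in_Omega (fun t => c * f t).
Proof.
move=> [cf [f0 [fp fm]]]; split.
  by move=> x; apply: cvgM; [exact: cvg_cst|exact: cf].
split; first by rewrite f0 mulr0.
have e : (fun t => c * f t / (1 + `|t|)) = (fun t => c * (f t / (1 + `|t|))).
  by apply/funext => t; rewrite mulrA.
by split; rewrite e -(mulr0 c); apply: cvgM => //; exact: cvg_cst.
Qed.

Lemma in_OmegaP f : in_Omega f <-> [/\ continuous f, f 0 = 0 &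
  forall e : R, 0 < e -> exists K : R, forall t, K < `|t| -> `|f t / (1 + `|t|)| < e].
Proof.
split.
  move=> [cf [f0 [fp fm]]]; split => // e e0.
  have /cvgrPdist_lt/(_ _ e0) [K1 [_ H1]] := fp.
  have /cvgrPdist_lt/(_ _ e0) [K2 [_ H2]] := fm.
  exists (Num.max `|K1| `|K2|) => t; rewrite gt_max => /andP[k1 k2].
  have [t0|t0] := leP 0 t.
    have := H1 t; rewrite sub0r normrN; apply.
    by apply: (le_lt_trans (ler_norm _)); rewrite -(ger0_norm t0).
  have := H2 t; rewrite sub0r normrN; apply; rewrite (ltr0_norm t0) in k2.
  by have := ler_norm (- K2); rewrite normrN; lra.
move=> [cf f0 small]; split => //; split => //.
split; apply/cvgrPdist_lt => e e0; have [K HK] := small e e0.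
- exists `|K|; split; first exact: num_real.
  move=> t Kt; rewrite sub0r normrN; apply: HK.
  apply: (le_lt_trans (ler_norm K)); apply: (lt_le_trans Kt); exact: ler_norm.
- exists (- `|K|); split; first by rewrite rpredN num_real.
  move=> t Kt; rewrite sub0r normrN; apply: HK.
  apply: (le_lt_trans (ler_norm K)); rewrite ltrNr in Kt; apply: (lt_le_trans Kt).
  by rewrite -normrN; exact: ler_norm.
Qed.

End omega_space.

Section exponential_tightness.
Variables (R : realType) (v : R -> R).
Variables (d : measure_display) (T : measurableType d) (P : probability T R).
Variable A : nat -> T -> R -> R.
Hypothesis A_paths : forall i w, in_Omega (A i w).
Hypothesis A_law : iid_gaussian_family P v A.
Local Notation ev := (ev A).
Local Notation pr := (pr P).
Local Notation boxev ls k s := (box (fun i => ev (ls i)) k s).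
Local Notation V := (seq (nat * R * R)).

Lemma in_Omega_mean n w : in_Omega (mean_path A n w).
Proof.
apply: in_OmegaZ; elim: n => [|n IH].
  by under eq_fun do rewrite big_ord0; exact: in_Omega0.
by under eq_fun do rewrite big_ord_recr; exact: in_OmegaD.
Qed.

Definition allev (ls : nat -> V) (e : R) : set T :=
  [set w | forall j, `|ev (ls j) w| <= e].

Lemma allevE ls e : allev ls e = \bigcap_k boxev ls k e.
Proof.
apply/seteqP; split => w /= h; first by move=> k _ j _; exact: h.
by move=> j; exact: (h j.+1).
Qed.

Lemma measurable_allev ls e : measurable (allev ls e).
Proof.
by rewrite allevE; apply: bigcapT_measurable => k; exact: (measurable_boxev A_law).
Qed.

Lemma pr_allevC_le ls e (c : R) : (forall k, pr (~` boxev ls k e) <= c) ->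
  pr (~` allev ls e) <= c.
Proof.
move=> H; rewrite allevE setC_bigcap.
have mB k : measurable (~` boxev ls k e).
  by apply: measurableC; exact: (measurable_boxev A_law).
have mU : measurable (\bigcup_k ~` boxev ls k e) by exact: bigcup_measurable.
have := @nondecreasing_cvg_mu _ _ _ P (fun k => ~` boxev ls k e) mB mU.
move=> /(_ _)/wrap[|].
  move=> n m nm; apply/subsetPset; apply: subsetC => w h i ik.
  by apply: h; exact: leq_trans nm.
move=> lim; rewrite -lee_fin -prE//.
rewrite -(cvg_lim _ lim)//; apply: lime_le; first by apply/cvg_ex; eexists; exact: lim.
by apply: nearW => k /=; rewrite (prE P (mB k)) lee_fin.
Qed.

(** Continuity from below along the increasing events that [B k] holds for all [k >= N], whose union
    is [D]. *)
Lemma near_pr_ge (D : set T) (B : nat -> set T) (dl : R) :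
  measurable D -> (forall N, measurable (B N)) ->
  (forall w, D w -> \forall N \near \oo, B N w) -> 0 < dl ->
  \forall N \near \oo, pr D - dl <= pr (B N).
Proof.
move=> mD mB DB dl0.
pose F N := D `&` \bigcap_(k in [set k | (N <= k)%N]) B k.
have mF N : measurable (F N).
  by apply: measurableI => //; apply: bigcap_measurableType => k _.
have UF : \bigcup_N F N = D.
  apply/seteqP; split => w; first by move=> [N _ []].
  by move=> Dw; have [N _ HN] := DB w Dw; exists N.
have := @nondecreasing_cvg_mu _ _ _ P F mF.
rewrite UF => /(_ mD)/(_ _)/wrap[|].
  move=> n m nm; apply/subsetPset => w [Dw h]; split => // k mk.
  by apply: h; exact: leq_trans mk.
have PFE : (P \o F) = (fun n => (pr (F n))%:E).
  by apply/funext => n /=; rewrite prE.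
move=> lim; have {lim} : (fun n => (pr (F n))%:E) @ \oo --> (pr D)%:E.
  by rewrite -PFE -(prE P mD); exact: lim.
move=> /fine_cvg/cvgrPdist_lt/(_ _ dl0); apply: filterS => N /= h.
have FB : pr (F N) <= pr (B N).
  by apply: pr_le => // w [_]; apply => /=.
move: h; rewrite ltr_norml => /andP[_]; lra.
Qed.

(** Fernique's inequality asks only that for one copy all oscillations stay below [s], of order
    [e / sqrt r], with probability at least [(1 + expR (- 2))^-1]. Decay of the paths gives this
    beyond a large [M], and uniform continuity on [[0, M]] for a fine mesh chosen after [M]. *)
Lemma exponential_tightness (e : R) (r : nat) : 0 < e -> (0 < r)%N ->
  \forall M \near \oo, \forall N \near \oo, forall n, (0 < n)%N ->
    pr (~` allev (fun j => at_mean n (osc M N (ratpt R j))) e) <= expR (- (r * n)%:R).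
Proof.
move=> e0 r0.
have sr : 0 < Num.sqrt r%:R :> R by rewrite sqrtr_gt0 ltr0n.
pose s := e / (4 * Num.sqrt r%:R).
have s0 : 0 < s by rewrite divr_gt0// mulr_gt0.
have es : e = 4 * s * Num.sqrt r%:R by rewrite /s; field; rewrite gt_eqF.
(* Half of the room above Fernique's threshold: one [dl] is spent on [M], the other on [N]. *)
pose dl : R := (1 - (1 + expR (- 2))^-1) / 2.
have dl0 : 0 < dl.
  by rewrite divr_gt0// subr_gt0 invf_lt1 ?addr_gt0 ?expR_gt0// ltrDl expR_gt0.
have dlE : 1 - dl - dl = (1 + expR (- 2))^-1 by rewrite /dl; field.
(* Rational times only, for measurability; continuity of the path extends the bound to real times
   below. *)
pose D (M : nat) := [set w | forall j, M%:R <= ratpt R j ->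
   `|A 0%N w (- ratpt R j) / (1 + ratpt R j)| <= s].
have mD M : measurable (D M).
  have -> : D M = \bigcap_j (if M%:R <= ratpt R j then
      [set w | `|ev [:: (0%N, - ratpt R j, (1 + ratpt R j)^-1)] w| <= s] else setT).
    apply/seteqP; split => w /= h j.
      move=> _; case: ifP => //= jM.
      by rewrite /ev big_seq1 mulrC; exact: h.
    move=> jM; have := h j I; rewrite jM /=.
    by rewrite /ev big_seq1 mulrC.
  apply: bigcapT_measurable => j; case: ifP => // _.
  rewrite -[X in measurable X]setTI; apply: measurable_fun_le => //.
  by apply: measurableT_comp => //; exact: (measurable_ev A_law).
have D1 : \forall M \near \oo, 1 - dl <= pr (D M).
  have := @near_pr_ge setT D dl measurableT mD.
  have -> : pr setT = 1 by rewrite /pr probability_setT.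
  apply=> // w _.
  by have := tame_tail (A_paths 0 w) s0; apply: filterS => M h j; exact: h.
apply: filterS D1 => M DM.
pose B N := allev (fun j => at_idx 0 (osc M N (ratpt R j))) s.
have BN : \forall N \near \oo, pr (D M) - dl <= pr (B N).
  apply: near_pr_ge => //; first by move=> N; exact: measurable_allev.
  move=> w Dw.
  have tail (t : R) : M%:R <= t -> `|A 0%N w (- t) / (1 + t)| <= s.
    move=> Mt; have cA : continuous (A 0%N w) by case: (A_paths 0 w).
    have t0 : 0 <= t by exact: le_trans Mt.
    pose h u := A 0%N w (- u) / (1 + u).
    have ch : {for t, continuous h}.
      apply: cvgM.
        apply: (@continuous_comp _ _ _ -%R (A 0%N w)); [exact: opp_continuous|exact: cA].
      apply: cvgV; first by rewrite gt_eqF//; lra.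
      by apply: (@cvgD _ R^o); [exact: cvg_cst|exact: cvg_id].
    rewrite -/(h t) leNgt; apply/negP => sh.
    have p0 : 0 < `|h t| - s by rewrite subr_gt0.
    have /cvgrPdist_lt/(_ _ p0)[dd /= dd0 Hd] := ch.
    have [j /andP[j1 j2]] : exists j, t < ratpt R j < t + dd.
      by apply: ratpt_dense => //; rewrite ltrDl.
    have := Dw j (le_trans Mt (ltW j1)); rewrite -/(h (ratpt R j)) => hj.
    have := Hd (ratpt R j); rewrite /= distrC gtr0_norm ?subr_gt0// ltrBlDl => /(_ j2).
    have := lerB_dist (h t) (h (ratpt R j)); lra.
  have [cA _] := A_paths 0 w.
  have := tame_near cA s0 tail; apply: filterS => N h j.
  by rewrite ev_at_idx; apply: h; exact: ratpt_ge0.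
apply: filterS BN => N BN n n0.
apply: pr_allevC_le => k; rewrite es.
apply: (fernique_mean A_law) => //; rewrite -dlE.
apply: (@le_trans _ _ (pr (B N))); first lra.
apply: pr_le; [exact: measurable_allev|exact: (measurable_boxev A_law)|].
by move=> w h j _; exact: h.
Qed.

End exponential_tightness.

(** * The queue functional *)

Section queue_functional.
Variable R : realType.
Variables (c1 c2 : R).
Hypotheses (c2_gt0 : 0 < c2) (c12 : c2 < c1).
Implicit Types f g : R -> R.

Let c1_gt0 : 0 < c1. Proof. exact: lt_trans c12. Qed.

(* With [X t := - f (- t)], this says that
   [sup_t (X t - c2 t) - sup_s (X s - c1 s)] is at least [beta]. *)
Definition reach (beta : R) f := exists2 t, 0 < t & forall s, 0 < s ->
  - f (- s) - c1 * s + beta <= - f (- t) - c2 * t.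

Lemma continuous_drift f (c : R) : continuous f ->
  continuous (fun s : R => - f (- s) - c * s).
Proof.
move=> cf x; apply: (@cvgB _ R^o).
  apply: (@cvgN _ R^o).
  apply: (@continuous_comp _ _ _ -%R f); [exact: opp_continuous|exact: cf].
by apply: cvgM; [exact: cvg_cst|exact: cvg_id].
Qed.

(** Past some [T] the path is below [c / 4 * (1 + s)], so the drift wins: beyond [M] the value at
    [a] is no longer reached, and a maximum over [[a, M]] is global. *)
Lemma Omega_drift_max f (c a : R) : in_Omega f -> 0 < c -> 0 <= a ->
  exists2 m, a <= m & forall s, a <= s -> - f (- s) - c * s <= - f (- m) - c * m.
Proof.
move=> Of c0 a0; have [cf _] := Of.
have c4 : 0 < c / 4 by rewrite divr_gt0.
have [T _ /(_ _ (leqnn T)) HT] := tame_tail Of c4.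
pose y s := - f (- s) - c * s.
pose M := Num.max (Num.max a T%:R) (1 + (4 / c) * `|y a|).
have aM : a <= M by rewrite !le_max lexx.
have [|m] := @EVT_max R y a M aM.
  by apply: continuous_subspaceT; exact: continuous_drift.
rewrite in_itv/= => /andP[am mM] Hm; exists m => // s as_.
have [sM|Ms] := lerP s M; first by apply: Hm; rewrite in_itv/= as_.
apply: (le_trans _ (Hm a _)); last by rewrite in_itv/= lexx.
have Ts : T%:R <= s by apply: le_trans (ltW Ms); rewrite !le_max lexx orbT.
have := HT s Ts; have s0 : 0 <= s by exact: le_trans as_.
have s10 : 0 < 1 + s by lra.
rewrite normrM normfV (gtr0_norm s10) ler_pdivrMr// => h1.
have h2 : 1 + (4 / c) * `|y a| < s by apply: le_lt_trans Ms; rewrite !le_max lexx orbT.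
have h3 : `|y a| <= c / 4 * s - c / 4.
  have -> : `|y a| = c / 4 * (4 / c * `|y a|) by field; rewrite gt_eqF.
  have -> : c / 4 * s - c / 4 = c / 4 * (s - 1) by ring.
  rewrite ler_pM2l//; lra.
rewrite -/(y a); have := ler_norm (- f (- s)); rewrite normrN.
have := ler_norm (- y a); rewrite normrN.
have : 0 <= c * s by rewrite mulr_ge0// ltW.
lra.
Qed.

(** The drifted path tends to 0 at time 0, so its supremum over any initial interval is
    nonnegative. *)
Lemma drift_sup_ge0 f (K r : R) : continuous f -> f 0 = 0 -> 0 < r ->
  (forall s, 0 < s -> s < r -> - f (- s) - c1 * s <= K) -> 0 <= K.
Proof.
move=> cf f0 r0 H; rewrite leNgt; apply/negP => K0.
have nK : 0 < - K by rewrite oppr_gt0.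
have /cvgrPdist_lt/(_ _ nK)[e /= e0 He] := @continuous_drift f c1 cf 0.
pose u := Num.min e r / 2.
have m0 : 0 < Num.min e r by rewrite lt_min e0.
have u0 : 0 < u by rewrite divr_gt0.
have ue : u < e by have : Num.min e r <= e by [rewrite ge_min lexx]; rewrite /u; lra.
have ur : u < r by have : Num.min e r <= r by [rewrite ge_min lexx orbT]; rewrite /u; lra.
have := He u; rewrite /= sub0r normrN gtr0_norm// oppr0 f0 mulr0 !subr0 oppr0 sub0r.
move=> /(_ ue); have := H _ u0 ur; rewrite normrN ltr_norml => h /andP[h1 h2]; lra.
Qed.

Lemma reach_ge beta f t : continuous f -> f 0 = 0 ->
  (forall s, 0 < s -> - f (- s) - c1 * s + beta <= - f (- t) - c2 * t) ->
  beta <= - f (- t) - c2 * t.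
Proof.
move=> cf f0 H; rewrite -subr_ge0; apply: (drift_sup_ge0 cf f0 ltr01) => s /H; lra.
Qed.

(** The comparison of [t] with itself; this is where [t > b / (c1 - c2)] in [setS] comes from. *)
Lemma reach_time beta f t : 0 < t ->
  (forall s, 0 < s -> - f (- s) - c1 * s + beta <= - f (- t) - c2 * t) ->
  beta <= (c1 - c2) * t.
Proof. by move=> t0 /(_ _ t0); lra. Qed.

Lemma reach_le beta beta' f : beta' <= beta -> reach beta f -> reach beta' f.
Proof. move=> bb [t t0 H]; exists t => // s /H; lra. Qed.

Lemma reach_setS b beta f : b < beta -> in_Omega f -> reach beta f -> setS b c1 c2 f.
Proof.
move=> bb Of [t t0 H]; split => //; exists t; split.
  rewrite ltr_pdivrMr ?subr_gt0//; have := reach_time t0 H; lra.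
by move=> s s0 st; have := H s s0; lra.
Qed.

(** [sup] bounds its set only when the set is bounded: the quotient is below 1 far out, and
    continuity bounds it on the compact rest. *)
Lemma Omega_norm_ge f t : in_Omega f -> `|f t| / (1 + `|t|) <= Omega_norm f.
Proof.
move=> Of; rewrite /Omega_norm; apply: ub_le_sup; last by exists t.
have [cf [f0 [fp fm]]] := Of.
have [M1 [_ /= H1]] : \forall t \near +oo, `|f t / (1 + `|t|)| < 1.
  have /cvgrPdist_lt/(_ _ (@ltr01 R)) := fp.
  by apply: filterS => x; rewrite sub0r normrN.
have [M2 [_ /= H2]] : \forall t \near -oo, `|f t / (1 + `|t|)| < 1.
  have /cvgrPdist_lt/(_ _ (@ltr01 R)) := fm.
  by apply: filterS => x; rewrite sub0r normrN.
pose M : R := Num.max `|M1| `|M2|.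
have M00 : 0 <= M by rewrite le_max normr_ge0.
have M0 : - M <= M by lra.
have [|m _ Hm] := @EVT_max R (fun x => `|f x|) (- M) M M0.
  apply: continuous_subspaceT => x.
  by apply: cvg_norm; exact: cf.
exists (Num.max 1 `|f m|) => _ [x _ <-].
have x1 : 0 < 1 + `|x| by have := normr_ge0 x; lra.
have [|] := boolP (x \in `[- M, M]).
  move=> xM; rewrite le_max; apply/orP; right.
  apply: (le_trans _ (Hm x xM)); by rewrite ler_pdivrMr// ler_peMr// lerDl.
rewrite in_itv/= negb_and -!ltNge => h; rewrite le_max; apply/orP; left.
have e : `|f x| / (1 + `|x|) = `|f x / (1 + `|x|)| by rewrite normrM normfV (gtr0_norm x1).
rewrite e; apply: ltW; case/orP: h => h.
- apply: H2; apply: (lt_le_trans h); rewrite lerNl.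
  by apply: (le_trans (ler_norm _)); rewrite normrN le_max lexx orbT.
- apply: H1; apply: le_lt_trans h; apply: (le_trans (ler_norm _)).
  by rewrite le_max lexx.
Qed.

Lemma in_OmegaB f g : in_Omega f -> in_Omega g -> in_Omega (f \- g).
Proof.
move=> Of Og; have := in_OmegaD Of (in_OmegaZ (-1) Og).
by congr in_Omega; apply/funext => t /=; rewrite mulN1r.
Qed.

(** A nearby [g] in [setS] provides a time [t] that beats the earlier [s]. If later times spoil this
    for [f], the maximizer [m >= t] of the path drifted by [c1] works instead: passing from rate
    [c1] to [c2] at [m] gains [(c1 - c2) * m > b]. *)
Lemma closure_reach b beta f : 0 < b -> beta < b ->
  Omega_closure (setS b c1 c2) f -> reach beta f.
Proof.
move=> b0 bb [Of H]; have [cf [f0 _]] := Of.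
have [M M0 HM] := Omega_drift_max Of (divr_gt0 c2_gt0 (ltr0n R 2)) (lexx 0).
set C := - f (- M) - c2 / 2 * M in HM.
(* An a priori bound on the time [t] of every [g] close to [f], so that [e] can be fixed before [g]
   is known. *)
pose tb := Num.max 1 ((4 / c2) * (C - b + 1)).
pose e := Num.min (c2 / 4) (Num.min 1 ((b - beta) / 2) / (2 + 2 * tb)).
have tb1 : 1 <= tb by rewrite le_max lexx.
have tb0 : 0 < 2 + 2 * tb by lra.
have m0 : 0 < Num.min 1 ((b - beta) / 2) by rewrite lt_min ltr01 divr_gt0// subr_gt0.
have e0 : 0 < e by rewrite lt_min !divr_gt0.
have ec : e <= c2 / 4 by rewrite ge_min lexx.
have et : e * (2 + 2 * tb) <= Num.min 1 ((b - beta) / 2).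
  by rewrite -ler_pdivlMr// ge_min lexx orbT.
have et1 : e * (2 + 2 * tb) <= 1 by apply: (le_trans et); rewrite ge_min lexx.
have et2 : e * (2 + 2 * tb) <= (b - beta) / 2 by apply: (le_trans et); rewrite ge_min lexx orbT.
have [g [[Og [t [tb_ Hg]]] ge]] := H e e0.
have [cg [g0 _]] := Og.
have dist u : 0 <= u -> `|f (- u) - g (- u)| <= e * (1 + u).
  move=> u0; have := Omega_norm_ge (- u) (in_OmegaB Of Og).
  rewrite normrN (ger0_norm u0) ler_pdivrMr; last lra.
  by move/le_trans; apply; apply: ler_wpM2r; [lra|exact: ltW].
have bt : b < (c1 - c2) * t by rewrite mulrC -ltr_pdivrMr// subr_gt0.
have t0 : 0 < t by apply: lt_trans tb_; rewrite divr_gt0// subr_gt0.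
have gt : b <= - g (- t) - c2 * t.
  rewrite -subr_ge0; apply: (drift_sup_ge0 cg g0 t0) => s s0 st.
  have := Hg s s0 st; lra.
have e14 : e <= 1 by nra.
have dt := dist t (ltW t0); rewrite ler_norml in dt; case/andP: dt => dt1 dt2.
have ttb : t <= tb.
  rewrite le_max; apply/orP; right.
  have := HM t (ltW t0); rewrite -/C => hC.
  have -> : t = (4 / c2) * (c2 / 4 * t) by field; rewrite gt_eqF.
  rewrite ler_pM2l ?divr_gt0//; nra.
have key s : 0 < s -> s <= t ->
    - f (- s) - c1 * s + (b + beta) / 2 <= - f (- t) - c2 * t.
  move=> s0; rewrite le_eqVlt => /predU1P[->|st]; first lra.
  have ds := dist s (ltW s0); rewrite ler_norml in ds; case/andP: ds => ds1 ds2.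
  have := Hg s s0 st.
  have : e * (1 + s) + e * (1 + t) <= e * (2 + 2 * tb).
    by rewrite -mulrDr ler_pM2l//; lra.
  lra.
have [m tm Hm] := Omega_drift_max Of c1_gt0 (ltW t0).
have [ym|ym] := lerP (- f (- m) - c1 * m) (- f (- t) - c2 * t - beta).
  exists t => // s s0; have [st|/ltW ts] := lerP s t; first by have := key s s0 st; lra.
  by have := Hm s ts; lra.
have m0' : 0 < m by exact: lt_le_trans tm.
have bm : b < (c1 - c2) * m.
  by apply: (lt_le_trans bt); rewrite ler_pM2l// subr_gt0.
exists m => // s s0; have [st|/ltW ts] := lerP s t; first by have := key s s0 st; lra.
by have := Hm s ts; lra.
Qed.

(** The level is open in the weighted norm: the slack [beta - beta'] pays for a perturbation on
    [[0, T]], and after [T] the drift [c1] dominates both the path and the perturbation. *)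
Lemma reach_stable beta beta' f : 0 < beta' -> beta' < beta ->
  in_Omega f -> reach beta f ->
  exists2 e, 0 < e & forall g, (forall t, 0 <= t -> `|g (- t) - f (- t)| <= e * (1 + t)) ->
    reach beta' g.
Proof.
move=> b'0 bb Of [t t0 H]; have [cf [f0 _]] := Of.
have bt := reach_ge cf f0 H.
have c4 : 0 < c1 / 4 by rewrite divr_gt0.
have [T0 _ /(_ _ (leqnn T0)) HT0] := tame_tail Of c4.
pose T := 1 + Num.max 0 T0%:R : R.
have T0T : T0%:R <= T by have : (T0%:R : R) <= Num.max 0 T0%:R by [rewrite le_max lexx orbT]; rewrite /T; lra.
have T1 : 1 <= T by have : 0 <= Num.max 0 (T0%:R : R) by [rewrite le_max lexx]; rewrite /T; lra.
pose e := Num.min (c1 / 8) ((beta - beta') / (2 + T + t)).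
have d0 : 0 < 2 + T + t by lra.
have e0 : 0 < e by rewrite lt_min !divr_gt0// subr_gt0.
have e1 : e <= c1 / 8 by rewrite ge_min lexx.
have e2 : e * (2 + T + t) <= beta - beta' by rewrite -ler_pdivlMr// ge_min lexx orbT.
exists e => // g Hg; exists t => // s s0.
have := Hg t (ltW t0); have := Hg s (ltW s0).
rewrite !ler_norml => /andP[s1 s2] /andP[t1 t2].
have [sT|Ts] := lerP s T.
  have : e * (1 + s) + e * (1 + t) <= e * (2 + T + t).
    by rewrite -mulrDr ler_pM2l//; lra.
  by have := H s s0; lra.
have := HT0 s (le_trans T0T (ltW Ts)); have s10 : 0 < 1 + s by lra.
rewrite normrM normfV (gtr0_norm s10) ler_pdivrMr// ler_norml => /andP[h1 h2].
have : e * (1 + t) <= e * (2 + T + t) by rewrite ler_pM2l//; lra.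
have : e * (1 + s) <= c1 / 8 * (1 + s) by rewrite ler_pM2r.
nra.
Qed.

(** For [s <= beta / (c1 - c2)] the increment [f (- s) - f (- t)] is nonnegative, so scaling
    preserves the comparison. If a later time defeats [t], it is replaced by the maximizer [m] of
    the scaled path from [beta / (c1 - c2)] on, where [(c1 - c2) * m >= beta]. *)
Lemma reach_scale beta lam f : 0 < beta -> 1 <= lam -> in_Omega f ->
  reach beta f -> reach beta (fun t => lam * f t).
Proof.
move=> b0 l1 Of [t t0 H]; have Olf := in_OmegaZ lam Of.
have tt0 := reach_time t0 H.
have key s : 0 < s -> (c1 - c2) * s <= beta ->
    - (lam * f (- s)) - c1 * s + beta <= - (lam * f (- t)) - c2 * t.
  move=> s0 sb; have := H s s0.
  have st : s <= t by rewrite -(@ler_pM2l _ (c1 - c2)) ?subr_gt0//; exact: le_trans tt0.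
  have : 0 <= beta + c2 * t - c1 * s.
    have : c2 * s <= c2 * t by rewrite ler_pM2l.
    lra.
  move=> p0 h.
  have : 0 <= (lam - 1) * (f (- s) - f (- t)) by rewrite mulr_ge0//; lra.
  lra.
have [h|/existsNP[s1 /not_implyP[s10 /negP]]] := pselect (forall s, 0 < s ->
    - (lam * f (- s)) - c1 * s + beta <= - (lam * f (- t)) - c2 * t).
  by exists t.
rewrite -ltNge => hs1.
pose a := beta / (c1 - c2).
have c0 : 0 < c1 - c2 by rewrite subr_gt0.
have a0 : 0 < a by rewrite divr_gt0.
have as1 : a <= s1.
  rewrite leNgt; apply/negP => /ltW; rewrite ler_pdivlMr// mulrC => /(key s1 s10).
  lra.
have [m am Hm] := Omega_drift_max Olf c1_gt0 (ltW a0).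
have bm : beta <= (c1 - c2) * m by rewrite mulrC -ler_pdivrMr.
exists m; first exact: lt_le_trans am.
move=> s s0; have [sa|/ltW sa] := lerP a s; first by have := Hm s sa; lra.
have := key s s0; rewrite mulrC -ler_pdivlMr// => /(_ sa).
have := Hm s1 as1; lra.
Qed.

Definition shift_path (h : R) f (t : R) : R := f (t + h) - f h.

(** If the scaled path drifted by [c1] never exceeds [kap], scaling raises the level to
    [lam * beta - kap]. Otherwise some [s1] exceeds [kap]; shifting by [h] then adds
    [(c1 - c2) * h], and the comparison times within [(0, h]] created by the shift are dominated by
    [s1]. *)
Lemma reach_improve beta lam h kap f : 0 <= h -> 0 < beta -> 1 <= lam -> in_Omega f ->
  (forall u, 0 <= u <= h -> lam * `|f u| + c1 * u <= kap) ->
  reach beta f ->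
  reach (lam * beta - kap) (fun t => lam * f t) \/
  reach (beta + (c1 - c2) * h) (fun t => lam * shift_path h f t).
Proof.
move=> h0 b0 l1 Of Hk rf; have [cf [f0 _]] := Of.
have [hA|/existsNP[s1 /not_implyP[s10 /negP]]] := pselect (forall s, 0 < s ->
    - (lam * f (- s)) - c1 * s <= kap).
  left; have [t t0 H] := rf; exists t => // s s0.
  have := reach_ge cf f0 H; have := hA s s0.
  have : 0 <= (lam - 1) * (c2 * t) by rewrite !mulr_ge0//; [lra|exact: ltW|exact: ltW].
  move=> p1 p2 p3.
  have : lam * beta <= lam * (- f (- t) - c2 * t) by apply: ler_wpM2l => //; lra.
  lra.
rewrite -ltNge => hs1; right.
have [t t0 H] := reach_scale b0 l1 Of rf.
exists (t + h); first lra.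
move=> s s0; rewrite /shift_path.
have -> : - (t + h) + h = - t by ring.
have -> : - s + h = - (s - h) by ring.
suff : - (lam * f (- (s - h))) - c1 * (s - h) + beta <= - (lam * f (- t)) - c2 * t by lra.
have [sh|sh] := ltP 0 (s - h); first exact: H.
have := Hk (- (s - h)); have -> : 0 <= - (s - h) <= h by apply/andP; split; lra.
move=> /(_ isT) hk; have := H s1 s10.
have : - (lam * f (- (s - h))) <= lam * `|f (- (s - h))|.
  rewrite -mulrN; apply: ler_wpM2l; first lra.
  by rewrite -normrN; exact: ler_norm.
lra.
Qed.

End queue_functional.

(** * The reproducing kernel Hilbert space *)

Section rkhs.
Variables (R : realType) (v : R -> R).
Hypothesis v0 : v 0 = 0.
Hypothesis kcov_ge0 : forall l, 0 <= kcov v l l.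
Local Notation kcov := (kcov v).
Local Notation kfun := (kfun v).
Implicit Types l m : seq (R * R).

Definition kscale (c : R) l : seq (R * R) := [seq (p.1, c * p.2) | p <- l].

Lemma kcov_sym l m : kcov l m = kcov m l.
Proof.
rewrite /kcov exchange_big; apply: eq_bigr => p _; apply: eq_bigr => q _.
by rewrite [q.2 * _]mulrC Gam_sym.
Qed.

Lemma kcov_catl l1 l2 m : kcov (l1 ++ l2) m = kcov l1 m + kcov l2 m.
Proof. by rewrite /kcov big_cat. Qed.

Lemma kcov_catr l1 l2 m : kcov m (l1 ++ l2) = kcov m l1 + kcov m l2.
Proof. by rewrite kcov_sym kcov_catl !(kcov_sym _ m). Qed.

Lemma kcov_scalel c l m : kcov (kscale c l) m = c * kcov l m.
Proof.
rewrite /kcov /kscale big_map mulr_sumr; apply: eq_bigr => p _.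
by rewrite mulr_sumr; apply: eq_bigr => q _; rewrite /= !mulrA.
Qed.

Lemma kcov_scaler c l m : kcov l (kscale c m) = c * kcov l m.
Proof. by rewrite kcov_sym kcov_scalel kcov_sym. Qed.

Definition kcovE := (kcov_catl, kcov_catr, kcov_scalel, kcov_scaler).

Lemma kdiffE l m : kdiff l m = l ++ kscale (-1) m.
Proof. by congr (_ ++ _); apply: eq_map => p; rewrite mulN1r. Qed.

Lemma knorm2E l : knorm2 v l = kcov l l. Proof. by []. Qed.

Lemma knorm2_kdiff l m : knorm2 v (kdiff l m) = kcov l l - 2 * kcov l m + kcov m m.
Proof. by rewrite knorm2E kdiffE !kcovE (kcov_sym m l); ring. Qed.

Lemma apply_kfun m l : apply_path m (kfun l) = kcov l m.
Proof.
rewrite /apply_path /kfun /kcov exchange_big; apply: eq_bigr => p _.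
by rewrite mulr_sumr; apply: eq_bigr => q _; rewrite mulrA [p.2 * _]mulrC.
Qed.

Lemma kcov_cauchy_schwarz l m : kcov l m ^+ 2 <= kcov l l * kcov m m.
Proof.
have h (x y : R) : 0 <= x ^+ 2 * kcov l l + 2 * x * y * kcov l m + y ^+ 2 * kcov m m.
  have := kcov_ge0 (kscale x l ++ kscale y m); rewrite !kcovE (kcov_sym m l).
  by congr (_ <= _); ring.
have [m0|m0] := eqVneq (kcov m m) 0.
  have [l0|l0] := eqVneq (kcov l m) 0; first by rewrite l0 m0 mulr0 expr0n.
  (* With [kcov m m = 0] the form is linear in [y], and this [y] gives it the value [-1]. *)
  have := h 1 (- (kcov l l + 1) / (2 * kcov l m)); rewrite m0.
  have -> : 1 ^+ 2 * kcov l l + 2 * 1 * (- (kcov l l + 1) / (2 * kcov l m)) * kcov l m +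
    (- (kcov l l + 1) / (2 * kcov l m)) ^+ 2 * 0 = -1 by field; exact: l0.
  by rewrite ler0N1.
have m_gt0 : 0 < kcov m m by rewrite lt_neqAle eq_sym m0 kcov_ge0.
have := h (kcov m m) (- kcov l m).
have -> : kcov m m ^+ 2 * kcov l l + 2 * kcov m m * - kcov l m * kcov l m +
  (- kcov l m) ^+ 2 * kcov m m = kcov m m * (kcov l l * kcov m m - kcov l m ^+ 2) by ring.
by rewrite pmulr_rge0// subr_ge0.
Qed.

Lemma Gam_diag (s : R) : Gam v s s = v `|s|.
Proof. by rewrite /Gam subrr normr0 v0 subr0; field. Qed.

Lemma kcov_point (t c : R) : kcov [:: (t, c)] [:: (t, c)] = c ^+ 2 * v `|t|.
Proof. by rewrite /kcov !big_seq1 /= Gam_diag expr2. Qed.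

Lemma kcov_incr (t u : R) :
  kcov [:: (t, 1); (u, -1)] [:: (t, 1); (u, -1)] = v `|t - u|.
Proof.
rewrite /kcov !big_cons !big_nil /= !Gam_diag (Gam_sym v t u) /Gam.
by field.
Qed.

Lemma rkhs_approx_kfun l : rkhs_approx v (kfun l) (knorm2 v l).
Proof.
exists (fun=> l); split; last by split => [t|]; exact: cvg_cst.
move=> e e0; exists 0%N => m k _ _; rewrite knorm2_kdiff.
by have -> : kcov l l - 2 * kcov l l + kcov l l = 0 by ring.
Qed.

Lemma rkhs_approx_scale (c : R) f L : rkhs_approx v f L ->
  rkhs_approx v (fun t => c * f t) (c ^+ 2 * L).
Proof.
move=> [u [cau [pt nm]]]; exists (fun n => kscale c (u n)); split; [|split].
- move=> e e0; have c0 : 0 < 1 + c ^+ 2 by have := sqr_ge0 c; lra.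
  have [N HN] := cau _ (divr_gt0 e0 c0); exists N => m k Nm Nk.
  have := HN m k Nm Nk; rewrite !knorm2_kdiff !kcovE ltr_pdivlMr// => h.
  have h2 := kcov_ge0 (kdiff (u m) (u k)); rewrite -knorm2E knorm2_kdiff in h2.
  have -> : c * (c * kcov (u m) (u m)) - 2 * (c * (c * kcov (u m) (u k))) +
    c * (c * kcov (u k) (u k)) =
    c ^+ 2 * (kcov (u m) (u m) - 2 * kcov (u m) (u k) + kcov (u k) (u k)) by ring.
  by apply: le_lt_trans h; rewrite mulrC ler_wpM2l//; lra.
- move=> t; have -> : (fun n => kfun (kscale c (u n)) t) = (fun n => c * kfun (u n) t).
    apply/funext => n; rewrite /kfun big_map mulr_sumr; apply: eq_bigr => p _ /=.
    by rewrite mulrA.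
  by apply: cvgM; [exact: cvg_cst|exact: pt].
- have -> : (fun n => knorm2 v (kscale c (u n))) = (fun n => c ^+ 2 * knorm2 v (u n)).
    by apply/funext => n; rewrite !knorm2E !kcovE; ring.
  by apply: cvgM; [exact: cvg_cst|exact: nm].
Qed.

(** The shift of [Gam v s] by [h] is [Gam v (s - h) - Gam v (- h)], so shifting keeps finite
    combinations. *)
Definition kshift (h : R) l : seq (R * R) :=
  [seq (p.1 - h, p.2) | p <- l] ++ [seq (- h, - p.2) | p <- l].

Lemma kfun_shift h l t : kfun (kshift h l) t = shift_path h (kfun l) t.
Proof.
rewrite /kfun /kshift big_cat !big_map /= -big_split /= /shift_path -sumrB.
apply: eq_bigr => p _ /=; rewrite /Gam.
have -> : t - - h = t + h by ring.
have -> : t - (p.1 - h) = t + h - p.1 by ring.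
by rewrite normrN (distrC p.1 h); field.
Qed.

(** Stationarity of the increments: time shifts are isometries. *)
Lemma kcov_shift h l m : kcov (kshift h l) (kshift h m) = kcov l m.
Proof.
have e : kcov (kshift h l) (kshift h m) = apply_path (kshift h m) (shift_path h (kfun l)).
  rewrite -apply_kfun /apply_path; apply: eq_bigr => p _.
  by rewrite kfun_shift.
rewrite e -(apply_kfun m l) /apply_path /kshift big_cat !big_map /= -big_split /=.
apply: eq_bigr => p _ /=; rewrite /shift_path.
have -> : - h + h = 0 by ring.
have -> : p.1 - h + h = p.1 by ring.
have -> : kfun l 0 = 0.
  rewrite /kfun big1// => q _.
  by rewrite /Gam normr0 v0 sub0r normrN; ring.
by ring.
Qed.

Lemma rkhs_approx_shift (h : R) f L : rkhs_approx v f L ->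
  rkhs_approx v (shift_path h f) L.
Proof.
move=> [u [cau [pt nm]]]; exists (fun n => kshift h (u n)); split; [|split].
- move=> e e0; have [N HN] := cau _ e0; exists N => m k Nm Nk.
  by have := HN m k Nm Nk; rewrite !knorm2_kdiff !kcov_shift.
- move=> t; have -> : (fun n => kfun (kshift h (u n)) t) =
      (fun n => kfun (u n) (t + h) - kfun (u n) h).
    by apply/funext => n; rewrite kfun_shift.
  by apply: (@cvgB _ R^o); exact: pt.
- have -> : (fun n => knorm2 v (kshift h (u n))) = (fun n => knorm2 v (u n)) => //.
  by apply/funext => n; rewrite !knorm2E kcov_shift.
Qed.

Lemma apply_path_cvg m (g : nat -> R -> R) f : (forall t, (g^~ t) @ \oo --> f t) ->
  (fun n => apply_path m (g n)) @ \oo --> apply_path m f.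
Proof.
move=> gf; elim: m => [|p m IH].
  rewrite /apply_path; under eq_fun do rewrite big_nil; rewrite big_nil; exact: cvg_cst.
rewrite /apply_path; under eq_fun do rewrite big_cons; rewrite big_cons.
apply: (@cvgD _ R^o) => //; apply: cvgM; [exact: cvg_cst|exact: gf].
Qed.

Lemma rkhs_approx_bound f L m : rkhs_approx v f L ->
  apply_path m f ^+ 2 <= L * kcov m m.
Proof.
move=> [u [_ [pt nm]]].
have c1 : (fun n => apply_path m (kfun (u n)) ^+ 2) @ \oo --> apply_path m f ^+ 2.
  have h := @apply_path_cvg m _ _ pt.
  by under eq_fun do rewrite expr2; rewrite expr2; apply: cvgM.
have c2 : (fun n => knorm2 v (u n) * kcov m m) @ \oo --> L * kcov m m.
  by apply: cvgM => //; exact: cvg_cst.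
apply: (ler_cvg_to c1 c2); apply: nearW => n.
by rewrite apply_kfun knorm2E kcov_cauchy_schwarz.
Qed.

Lemma rkhs_approx_ge0 f L : rkhs_approx v f L -> 0 <= L.
Proof.
move=> [u [_ [_ nm]]]; apply: (ler_cvg_to (cvg_cst 0) nm).
by apply: nearW => n; rewrite knorm2E kcov_ge0.
Qed.

(** A late term of the approximating sequence. One [l] serves every functional [m], with an error
    relative to the norm of [m]; applied to evaluations this is uniform in time after weighting. *)
Lemma rkhs_approx_near f L (eta : R) : 0 < eta -> rkhs_approx v f L ->
  exists l, knorm2 v l <= L + eta /\
    forall m, (apply_path m f - apply_path m (kfun l)) ^+ 2 <= eta * kcov m m.
Proof.
move=> eta0 [u [cau [pt nm]]].
have [N HN] := cau _ eta0.
have /cvgrPdist_lt/(_ _ eta0) [N' _ HN'] := nm.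
pose k := maxn N N'; exists (u k); split.
  have := HN' k; rewrite /= leq_maxr => /(_ isT); rewrite ltr_norml; lra.
move=> m; have h := @apply_path_cvg m _ _ pt.
have c1 : (fun n => (apply_path m (kfun (u n)) - apply_path m (kfun (u k))) ^+ 2) @ \oo -->
    (apply_path m f - apply_path m (kfun (u k))) ^+ 2.
  have hB : (fun n => apply_path m (kfun (u n)) - apply_path m (kfun (u k))) @ \oo -->
      apply_path m f - apply_path m (kfun (u k)).
    by apply: (@cvgB _ R^o) => //; exact: cvg_cst.
  by under eq_fun do rewrite expr2; rewrite expr2; apply: cvgM.
apply: (ler_cvg_to c1 (cvg_cst (eta * kcov m m))).
near=> n; rewrite !apply_kfun.
have -> : kcov (u n) m - kcov (u k) m = kcov (kdiff (u n) (u k)) m.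
  by rewrite kdiffE !kcovE mulN1r.
apply: (le_trans (kcov_cauchy_schwarz _ _)).
apply: ler_wpM2r; first exact: kcov_ge0.
rewrite -knorm2E; apply: ltW; apply: HN; last exact: leq_maxl.
near: n; exact: nbhs_infty_ge.
Unshelve. all: by end_near. Qed.

Section variance_growth.
Hypothesis v_cont : {within `[0, +oo[, continuous v}.
Hypothesis v_ge0 : forall t : R, 0 <= t -> 0 <= v t.
Hypothesis v_growth : exists alpha : R, alpha < 2 /\
  (fun t => v t / t `^ alpha) @ +oo --> (0 : R).

Lemma v_tail (eta : R) : 0 < eta ->
  \forall M \near \oo, forall t : R, M%:R <= t -> v t <= eta * (1 + t) ^+ 2.
Proof.
move=> eta0; have [al [al2 /cvgrPdist_lt/(_ _ eta0)[K [_ HK]]]] := v_growth.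
near=> M => t Mt.
have M1 : 1 <= M%:R :> R by rewrite ler1n; near: M; exact: nbhs_infty_gt.
have t1 : 1 <= t by exact: le_trans Mt.
have Kt : K < t by apply: lt_le_trans Mt; near: M; exact: nbhs_infty_gtr.
have p0 : 0 < t `^ al by rewrite powR_gt0//; lra.
have := HK t Kt; rewrite /= sub0r normrN ger0_norm; last first.
  by rewrite divr_ge0 ?v_ge0//; lra.
rewrite ltr_pdivrMr// => h; apply: (le_trans (ltW h)).
rewrite ler_pM2l//; apply: (@le_trans _ _ (t ^+ 2)).
  by rewrite -powR_mulrn ?ler_powR// ?ltW//; lra.
by rewrite ler_pXn2r// ?nnegrE; lra.
Unshelve. all: by end_near. Qed.

Lemma continuous_vabs : continuous (fun t : R => v `|t|).
Proof.
move=> t.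
have := (continuous_within_itvcyP 0 v).1 v_cont.
move=> [vc vr]; have [t0|t0] := eqVneq t 0.
  subst t; apply/cvgrPdist_lt => e e0 /=; rewrite normr0.
  move/cvgrPdist_lt : vr => /(_ _ e0) [dl /= dl0 H].
  exists dl => //= x /=; rewrite sub0r normrN => xd.
  have [->|x0] := eqVneq x 0; first by rewrite normr0 subrr normr0.
  apply: H => /=; first by rewrite sub0r normrN normr_id.
  by rewrite normr_gt0.
apply: (@continuous_comp _ _ _ (fun x : R => `|x|) v); first exact: norm_continuous.
by apply: vc; rewrite in_itv/= andbT normr_gt0.
Qed.

Lemma v_near0 (eta : R) : 0 < eta ->
  exists2 h : R, 0 < h & forall u : R, 0 <= u <= h -> v u <= eta.
Proof.
move=> eta0; have /cvgrPdist_lt/(_ _ eta0) [dl /= dl0 H] := @continuous_vabs 0.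
exists (dl / 2); first by rewrite divr_gt0.
move=> u /andP[u0 ud]; have := H u; rewrite /= sub0r normrN ger0_norm// => /(_ _)/wrap[|].
  lra.
rewrite normr0 v0 sub0r normrN => h.
by apply: (le_trans (ler_norm _)); exact: ltW.
Qed.

Lemma v_bound : exists2 C, 0 < C & forall t, 0 <= t -> v t <= C * (1 + t) ^+ 2.
Proof.
have [M _ /(_ _ (leqnn M)) HM] := v_tail ltr01.
have [|m _ Hm] := @EVT_max R (fun x => v `|x|) 0 M%:R (ler0n _ _).
  by apply: continuous_subspaceT; exact: continuous_vabs.
have m0 := v_ge0 (normr_ge0 m).
exists (1 + v `|m|); first lra.
move=> t t0; have q : 1 <= (1 + t) ^+ 2 by rewrite exprn_ege1//; lra.
have [tM|/ltW Mt] := lerP t M%:R.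
  have := Hm t; rewrite in_itv/= t0 tM (ger0_norm t0) => /(_ isT); nra.
have := HM t Mt; nra.
Qed.

(** By the Cauchy-Schwarz inequality it suffices that [osc] has small variance. This is [v] at a
    time below the mesh, or [v t / (1 + t) ^ 2] for late [t], so one grid serves the whole ball. *)
Lemma tame_rkhs (a e : R) : 0 <= a -> 0 < e ->
  \forall M \near \oo, \forall N \near \oo, forall l, knorm2 v l <= a ->
    tame M N e (kfun l).
Proof.
move=> a0 e0.
have a1 : 0 < 1 + a by lra.
pose eta := e ^+ 2 / (1 + a).
have eta0 : 0 < eta by rewrite divr_gt0// exprn_gt0.
have ae : a * eta <= e ^+ 2.
  by rewrite /eta mulrCA ler_piMr ?sqr_ge0// ler_pdivrMr// mul1r; lra.
have [h h0 Hh] := v_near0 eta0.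
have := v_tail eta0; apply: filterS => M HM.
near=> N => l la t t0.
have N0 : (0 < N)%N by near: N; exact: nbhs_infty_gt.
have Nh : N%:R^-1 <= h.
  near: N; have /cvgrPdist_lt/(_ _ h0) := @cvgn_invn R.
  apply: filterS => N; rewrite sub0r normrN ger0_norm ?invr_ge0//; exact: ltW.
rewrite apply_kfun -ler_sqr ?nnegrE ?normr_ge0 ?(ltW e0)// real_normK ?num_real//.
apply: (le_trans (kcov_cauchy_schwarz _ _)); apply: le_trans ae.
apply: ler_pM => //; [exact: kcov_ge0..|].
rewrite /osc; case: ltP => [tM|Mt].
  rewrite kcov_incr; have /andP[g1 g2] := gridpt_itv N0 t0.
  have -> : `|- t - - gridpt N t| = t - gridpt N t.
    by rewrite opprK addrC distrC ger0_norm//; lra.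
  by apply: Hh; apply/andP; split; lra.
rewrite kcov_point normrN (ger0_norm t0) exprVn mulrC ler_pdivrMr; last first.
  by rewrite exprn_gt0//; lra.
exact: HM.
Unshelve. all: by end_near. Qed.

(** The decay at infinity follows from [Gam v s t ^ 2 <= v |s| * v |t|] and the growth of [v] below
    [t ^ 2]. *)
Lemma in_Omega_kfun l : in_Omega (kfun l).
Proof.
elim: l => [|p l IH].
  have -> : kfun [::] = (fun=> 0) by apply/funext => t; rewrite /kfun big_nil.
  exact: in_Omega0.
have -> : kfun (p :: l) = (fun t => p.2 * Gam v p.1 t + kfun l t).
  by apply/funext => t; rewrite /kfun big_cons.
apply: in_OmegaD => //; apply: in_OmegaZ.
have cG : continuous (Gam v p.1).
  move=> t; apply: cvgM; last exact: cvg_cst.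
  apply: (@cvgB _ R^o).
    by apply: (@cvgD _ R^o); [exact: cvg_cst|exact: continuous_vabs].
  apply: (@continuous_comp _ _ _ (fun x : R => x - p.1) (fun x : R => v `|x|)).
    by apply: (@cvgB _ R^o); [exact: cvg_id|exact: cvg_cst].
  exact: continuous_vabs.
have bound t : Gam v p.1 t ^+ 2 <= v `|p.1| * v `|t|.
  have := kcov_cauchy_schwarz [:: (p.1, 1)] [:: (t, 1)].
  by rewrite !kcov_point /kcov !big_seq1 /= !expr1n !mul1r.
have small (e : R) : 0 < e -> exists K : R, forall t, K < `|t| ->
    `|Gam v p.1 t / (1 + `|t|)| < e.
  move=> e0; have w0 : 0 < 1 + v `|p.1| by have := v_ge0 (normr_ge0 p.1); lra.
  pose eta := (e / 2) ^+ 2 / (1 + v `|p.1|).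
  have eta0 : 0 < eta by rewrite divr_gt0// exprn_gt0// divr_gt0.
  have [M _ /(_ _ (leqnn M)) HM] := v_tail eta0.
  exists M%:R => t Mt; have t1 : 0 < 1 + `|t| by have := normr_ge0 t; lra.
  rewrite normrM normfV (gtr0_norm t1) ltr_pdivrMr//.
  apply: (@le_lt_trans _ _ (e / 2 * (1 + `|t|))); last by rewrite ltr_pM2r//; lra.
  rewrite -ler_sqr ?nnegrE ?normr_ge0 ?mulr_ge0//; try lra.
  rewrite real_normK ?num_real//; apply: (le_trans (bound t)).
  apply: (@le_trans _ _ (v `|p.1| * (eta * (1 + `|t|) ^+ 2))).
    by apply: ler_wpM2l; [exact/v_ge0/normr_ge0|exact: HM (ltW Mt)].
  rewrite mulrA exprMn ler_wpM2r ?sqr_ge0//.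
  rewrite /eta mulrCA ler_piMr ?sqr_ge0// ler_pdivrMr// mul1r; lra.
apply/in_OmegaP; split => //.
by rewrite /Gam normr0 v0 sub0r normrN; ring.
Qed.

End variance_growth.
End rkhs.

(** * The overflow event for the mean path *)

Section event.
Variables (R : realType) (v : R -> R).
Variables (d : measure_display) (T : measurableType d) (P : probability T R).
Variable A : nat -> T -> R -> R.
Hypothesis A_paths : forall i w, in_Omega (A i w).
Hypothesis A_law : iid_gaussian_family P v A.
Variables (b c1 c2 : R).
Hypotheses (c2_gt0 : 0 < c2) (c12 : c2 < c1).

Let c1_gt0 : 0 < c1. Proof. exact: lt_trans c12. Qed.

(** A difference of suprema above [b] means a margin uniform in [s], hence a larger level [beta]
    with weak inequalities rather than strict inequalities at level [b]. *)
Definition exceeds (f : R -> R) := exists2 beta, b < beta & reach c1 c2 beta f.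

Lemma workload_meanE n (c t : R) w : (0 < n)%N ->
  (\sum_(i < n) (A i w 0 - A i w (- t))) - n%:R * c * t =
  n%:R * (- mean_path A n w (- t) - c * t).
Proof.
move=> n0; have n0' : n%:R != 0 :> R by rewrite pnatr_eq0 -lt0n.
have -> : \sum_(i < n) (A i w 0 - A i w (- t)) = - \sum_(i < n) A i w (- t).
  rewrite -sumrN; apply: eq_bigr => i _.
  by have [_ [-> _]] := A_paths i w; rewrite sub0r.
by rewrite /mean_path; field.
Qed.

Lemma Q2_exceeds n w : (0 < n)%N ->
  (n%:R * b < Q2 A n c1 c2 w) <-> exceeds (mean_path A n w).
Proof.
move=> n0; have n0' : 0 < n%:R :> R by rewrite ltr0n.
have Om := in_Omega_mean A_paths n w.
set f := mean_path A n w in Om *.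
pose E c := [set n%:R * (- f (- t) - c * t) | t in [set t : R | 0 < t]].
have workE c : workload A n c w = sup (E c).
  by rewrite /workload /E; congr sup; apply: eq_imagel => t _; rewrite workload_meanE.
(* Sublinear growth of the path bounds both sets, so [sup] is a genuine least upper bound. *)
have supE c : 0 < c -> has_sup (E c).
  move=> c0; split; first by exists (n%:R * (- f (- 1) - c * 1)); exists 1 => //=.
  have [m _ Hm] := Omega_drift_max Om c0 (lexx 0).
  exists (n%:R * (- f (- m) - c * m)) => _ [t /= t0 <-].
  by rewrite ler_pM2l//; apply: Hm; exact: ltW.
have [ne1 ub1] := supE c1 c1_gt0; have [ne2 ub2] := supE c2 c2_gt0.
rewrite /Q2 !workE; split.
  rewrite ltrBrDr => /(sup_gt ne2) [_ [t /= t0 <-] h].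
  exists (- f (- t) - c2 * t - sup (E c1) / n%:R).
    by rewrite ltrBrDr -(ltr_pM2l n0') mulrDr mulrCA divff ?gt_eqF// mulr1.
  exists t => // s s0.
  have : n%:R * (- f (- s) - c1 * s) <= sup (E c1) by apply: ub_le_sup => //; exists s.
  rewrite -ler_pdivlMl// mulrC; lra.
move=> [beta bb [t t0 H]].
have h1 : sup (E c1) <= n%:R * (- f (- t) - c2 * t - beta).
  apply: ge_sup => // _ [s /= s0 <-]; rewrite ler_pM2l//.
  by have := H s s0; lra.
have h2 : n%:R * (- f (- t) - c2 * t) <= sup (E c2) by apply: ub_le_sup => //; exists t.
have : n%:R * b < n%:R * beta by rewrite ltr_pM2l.
lra.
Qed.

(** With rational times and margins [k.+1^-1] the event becomes a countable combination of linear
    inequalities, hence measurable. *)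
Lemma exceeds_ratpt (f : R -> R) : continuous f ->
  exceeds f <-> exists k j : nat, 0 < ratpt R j /\ forall i : nat, 0 < ratpt R i ->
    - f (- ratpt R i) - c1 * ratpt R i + (b + k.+1%:R^-1) <=
    - f (- ratpt R j) - c2 * ratpt R j.
Proof.
move=> cf; split.
  move=> [beta bb [t t0 H]].
  have p0 : 0 < (beta - b) / 2 by rewrite divr_gt0// subr_gt0.
  have /cvgrPdist_lt/(_ _ p0) [e /= e0 He] := @continuous_drift _ f c2 cf t.
  have [j /andP[j1 j2]] : exists j, t < ratpt R j < t + e.
    by apply: ratpt_dense; [exact: ltW|rewrite ltrDl].
  have := He (ratpt R j); rewrite /= distrC gtr0_norm ?subr_gt0// ltrBlDl => /(_ j2).
  rewrite ltr_norml => /andP[_ hj].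
  have /cvgrPdist_lt/(_ _ p0) [k _ /(_ k.+1 (leqnSn k))] := @cvgn_invn R.
  rewrite sub0r normrN ger0_norm ?invr_ge0// => hk.
  exists k, j; split; first exact: lt_trans j1.
  by move=> i i0; have := H _ i0; move: hk; set q : R := _^-1 => hk; lra.
move=> [k [j [j0 H]]]; exists (b + k.+1%:R^-1); first by rewrite ltrDl invr_gt0.
exists (ratpt R j) => // s s0; rewrite -lerBrDr leNgt; apply/negP.
set K := (X in X < _); rewrite -subr_gt0 => p0.
have /cvgrPdist_lt/(_ _ p0) [e /= e0 He] := @continuous_drift _ f c1 cf s.
have [i /andP[i1 i2]] : exists i, s < ratpt R i < s + e.
  by apply: ratpt_dense; [exact: ltW|rewrite ltrDl].
have := He (ratpt R i); rewrite /= distrC gtr0_norm ?subr_gt0// ltrBlDl => /(_ i2).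
rewrite ltr_norml => /andP[_ hi].
by have := H i (lt_trans s0 i1); rewrite -lerBrDr -/K; lra.
Qed.

Lemma measurable_exceeds n : measurable [set w | exceeds (mean_path A n w)].
Proof.
pose L i j : seq (R * R) := [:: (- ratpt R i, -1); (- ratpt R j, 1)].
have -> : [set w | exceeds (mean_path A n w)] = \bigcup_k \bigcup_j
    (if 0 < ratpt R j then \bigcap_i (if 0 < ratpt R i then
      [set w | ev A (at_mean n (L i j)) w <=
        c1 * ratpt R i - c2 * ratpt R j - (b + k.+1%:R^-1)] else setT) else set0).
  have lE i j w : ev A (at_mean n (L i j)) w =
      - mean_path A n w (- ratpt R i) + mean_path A n w (- ratpt R j).
    by rewrite ev_at_mean /apply_path !big_cons big_nil /= mulN1r mul1r addr0.
  apply/seteqP; split => w /=.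
    have [cm _] := in_Omega_mean A_paths n w.
    move=> /(exceeds_ratpt cm) [k [j [j0 H]]]; exists k => //; exists j => //.
    rewrite j0 => i _; case: ifP => // i0 /=; rewrite lE.
    by have := H i i0; set q := b + _; lra.
  move=> [k _ [j _]]; case: ifP => // j0 H.
  have [cm _] := in_Omega_mean A_paths n w.
  apply/(exceeds_ratpt cm); exists k, j; split => // i i0.
  by have := H i I; rewrite i0 /= lE; set q := b + _; lra.
apply: bigcup_measurable => k _; apply: bigcup_measurable => j _.
case: ifP => // _; apply: bigcapT_measurable => i; case: ifP => // _.
rewrite -[X in measurable X]setTI; apply: measurable_fun_le => //.
exact: (measurable_ev A_law).
Qed.

End event.

(** * Discretization of the event on a time grid *)

Section grid.
Variables (R : realType) (b c1 c2 : R).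
Hypotheses (c2_gt0 : 0 < c2) (c12 : c2 < c1).

Definition gridtime (N k : nat) : R := k%:R / N%:R.

(** The instance [k = 0] is always available, so the bound on [i] is effective although it sits
    under the quantifier. For [f 0 = 0] that instance also forces the value at [i] to be at least
    [b - e]. *)
Definition grid_exceeds (M N : nat) (e : R) (f : R -> R) := exists i : nat,
  forall k : nat, (k <= M * N)%N ->
  (i <= M * N)%N /\ - f (- gridtime N k) - c1 * gridtime N k + (b - e) <=
    - f (- gridtime N i) - c2 * gridtime N i.

Lemma gridptE N (t : R) : gridpt N t = gridtime N (Num.truncn (t * N%:R)).
Proof. by []. Qed.

Lemma truncn_grid M N (t : R) : (0 < N)%N -> 0 <= t -> t < M%:R ->
  (Num.truncn (t * N%:R) <= M * N)%N.
Proof.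
move=> N0 t0 tM; have n0 : (0 : R) < N%:R by rewrite ltr0n.
have /truncn_itv/andP[h1 _] : 0 <= t * N%:R by rewrite mulr_ge0.
by rewrite -(ler_nat R) natrM; apply: (le_trans h1); rewrite ler_pM2r// ltW.
Qed.

(** A tame path cannot attain [b] after [M], being at most [e * (1 + t)] there against a drift
    [c2 * t]. So the witness lies before [M], and rounding it down costs [e]. *)
Lemma exceeds_grid M N (e : R) (f : R -> R) : (0 < N)%N -> continuous f -> f 0 = 0 -> 0 < b ->
  0 < e -> e < c2 / 2 -> e < b -> tame M N e f -> exceeds b c1 c2 f ->
  grid_exceeds M N e f.
Proof.
move=> N0 cf f0 b0 e0 ec eb tf [beta bb [t t0 H]].
have bt := reach_ge cf f0 H.
have [tM|Mt] := ltP t M%:R; last first.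
  have := tf t (ltW t0); rewrite apply_osc ltNge Mt /=.
  have t10 : 0 < 1 + t by lra.
  rewrite normrM normfV (gtr0_norm t10) ler_pdivrMr// ler_norml => /andP[h1 h2].
  exfalso; have : e * t <= c2 / 2 * t by rewrite ler_pM2r// ltW.
  have : 0 <= c2 * t by rewrite mulr_ge0// ltW.
  have : e < b by []. lra.
exists (Num.truncn (t * N%:R)) => k kM; split; first exact: (truncn_grid N0 (ltW t0) tM).
have := tf t (ltW t0); rewrite apply_osc tM ler_norml -gridptE => /andP[h1 h2].
have /andP[g1 _] := gridpt_itv N0 (ltW t0).
have : c2 * gridpt N t <= c2 * t by rewrite ler_pM2l.
have [->|k0] := posnP k.
  by rewrite /gridtime mul0r oppr0 f0; lra.
have kp : 0 < gridtime N k by rewrite divr_gt0// ltr0n.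
by have := H _ kp; lra.
Qed.

(** Rounding [s] down lowers the drift [c1 * s], so only the oscillation [e'] is lost; after [M] the
    drift [c1] makes the comparison automatic. *)
Lemma grid_reach M N (e e' : R) (f : R -> R) : (0 < N)%N -> continuous f -> f 0 = 0 ->
  0 < e' -> e' < c1 / 2 -> e' <= M%:R * (c1 / 2) -> tame M N e' f ->
  grid_exceeds M N e f -> 0 < b - e -> reach c1 c2 (b - e - e') f.
Proof.
move=> N0 cf f0 e0 ec eM tf [i Hi] be.
have c1_gt0 : 0 < c1 by exact: lt_trans c12.
have [_ h0] := Hi 0%N (leq0n _).
rewrite /gridtime mul0r oppr0 f0 -/(gridtime N i) in h0.
exists (gridtime N i).
  have [i0|i0] := posnP i; last by rewrite divr_gt0// ltr0n.
  exfalso; move: h0; rewrite i0 /gridtime mul0r oppr0 f0; lra.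
move=> s s0; have := tf s (ltW s0); rewrite apply_osc; case: ltP => [sM|Ms].
  rewrite ler_norml gridptE => /andP[h1 h2].
  have /andP[g1 _] := gridpt_itv N0 (ltW s0).
  have := Hi _ (truncn_grid N0 (ltW s0) sM) => -[_ hk].
  have : c1 * gridpt N s <= c1 * s by rewrite ler_pM2l.
  rewrite gridptE; lra.
have s10 : 0 < 1 + s by lra.
rewrite normrM normfV (gtr0_norm s10) ler_pdivrMr// ler_norml => /andP[h1 h2].
have : e' * s <= c1 / 2 * s by rewrite ler_pM2r// ltW.
have : M%:R * (c1 / 2) <= s * (c1 / 2) by rewrite ler_pM2r// divr_gt0.
lra.
Qed.

End grid.

(** * Regaining a strict excess at a small cost in norm *)

Section improve.
Variables (R : realType) (v : R -> R).
Hypothesis v_cont : {within `[0, +oo[, continuous v}.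
Hypothesis v0 : v 0 = 0.
Hypothesis kcov_ge0 : forall l, 0 <= kcov v l l.
Variables (b c1 c2 : R).
Hypotheses (b_gt0 : 0 < b) (c2_gt0 : 0 < c2) (c12 : c2 < c1).

Lemma in_Omega_shift h (f : R -> R) : in_Omega f -> in_Omega (shift_path h f).
Proof.
move=> /in_OmegaP [cf f0 small]; apply/in_OmegaP; split.
- move=> x; apply: (@cvgB _ R^o); last exact: cvg_cst.
  apply: (@continuous_comp _ _ _ (fun x : R => x + h) f); last exact: cf.
  by apply: (@cvgD _ R^o); [exact: cvg_id|exact: cvg_cst].
- by rewrite /shift_path add0r subrr.
move=> e e0; have h1 : 0 < 1 + `|h| by have := normr_ge0 h; lra.
have [K HK] := small (e / (2 * (1 + `|h|))) (divr_gt0 e0 (mulr_gt0 (ltr0n R 2) h1)).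
exists (Num.max (K + `|h|) (2 * `|f h| / e)) => t; rewrite gt_max => /andP[k1 k2].
have t1 : 0 < 1 + `|t| by have := normr_ge0 t; lra.
have th1 : 0 < 1 + `|t + h| by have := normr_ge0 (t + h); lra.
have Kth : K < `|t + h|.
  have := lerB_dist t (- h); rewrite opprK normrN; lra.
have := HK _ Kth; rewrite normrM normfV (gtr0_norm th1) ltr_pdivrMr// => h2.
rewrite normrM normfV (gtr0_norm t1) ltr_pdivrMr//.
have h3 : e / (2 * (1 + `|h|)) * (1 + `|t + h|) <= e / 2 * (1 + `|t|).
  have -> : e / 2 * (1 + `|t|) = e / (2 * (1 + `|h|)) * ((1 + `|h|) * (1 + `|t|)).
    by field; rewrite gt_eqF.
  rewrite ler_pM2l ?divr_gt0 ?mulr_gt0//.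
  have := ler_normD t h; have := mulr_ge0 (normr_ge0 h) (normr_ge0 t); lra.
have h4 : `|f h| < e / 2 * `|t|.
  by move: k2; rewrite ltr_pdivrMr//; lra.
apply: (le_lt_trans (ler_normB _ _)); lra.
Qed.

(* The path [g] is [f] scaled by [lam] and shifted in time. *)
Lemma rkhs_improve (a lam : R) : 0 <= a -> 1 < lam ->
  exists eps : R, [/\ 0 < eps, eps < b & forall f L, in_Omega f ->
    rkhs_approx v f L -> L <= 2 * a -> reach c1 c2 (b - eps) f ->
    exists g, [/\ in_Omega g, exceeds b c1 c2 g & rkhs_approx v g (lam ^+ 2 * L)]].
Proof.
move=> a0 l1; have l0 : 0 < lam by lra.
have c1_gt0 : 0 < c1 by exact: lt_trans c12.
(* Half of the gain [(lam - 1) * b] from scaling. The shift [h] is then so short that no path of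
   squared norm at most [2 * a] lets [lam * |f u| + c1 * u] exceed [kap] on [[0, h]]. *)
pose kap := (lam - 1) * b / 2.
have kap0 : 0 < kap by rewrite divr_gt0// mulr_gt0// subr_gt0.
pose eta := (kap / (2 * lam)) ^+ 2 / (2 * a + 1).
have a1 : 0 < 2 * a + 1 by lra.
have kl0 : 0 < kap / (2 * lam) by rewrite divr_gt0// mulr_gt0.
have eta0 : 0 < eta by rewrite divr_gt0// exprn_gt0.
have [h1 h10 Hh1] := v_near0 v0 v_cont eta0.
pose h := Num.min h1 (kap / (2 * c1)).
have h0 : 0 < h by rewrite lt_min h10 divr_gt0// mulr_gt0.
have hh1 : h <= h1 by rewrite ge_min lexx.
have hc : c1 * h <= kap / 2.
  have : h <= kap / (2 * c1) by rewrite ge_min lexx orbT.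
  by rewrite ler_pdivlMr ?mulr_gt0//; lra.
have c0 : 0 < c1 - c2 by rewrite subr_gt0.
(* Smaller than what either alternative of [reach_improve] gains, and chosen without reference to
   [f]. *)
pose eps := Num.min (b / 2) (Num.min (kap / (2 * lam)) ((c1 - c2) * h / 2)).
have eps1 : eps <= b / 2 by rewrite ge_min lexx.
have eps2 : eps <= kap / (2 * lam) by rewrite !ge_min lexx !orbT.
have eps3 : eps <= (c1 - c2) * h / 2 by rewrite !ge_min lexx !orbT.
have ch0 : 0 < (c1 - c2) * h by rewrite mulr_gt0.
have eps0 : 0 < eps by rewrite !lt_min kl0 (divr_gt0 b_gt0)// (divr_gt0 ch0).
clearbody eps h.
exists eps; split => //; first lra.
move=> f L Of fL La rf.
have ful u : 0 <= u <= h -> lam * `|f u| + c1 * u <= kap.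
  move=> /andP[u0 uh].
  have := rkhs_approx_bound kcov_ge0 [:: (u, 1)] fL.
  rewrite /apply_path big_seq1 kcov_point//= mul1r expr1n mul1r (ger0_norm u0) => hf.
  have vu : v u <= eta by apply: Hh1; rewrite u0 (le_trans uh).
  have fu : `|f u| <= kap / (2 * lam).
    rewrite -ler_sqr ?nnegrE ?normr_ge0 ?(ltW kl0)// real_normK ?num_real//.
    apply: (le_trans hf); apply: (@le_trans _ _ (2 * a * eta)).
      have L0 := rkhs_approx_ge0 kcov_ge0 fL.
      apply: (@le_trans _ _ (L * eta)); first exact: ler_wpM2l.
      by apply: ler_wpM2r => //; exact: ltW.
    rewrite /eta mulrCA ler_piMr ?sqr_ge0// ler_pdivrMr// mul1r; lra.
  have : lam * `|f u| <= kap / 2.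
    have -> : kap / 2 = lam * (kap / (2 * lam)) by field; rewrite gt_eqF.
    by rewrite ler_pM2l.
  have : c1 * u <= c1 * h by rewrite ler_pM2l.
  lra.
have be0 : 0 < b - eps by lra.
have [r|r] := reach_improve c2_gt0 c12 (ltW h0) be0 (ltW l1) Of ful rf.
- exists (fun t => lam * f t); split; [exact: in_OmegaZ| |exact: rkhs_approx_scale].
  exists (lam * (b - eps) - kap) => //.
  have : lam * eps <= kap / 2.
    have -> : kap / 2 = lam * (kap / (2 * lam)) by field; rewrite gt_eqF.
    by rewrite ler_pM2l.
  have : kap = (lam * b - b) / 2 by rewrite /kap; ring.
  lra.
- exists (fun t => lam * shift_path h f t); split.
  + by apply: in_OmegaZ; exact: in_Omega_shift.
  + by exists (b - eps + (c1 - c2) * h) => //; lra.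
  + by apply: rkhs_approx_scale => //; exact: rkhs_approx_shift.
Qed.

End improve.

(** * Covering the grid event by finitely many half spaces *)

Lemma continuous_row_lin (R : realType) (K : nat) (th : 'rV[R]_K) :
  continuous (fun y : 'rV[R]_K => \sum_k th ord0 k * y ord0 k : R).
Proof.
elim: (index_enum _) => [|k r IH].
  have -> : (fun y : 'rV[R]_K => \sum_(k <- [::]) th ord0 k * y ord0 k : R) = (fun=> 0 : R).
    by apply/funext => z; rewrite big_nil.
  by move=> y; exact: cst_continuous.
have -> : (fun y : 'rV[R]_K => \sum_(j <- k :: r) th ord0 j * y ord0 j : R) =
    (fun y : 'rV[R]_K => th ord0 k * y ord0 k + \sum_(j <- r) th ord0 j * y ord0 j : R).
  by apply/funext => z; rewrite big_cons.
move=> y; apply: (@continuousD R R^o 'rV[R]_K (fun y => th ord0 k * y ord0 k) (fun y => \sum_(j <- r) th ord0 j * y ord0 j) y); last exact: IH.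
apply: (@continuousM R 'rV[R]_K (fun=> th ord0 k) (fun y => y ord0 k) y); [exact: cst_continuous|exact: coord_continuous].
Qed.

Section finite_cover.
Variables (R : realType) (v : R -> R) (b c1 c2 e a : R) (M N : nat).
Local Notation K := (M * N).+1.
Local Notation tau k := (gridtime R N (nat_of_ord k)).

Definition glist (th : 'rV[R]_K) : seq (R * R) :=
  [seq (- tau k, th ord0 k) | k <- enum 'I_K].

Lemma apply_glist th f : apply_path (glist th) f = \sum_k th ord0 k * f (- tau k).
Proof. by rewrite /apply_path big_map big_enum. Qed.

Definition sigma : 'M[R]_K := \matrix_(j, k) Gam v (- tau j) (- tau k).

Lemma kfun_glist th k : kfun v (glist th) (- tau k) = (th *m sigma) ord0 k.
Proof.
rewrite /kfun big_map big_enum mxE; apply: eq_bigr => j _.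
by rewrite mxE.
Qed.

Lemma kcov_glist th :
  kcov v (glist th) (glist th) = \sum_k th ord0 k * (th *m sigma) ord0 k.
Proof.
rewrite -apply_kfun apply_glist; apply: eq_bigr => k _.
by rewrite kfun_glist.
Qed.

Definition gridcond (y : 'rV[R]_K) := exists i : 'I_K, forall k : 'I_K,
  - y ord0 k - c1 * tau k + (b - e) <= - y ord0 i - c2 * tau i.

Lemma grid_exceedsP f : grid_exceeds b c1 c2 M N e f <-> gridcond (\row_k f (- tau k)).
Proof.
split.
  move=> [i H]; have [iM _] := H 0%N (leq0n _).
  have iK : (i < K)%N by rewrite ltnS.
  exists (Ordinal iK) => k; rewrite !mxE /=.
  by have [] := H k; rewrite -ltnS.
move=> [i H]; exists i => k kM; split; first by rewrite -ltnS.
have kK : (k < K)%N by rewrite ltnS.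
by have := H (Ordinal kK); rewrite !mxE.
Qed.

Hypothesis Hno : forall th, knorm2 v (glist th) <= 2 * a ->
  ~ grid_exceeds b c1 c2 M N e (kfun v (glist th)).

Let O (th : 'rV[R]_K) : set 'rV[R]_K :=
  [set y | a + kcov v (glist th) (glist th) / 2 < \sum_k th ord0 k * y ord0 k].

Lemma sigma_sym : sigma^T = sigma.
Proof. by apply/matrixP => i j; rewrite !mxE Gam_sym. Qed.

(** For [y = th *m sigma] the value of [th] at [y] equals the variance of [th], so [th] itself
    separates [y]. Any [y] outside the range of [sigma] is separated by a multiple of a null vector
    of [sigma], whose variance is 0. *)
Lemma gridcond_separated y : gridcond y -> exists th, O th y.
Proof.
move=> gy; have [ys|ys] := boolP (y <= sigma)%MS.
  have [th yE] := submxP ys; exists th; rewrite /O /= kcov_glist -yE.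
  set S := \sum_k _; rewrite ltNge; apply/negP => Sa.
  apply: (Hno (th := th)).
    by rewrite knorm2E kcov_glist -yE -/S; lra.
  apply/grid_exceedsP.
  have -> : \row_k kfun v (glist th) (- tau k) = y => //.
  by apply/rowP => k; rewrite mxE kfun_glist -yE.
move: ys; rewrite submxE => /matrix0Pn [i [j yj]].
pose th0 := (col j (cokermx sigma))^T.
have th0s : th0 *m sigma = 0.
  by apply: trmx_inj; rewrite trmx_mul trmxK sigma_sym trmx0 colE mulmxA mulmx_coker mul0mx.
pose q := \sum_k th0 ord0 k * y ord0 k.
have q0 : q != 0.
  move: yj; rewrite (ord1 i) mxE; congr (_ != 0).
  by apply: eq_bigr => k _; rewrite /th0 !mxE mulrC.
exists (((a + 1) / q) *: th0); rewrite /O /= kcov_glist -scalemxAl th0s scaler0.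
rewrite [X in X / 2]big1 => [|k _]; last by rewrite [X in _ * X]mxE mulr0.
under eq_bigr do rewrite mxE -mulrA.
by rewrite -mulr_sumr -/q divfK//; lra.
Qed.

(** Compactness gives a finite subcover within a cube. The sides [B k] are the thresholds of the
    coordinate functionals, so a point outside the cube lies in the half space of a signed
    coordinate, and these are added to the list. *)
Lemma half_space_cover : exists ls : seq (seq (R * R)),
  forall f, grid_exceeds b c1 c2 M N e f ->
    exists2 l, l \in ls & a + kcov v l l / 2 <= apply_path l f.
Proof.
pose B (k : 'I_K) : R := a + kcov v [:: (- tau k, 1)] [:: (- tau k, 1)] / 2.
pose bx := [set y : 'rV[R]_K | forall k, `[- B k, B k]%classic (y ord0 k)].
have cbx : compact bx.
  apply: (@rV_compact R^o K (fun k => `[- B k, B k]%classic)) => k.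
  exact: segment_compact.
have lin_cont := @continuous_row_lin R K.
have cg : closed [set y : 'rV[R]_K | gridcond y].
  have -> : [set y : 'rV[R]_K | gridcond y] = \bigcup_(i in [set: 'I_K]) \bigcap_(k in [set: 'I_K])
     [set y : 'rV[R]_K | y ord0 i - y ord0 k <= c1 * tau k - c2 * tau i - (b - e)].
    apply/seteqP; split => y /=.
      by move=> [i H]; exists i => // k _ /=; have := H k; lra.
    by move=> [i _ H]; exists i => k; have := H k I; rewrite /=; lra.
  apply: closed_bigcup; first exact: finite_finset.
  move=> i _; apply: closed_bigI => k _.
  apply: (@closed_comp _ _ (fun y : 'rV[R]_K => y ord0 i - y ord0 k : R)
    [set x | x <= c1 * tau k - c2 * tau i - (b - e)]); last exact: closed_le.
  move=> y _; apply: (@continuousB R R^o 'rV[R]_K (fun y => y ord0 i)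
    (fun y => y ord0 k) y); exact: coord_continuous.
have /compact_closedI/(_ cg) := cbx; rewrite compact_cover.
move=> /(_ _ setT O)/(_ _)/wrap[th _|].
  apply: (@open_comp _ _ (fun y : 'rV[R]_K => \sum_k th ord0 k * y ord0 k : R)
    [set x | a + kcov v (glist th) (glist th) / 2 < x]); last exact: open_gt.
  by move=> y _; exact: lin_cont.
move=> /(_ _)/wrap[y [_ /gridcond_separated [th Oth]]|]; first by exists th.
move=> [D _ HD].
pose sgn (k : 'I_K) : seq (seq (R * R)) := [:: [:: (- tau k, 1)]; [:: (- tau k, -1)]].
exists ([seq glist th | th <- finmap.enum_fset D] ++ flatten [seq sgn k | k <- enum 'I_K]).
move=> f gf; pose y : 'rV[R]_K := \row_k f (- tau k).
have gy : gridcond y by apply/grid_exceedsP.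
have [yb|] := pselect (bx y).
  have [|th thD Oth] := HD y; first by split.
  exists (glist th); first by rewrite mem_cat map_f.
  rewrite apply_glist; apply: ltW; move: Oth; rewrite /O /=.
  by under eq_bigr do rewrite mxE.
move=> /existsNP [k]; rewrite /= in_itv/= mxE => /negP; rewrite negb_and -!ltNge => h.
have mem l : l \in sgn k -> l \in [seq glist th | th <- finmap.enum_fset D] ++
    flatten [seq sgn k | k <- enum 'I_K].
  move=> ls; rewrite mem_cat; apply/orP; right; apply/flattenP.
  by exists (sgn k) => //; rewrite map_f// mem_enum.
have kE : kcov v [:: (- tau k, -1)] [:: (- tau k, -1)] = kcov v [:: (- tau k, 1)] [:: (- tau k, 1)].
  by rewrite /kcov !big_seq1 /=; ring.
case/orP: h => h.
- exists [:: (- tau k, -1)]; first by apply: mem; rewrite !inE eqxx orbT.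
  by rewrite kE -/(B k) /apply_path big_seq1 /=; lra.
- exists [:: (- tau k, 1)]; first by apply: mem; rewrite !inE eqxx.
  by rewrite -/(B k) /apply_path big_seq1 /=; lra.
Qed.

End finite_cover.

(** * Large deviation bounds *)

Lemma near_nat_ex2 (P Q : nat -> Prop) :
  (\forall n \near \oo, P n) -> (\forall n \near \oo, Q n) ->
  exists n, [/\ P n, Q n & (0 < n)%N].
Proof.
move=> [N1 _ H1] [N2 _ H2]; exists (maxn N1 N2).+1; split => //.
- by apply: H1; rewrite /= ltnW// ltnS leq_maxl.
- by apply: H2; rewrite /= ltnW// ltnS leq_maxr.
Qed.

Lemma expR_dominates (R : realType) (c x K : R) : 0 < c -> 0 < x ->
  \forall n \near \oo, K <= c * expR (n%:R * x).
Proof.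
move=> c0 x0; exists (Num.truncn (K / (c * x))).+1 => // n /= nn.
have cx : 0 < c * x by rewrite mulr_gt0.
have Kn : K / (c * x) <= n%:R.
  by apply: ltW; apply: lt_le_trans (truncnS_gt _) _; rewrite ler_nat.
rewrite ler_pdivrMr// in Kn; apply: (le_trans Kn).
have := expR_ge1Dx (n%:R * x) => h.
rewrite [leLHS](_ : _ = c * (n%:R * x)); last by ring.
by rewrite ler_pM2l//; apply: le_trans h; rewrite lerDr.
Qed.

Section deviation_bounds.
Variables (R : realType) (v : R -> R).
Hypothesis v_cont : {within `[0, +oo[, continuous v}.
Hypothesis v_ge0 : forall t : R, 0 <= t -> 0 <= v t.
Hypothesis v0 : v 0 = 0.
Hypothesis v_growth : exists alpha : R, alpha < 2 /\
  (fun t => v t / t `^ alpha) @ +oo --> (0 : R).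
Variables (d : measure_display) (T : measurableType d) (P : probability T R).
Variable A : nat -> T -> R -> R.
Hypothesis A_paths : forall i w, in_Omega (A i w).
Hypothesis A_law : iid_gaussian_family P v A.
Variables (b c1 c2 : R).
Hypotheses (b_gt0 : 0 < b) (c2_gt0 : 0 < c2) (c12 : c2 < c1).
Local Notation pr := (pr P).
Local Notation kcov := (kcov v).
Local Notation mean n w := (mean_path A n w).
Local Notation event n := [set w | exceeds b c1 c2 (mean n w)].

(** Positivity is read off the law: this is the variance of a functional of the first copy. *)
Lemma law_kcov_ge0 l : 0 <= kcov l l.
Proof. by have := cov_ge0 A_law (at_idx 0 l); rewrite cov_at_idx eqxx. Qed.

Lemma pr_union_le (I : eqType) (ls : seq I) (F : I -> set T) (c : R) :
  (forall i, measurable (F i)) -> (forall i, i \in ls -> pr (F i) <= c) ->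
  measurable [set w | exists2 i, i \in ls & F i w] /\
  pr [set w | exists2 i, i \in ls & F i w] <= (size ls)%:R * c.
Proof.
move=> mF; elim: ls => [|i ls IH] H.
  have -> : [set w | exists2 i, i \in [::] & F i w] = set0.
    by apply/seteqP; split => w //= -[].
  by split => //; rewrite mul0r /pr measure0.
have [|mU U] := IH; first by move=> j jl; apply: H; rewrite inE jl orbT.
have -> : [set w | exists2 j, j \in i :: ls & F j w] =
    F i `|` [set w | exists2 j, j \in ls & F j w].
  apply/seteqP; split => w /=.
    by move=> [j]; rewrite inE => /orP[/eqP ->|jl] Fj; [left|right; exists j].
  by case=> [Fi|[j jl Fj]]; [exists i => //; rewrite mem_head|exists j => //; rewrite inE jl orbT].
split; first exact: measurableU.
apply: (le_trans (prU_le _ _ _)) => //.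
have := H i (mem_head _ _) => hi.
by rewrite /= -natr1 mulrDl mul1r addrC lerD.
Qed.

Definition half_space n l (c : R) : set T := [set w | c <= apply_path l (mean n w)].

Lemma measurable_half_space n l c : measurable (half_space n l c).
Proof.
have -> : half_space n l c = [set w | c <= ev A (at_mean n l) w].
  by apply/seteqP; split => w /=; rewrite ev_at_mean.
rewrite -[X in measurable X]setTI; apply: measurable_fun_le => //.
exact: (measurable_ev A_law).
Qed.

Lemma pr_half_space n l c : (0 < n)%N ->
  pr (half_space n l c) <= expR (- (n%:R * (c - kcov l l / 2))).
Proof.
move=> n0; have n0' : 0 < n%:R :> R by rewrite ltr0n.
rewrite -lee_fin -prE; last exact: measurable_half_space.
have := centered_gaussian_chernoff (ev_gaussian A_law (vscale n%:R (at_mean n l))) (n%:R * c).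
rewrite cov_scalel cov_scaler cov_at_mean//.
have -> : [set w | n%:R * c <= ev A (vscale n%:R (at_mean n l)) w] = half_space n l c.
  by apply/seteqP; split => w /=; rewrite ev_scale ev_at_mean ler_pM2l.
have -> : n%:R * (n%:R * (n%:R^-1 * kcov l l)) / 2 - n%:R * c =
  - (n%:R * (c - kcov l l / 2)) by field; rewrite gt_eqF.
by [].
Qed.

Lemma tame_mean M N e n w : (0 < N)%N ->
  allev A (fun j => at_mean n (osc M N (ratpt R j))) e w -> tame M N e (mean n w).
Proof.
move=> N0 h; apply: tame_ratpt => //; first by case: (in_Omega_mean A_paths n w).
by move=> j; have := h j; rewrite ev_at_mean.
Qed.

(** One grid must serve both sides: the mean path is tame up to a negligible probability, which puts
    the event into the grid event; the kernel combinations in the ball are tame, so one of them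
    satisfying the grid condition would reach [b - eps]. *)
Lemma deviation_upper (a : R) : 0 < a ->
  (exists eps : R, [/\ 0 < eps, eps < b &
    forall l, knorm2 v l <= 2 * a -> ~ reach c1 c2 (b - eps) (kfun v l)]) ->
  exists2 C : R, 0 < C & forall n, (0 < n)%N -> pr (event n) <= C * expR (- (n%:R * a)).
Proof.
move=> a0 [eps [eps0 epsb Heps]].
have c20 := c2_gt0; have c12' := c12; have b0 := b_gt0.
pose e := Num.min (eps / 2) (c2 / 4).
have e0 : 0 < e by rewrite lt_min !divr_gt0.
have e1 : e <= eps / 2 by rewrite ge_min lexx.
have e2 : e <= c2 / 4 by rewrite ge_min lexx orbT.
clearbody e.
have ec : e < c1 / 2 by lra.
have ec2 : e < c2 / 2 by lra.
have eb : e < b by lra.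
have be : 0 < b - e by lra.
have bee : b - eps <= b - e - e by lra.
(* Any tightness rate above [a] makes paths that are not tame negligible. *)
pose r := (Num.truncn a).+1.
have ra : a < r%:R by exact: truncnS_gt.
have r0 : (0 < r)%N by [].
clearbody r.
have a20 : 0 <= 2 * a by lra.
have tR := tame_rkhs v0 law_kcov_ge0 v_cont v_ge0 v_growth a20 e0.
have tE := exponential_tightness A_paths A_law e0 r0.
have [M [hR hE M1]] := near_nat_ex2 tR tE.
have [N [HR HE N0]] := near_nat_ex2 hR hE.
have Hno (th : 'rV[R]_(M * N).+1) : knorm2 v (glist th) <= 2 * a ->
    ~ grid_exceeds b c1 c2 M N e (kfun v (glist th)).
  move=> la ge; apply: (Heps _ la).
  have [cf [f0 _]] := in_Omega_kfun v0 law_kcov_ge0 v_cont v_ge0 v_growth (glist th).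
  have eM : e <= M%:R * (c1 / 2).
    have M1' : (1 : R) <= M%:R by rewrite ler1n.
    apply: (le_trans (ltW ec)); apply: ler_peMl => //.
    by rewrite divr_ge0// ltW// (lt_trans c2_gt0).
  have := grid_reach c2_gt0 c12 N0 cf f0 e0 ec eM (HR _ la) ge be.
  exact: reach_le.
have [ls Hls] := half_space_cover Hno.
exists (1 + (size ls)%:R); first by rewrite ltr_pwDl.
move=> n n0; have n0' : 0 < n%:R :> R by rewrite ltr0n.
pose Fn l := half_space n l (a + kcov l l / 2).
have mF l : measurable (Fn l) by exact: measurable_half_space.
have prF l : l \in ls -> pr (Fn l) <= expR (- (n%:R * a)).
  by move=> _; apply: (le_trans (pr_half_space _ _ n0)); rewrite addrK.
have [mU prU] := pr_union_le mF prF.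
set U := [set w | _] in mU prU.
pose G := allev A (fun j => at_mean n (osc M N (ratpt R j))) e.
have mG : measurable G by exact: (measurable_allev A_law).
have sub : event n `<=` ~` G `|` U.
  move=> w ew; have [Gw|] := pselect (G w); last by left.
  right; have tm := tame_mean N0 Gw.
  have [cm [m0 _]] := in_Omega_mean A_paths n w.
  have [l ll hl] := Hls _ (exceeds_grid c2_gt0 N0 cm m0 b_gt0 e0 ec2 eb tm ew).
  by exists l.
apply: (@le_trans _ _ (pr (~` G `|` U))).
  apply: pr_le => //; first exact: (measurable_exceeds A_paths A_law).
  by apply: measurableU => //; exact: measurableC.
apply: (le_trans (prU_le _ (measurableC mG) mU)).
rewrite mulrDl mul1r lerD//.
apply: (le_trans (HE n n0)); rewrite ler_expR lerN2 natrM [leRHS]mulrC.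
by rewrite ler_pM2l// ltW.
Qed.

Definition slab n l (x y : R) : set T := [set w | x <= apply_path l (mean n w) <= y].

Lemma slabE n l x y : slab n l x y = [set w | x <= ev A (at_mean n l) w <= y].
Proof. by apply/seteqP; split => w /=; rewrite ev_at_mean. Qed.

Lemma measurable_slab n l x y : measurable (slab n l x y).
Proof.
rewrite slabE.
have -> : [set w | x <= ev A (at_mean n l) w <= y] =
    ev A (at_mean n l) @^-1` `[x, y] by apply/seteqP; split => w /=; rewrite in_itv.
by rewrite -[X in measurable X]setTI; exact: (measurable_ev A_law).
Qed.

(** The slab starts at [kcov l l], the value of [l] at [kfun v l]. Under the mean the variance is
    [kcov l l / n], so the peak of the density only grows with [n] and the constant for [n = 1]
    serves all [n]. *)
Lemma pr_slab_ge l (dl : R) : 0 < kcov l l -> 0 < dl -> exists2 c0 : R, 0 < c0 &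
  forall n, (0 < n)%N ->
  c0 * expR (- (n%:R * (kcov l l * (1 + dl) ^+ 2 / 2))) <=
  pr (slab n l (kcov l l) (kcov l l * (1 + dl))).
Proof.
set s2 := kcov l l => s20 dl0.
exists (s2 * dl * normal_peak (Num.sqrt s2)).
  rewrite mulr_gt0 ?mulr_gt0// normal_peak_gt0//.
  by rewrite gt_eqF// sqrtr_gt0.
move=> n n0; have n0' : 0 < n%:R :> R by rewrite ltr0n.
have sn0 : 0 < n%:R^-1 * s2 by rewrite mulr_gt0// invr_gt0.
rewrite -lee_fin -prE; last exact: measurable_slab.
have g := ev_gaussian A_law (at_mean n l).
rewrite cov_at_mean// in g.
have := @centered_gaussian_itv_ge _ _ _ _ _ _ g s2 (s2 * (1 + dl)) sn0 (ltW s20).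
have -> : s2 * (1 + dl) - s2 = s2 * dl by ring.
have le : s2 <= s2 * (1 + dl) by rewrite ler_peMr ?lerDl// ltW.
move=> /(_ le); rewrite slabE; apply: le_trans; rewrite lee_fin.
have sq0 : Num.sqrt (n%:R^-1 * s2) != 0 by rewrite gt_eqF// sqrtr_gt0.
rewrite -/s2 normal_pdf0E// sqr_sqrtr ?(ltW sn0)//.
rewrite -!mulrA ler_pM2l// ler_pM2l//.
have -> : - (s2 * (1 + dl)) ^+ 2 / (n%:R^-1 * s2 *+ 2) =
  - (n%:R * (s2 * ((1 + dl) * ((1 + dl) / 2)))) by rewrite -mulr_natr; field; rewrite !gt_eqF.
rewrite ler_pM2r ?expR_gt0// /normal_peak !sqr_sqrtr ?(ltW sn0) ?(ltW s20)//.
have pi0 := pi_gt0 R.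
have sp0 : 0 < s2 * pi *+ 2 by rewrite mulrn_wgt0// mulr_gt0.
have snp0 : 0 < n%:R^-1 * s2 * pi *+ 2 by rewrite mulrn_wgt0// mulr_gt0.
rewrite lef_pV2 ?posrE ?sqrtr_gt0//; apply: ler_wsqrtr.
by rewrite lerMn2r/= ler_pM2r// ger_pMl// invf_le1// ler1n.
Qed.

(* The part of the functional [f |-> x * f (- t)] that is uncorrelated with [l]. *)
Definition orth l (t x : R) : seq (R * R) :=
  [:: (- t, x)] ++ kscale (- (x * kfun v l (- t) / kcov l l)) l.

Lemma apply_cat l m (f : R -> R) : apply_path (l ++ m) f = apply_path l f + apply_path m f.
Proof. by rewrite /apply_path big_cat. Qed.

Lemma apply_scale c l (f : R -> R) : apply_path (kscale c l) f = c * apply_path l f.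
Proof.
by rewrite /apply_path big_map mulr_sumr; apply: eq_bigr => p _; rewrite mulrA.
Qed.

Lemma apply_orth l t x (f : R -> R) : apply_path (orth l t x) f =
  x * (f (- t) - apply_path l f / kcov l l * kfun v l (- t)).
Proof.
rewrite /orth apply_cat apply_scale /apply_path big_seq1 /=.
by ring.
Qed.

Lemma kcov_orth l (t x : R) : 0 < kcov l l -> kcov l (orth l t x) = 0.
Proof.
move=> s0; rewrite -apply_kfun apply_orth apply_kfun divff ?gt_eqF//.
by rewrite mul1r subrr mulr0.
Qed.

(** Removing a projection can only lower the variance. *)
Lemma kcov_orth_le l (t x : R) : 0 < kcov l l -> x ^+ 2 = 1 -> 0 <= t ->
  kcov (orth l t x) (orth l t x) <= v t.
Proof.
move=> s0 x1 t0.
have -> : kcov (orth l t x) (orth l t x) = kcov [:: (- t, x)] (orth l t x).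
  rewrite {1}/orth kcov_catl kcov_scalel (@kcov_sym _ _ l).
  by rewrite kcov_sym (@kcov_sym _ _ _ l) kcov_orth// mulr0 addr0 kcov_sym.
rewrite /orth kcov_catr kcov_scaler kcov_point// x1 mul1r normrN ger0_norm//.
rewrite gerDl (@kcov_sym _ _ _ l) -(apply_kfun v [:: (- t, x)] l) /apply_path big_seq1/=.
rewrite mulNr oppr_le0 mulrAC [X in X / _](_ : _ = (x * kfun v l (- t)) ^+ 2); last by ring.
by rewrite divr_ge0 ?sqr_ge0// ltW.
Qed.

(** Requiring both [l] and an uncorrelated functional to be large adds their Chernoff exponents. The
    gain [th * e] loses at most half to the variance term, thanks to [th * v t <= e]. *)
Lemma pr_orth_le l (t x e th : R) n : 0 < kcov l l -> x ^+ 2 = 1 -> 0 <= t ->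
  0 < th -> th * v t <= e -> (0 < n)%N ->
  pr (half_space n (l ++ kscale th (orth l t x)) (kcov l l + th * e)) <=
  expR (- (n%:R * (kcov l l / 2 + th * e / 2))).
Proof.
move=> s0 x1 t0 th0 vt n0.
apply: (le_trans (pr_half_space _ _ n0)).
have := kcov_orth t x s0; have := kcov_orth_le s0 x1 t0.
move: (orth l t x) => m qv lm.
rewrite ler_expR lerN2 ler_pM2l ?ltr0n// !kcovE (@kcov_sym _ _ m l) lm.
set q := kcov m m in qv *.
have : th * (th * q) <= th * e.
  by rewrite ler_pM2l//; apply: le_trans vt; rewrite ler_pM2l.
move: (th * (th * q)) (th * e) (kcov l l) => y1 y2 y3 h.
by rewrite !mulr0; lra.
Qed.

Lemma deviation_lower_kfun l (eta beta : R) : 0 < eta -> b < beta ->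
  reach c1 c2 beta (kfun v l) ->
  \forall n \near \oo, expR (- (n%:R * (kcov l l / 2 + eta))) <= pr (event n).
Proof.
move=> eta0 bb rg; have b0 := b_gt0.
set g := kfun v l in rg *.
have Og : in_Omega g := in_Omega_kfun v0 law_kcov_ge0 v_cont v_ge0 v_growth l.
have [cg [g0 _]] := Og.
have gv t : 0 <= t -> g (- t) ^+ 2 <= kcov l l * v t.
  move=> t0; have := kcov_cauchy_schwarz law_kcov_ge0 l [:: (- t, 1)].
  rewrite kcov_point// expr1n mul1r normrN ger0_norm// -apply_kfun.
  by rewrite /apply_path big_seq1/= mul1r.
set s2 := kcov l l in gv *.
(* A combination of norm 0 vanishes by Cauchy-Schwarz and cannot reach a positive level. *)
have s20 : 0 < s2.
  rewrite lt_neqAle law_kcov_ge0 andbT; apply/eqP => s2E.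
  have [t t0 ht] := rg.
  have := reach_ge cg g0 ht; apply/negP; rewrite -ltNge.
  have -> : g (- t) = 0.
    apply/eqP; rewrite -sqrf_eq0; apply/eqP/le_anti.
    by rewrite sqr_ge0 andbT; apply: (le_trans (gv _ (ltW t0))); rewrite -s2E mul0r.
  have c2t : 0 < c2 * t by rewrite mulr_gt0.
  by lra.
pose beta2 := (b + beta) / 2.
have bb2 : b < beta2 by rewrite /beta2; lra.
have b20 : 0 < beta2 by apply: lt_trans bb2.
have bb2' : beta2 < beta by rewrite /beta2; lra.
have [e1 e10 He1] := reach_stable c2_gt0 c12 b20 bb2' Og rg.
(* Four errors: oscillation of the mean, oscillation of [g], the uncorrelated part at a grid point,
   and the width of the slab. *)
pose e := e1 / 4.
have e0 : 0 < e by rewrite divr_gt0.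
have e1E : e1 = 4 * e by rewrite /e; field.
clearbody e.
pose r := (Num.truncn (s2 / 2 + 1)).+1.
have rs : s2 / 2 + 1 < r%:R by exact: truncnS_gt.
have r0 : (0 < r)%N by [].
clearbody r.
have tR := tame_rkhs v0 law_kcov_ge0 v_cont v_ge0 v_growth (ltW s20) e0.
have tE := exponential_tightness A_paths A_law e0 r0.
have [M [hR hE M0]] := near_nat_ex2 tR tE.
have [N [HR HE N0]] := near_nat_ex2 hR hE.
have tg : tame M N e g by apply: HR.
have [C C0 vC] := v_bound v_cont v_ge0 v_growth.
pose tb := C * (1 + M%:R) ^+ 2.
have tb0 : 0 < tb by rewrite mulr_gt0// exprn_gt0// ltr_wpDr.
have vtb t : 0 <= t -> t <= M%:R -> v t <= tb.
  move=> t0 tM; apply: (le_trans (vC _ t0)); rewrite ler_pM2l//.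
  by rewrite ler_sqr ?nnegrE ?lerD2l// addr_ge0.
pose th := e / tb.
have th0 : 0 < th by rewrite divr_gt0.
(* The margin in the exponent: provided by [pr_orth_le], allowed by the claim, and covered by the
   tightness rate [r], respectively. *)
pose gam := Num.min (th * e / 2) (Num.min eta 1).
have gam0 : 0 < gam by rewrite !lt_min eta0 ltr01 divr_gt0// mulr_gt0.
have gam1 : gam <= th * e / 2 by rewrite ge_min lexx.
have gam2 : gam <= eta by rewrite !ge_min lexx orbT.
have gam3 : gam <= 1 by rewrite !ge_min lexx !orbT.
clearbody gam.
(* The slab is thin enough to move [g] by at most [e] at grid points and to cost at most half of
   [gam]. *)
pose dl := Num.min 1 (Num.min (e / (s2 * tb + 1)) (gam / (3 * s2))).
have stb0 : 0 < s2 * tb + 1 by rewrite ltr_wpDl// mulr_ge0 ?(ltW s20) ?(ltW tb0).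
have dl0 : 0 < dl by rewrite !lt_min ltr01 !divr_gt0// mulr_gt0.
have dl1 : dl <= 1 by rewrite ge_min lexx.
have dl2 : dl * (s2 * tb + 1) <= e by rewrite -ler_pdivlMr// !ge_min lexx orbT.
have dl3 : s2 * dl * 3 <= gam.
  by rewrite -mulrAC mulrC [s2 * 3]mulrC -ler_pdivlMr ?mulr_gt0// !ge_min lexx !orbT.
clearbody dl.
have dl4 : s2 * (1 + dl) ^+ 2 / 2 <= s2 / 2 + gam / 2.
  have : s2 * dl * dl <= s2 * dl by rewrite ler_piMr// mulr_ge0 ?(ltW s20) ?(ltW dl0).
  have -> : s2 * (1 + dl) ^+ 2 = s2 + 2 * (s2 * dl) + s2 * dl * dl by ring.
  by move: (s2 * dl * dl) (s2 * dl) dl3 => y1 y2 h1 h2; lra.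
have [c0 c00 Hc0] := pr_slab_ge s20 dl0.
pose lsx := [seq (gridtime R N k, x) | k <- iota 0 (M * N).+1, x <- [:: 1; -1 : R]].
have [K KE] : exists K : R, K = (size lsx)%:R by eexists.
have gh : 0 < gam / 2 by rewrite divr_gt0.
have [n0 _ Hn0] := expR_dominates (2 + K) c00 gh.
exists n0.+1 => // n /= nn0.
have n1 : (0 < n)%N by apply: leq_trans nn0.
have nK := Hn0 n (ltnW nn0).
have nR : 0 < n%:R :> R by rewrite ltr0n.
pose F (p : R * R) := if (0 <= p.1 <= M%:R) && (p.2 ^+ 2 == 1)
  then half_space n (l ++ kscale th (orth l p.1 p.2)) (s2 + th * e) else set0.
have mF p : measurable (F p).
  by rewrite /F; case: ifP => // _; exact: measurable_half_space.
have prF p : p \in lsx -> pr (F p) <= expR (- (n%:R * (s2 / 2 + gam))).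
  move=> _; rewrite /F; case: ifP => [/andP[/andP[p0 pM] /eqP p2]|_]; last first.
    by rewrite /pr measure0 expR_ge0.
  have thv : th * v p.1 <= e.
    by rewrite /th mulrAC ler_pdivrMr// ler_pM2l// vtb.
  apply: (le_trans (pr_orth_le s20 p2 p0 th0 thv n1)).
  by rewrite ler_expR lerN2 ler_pM2l// lerD2l.
have [mU prU] := pr_union_le mF prF; rewrite -KE in prU.
set U := [set w | _] in mU prU.
pose G := allev A (fun j => at_mean n (osc M N (ratpt R j))) e.
have mG : measurable G by exact: (measurable_allev A_law).
pose S := slab n l s2 (s2 * (1 + dl)).
have mS : measurable S by exact: measurable_slab.
have mE : measurable (event n) by exact: (measurable_exceeds A_paths A_law).
have sub : S `<=` event n `|` (~` G `|` U).
  move=> w /andP[z1 z2]; have [Gw|] := pselect (G w); last by right; left.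
  have [Uw|nU] := pselect (U w); first by right; right.
  left; have tm := tame_mean N0 Gw.
  exists beta2 => //; apply: He1 => t t0.
  rewrite e1E; set f := mean n w in tm *; set z := apply_path l f in z1 z2.
  have := tm t t0; have := tg t t0; rewrite !apply_osc.
  have [tM|tM] := ltP t M%:R; last first.
    have t10 : 0 < 1 + t by rewrite ltr_wpDr.
    rewrite !normf_div (ger0_norm (ltW t10)) !ler_pdivrMr// => h1 h2.
    apply: (le_trans (ler_normB _ _)); apply: (le_trans (lerD h2 h1)).
    rewrite -mulrDl ler_pM2r// mulr_natl -mulr2n ler_wpMn2l ?(ltW e0)//.
  set tk := gridpt N t => h1 h2.
  have tk0 : 0 <= tk := gridpt_ge0 N t.
  have tkM : tk <= M%:R.
    by have /andP[h _] := gridpt_itv N0 t0; apply: le_trans h (ltW tM).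
  have hk : `|f (- tk) - z / s2 * g (- tk)| <= e.
    rewrite leNgt; apply/negP => h; apply: nU.
    pose x : R := if 0 <= f (- tk) - z / s2 * g (- tk) then 1 else -1.
    have xx : x ^+ 2 = 1 by rewrite /x; case: ifP; rewrite ?sqrrN expr1n.
    have xN : x * (f (- tk) - z / s2 * g (- tk)) = `|f (- tk) - z / s2 * g (- tk)|.
      rewrite /x; case: ifPn => [/ger0_norm ->|]; first by rewrite mul1r.
      by rewrite -ltNge => /ltr0_norm ->; rewrite mulN1r.
    exists (tk, x).
      apply/allpairsPdep; exists (Num.truncn (t * N%:R)), x; split.
      - by rewrite mem_iota/= add0n ltnS truncn_grid.
      - by rewrite /x !inE; case: ifP; rewrite eqxx ?orbT.
      - by rewrite /tk gridptE.
    rewrite /F ifT; last by rewrite tk0 tkM xx eqxx.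
    change (s2 + th * e <= apply_path (l ++ kscale th (orth l tk x)) f).
    rewrite apply_cat apply_scale apply_orth -/f -/z -/s2 -/g xN.
    by rewrite lerD// ler_pM2l// ltW.
  have hg : `|g (- tk)| <= s2 * tb + 1.
    rewrite -(@ler_sqr R) ?nnegrE ?(ltW stb0)// -normrX ger0_norm ?sqr_ge0//.
    apply: (le_trans (gv _ tk0)); apply: (@le_trans _ _ (s2 * tb)).
      by rewrite ler_pM2l// vtb.
    have : 0 < s2 * tb by rewrite mulr_gt0.
    move: (s2 * tb) => y y0; rewrite sqrrD mulr1 expr1n.
    by have := sqr_ge0 y; lra.
  have hz : `|z / s2 * g (- tk) - g (- tk)| <= e.
    rewrite -{2}[g (- tk)]mul1r -mulrBl normrM; apply: le_trans dl2.
    apply: ler_pM => //; rewrite ger0_norm; last first.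
      by rewrite subr_ge0 ler_pdivlMr// mul1r.
    by rewrite lerBlDr ler_pdivrMr// addrC mulrC.
  have t1 : e * 4 <= e * 4 * (1 + t) by rewrite ler_peMr ?lerDl// mulr_ge0 ?(ltW e0).
  rewrite [4 * e]mulrC; move: t1 h1 h2 hk hz; rewrite !ler_norml.
  move: (e * 4 * (1 + t)) (f (- tk)) (f (- t)) (z / s2 * g (- tk)) (g (- tk)) (g (- t)).
  move=> y0 y1 y2 y3 y4 y5 t1 /andP[? ?] /andP[? ?] /andP[? ?] /andP[? ?].
  by apply/andP; split; lra.
pose X := expR (- (n%:R * (s2 / 2 + gam))).
have X0 : 0 < X by exact: expR_gt0.
have prS : (2 + K) * X <= pr S.
  apply: le_trans (Hc0 n n1); rewrite -/s2.
  apply: (@le_trans _ _ (c0 * expR (n%:R * (gam / 2)) * X)); first by rewrite ler_pM2r.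
  rewrite -mulrA ler_pM2l// /X -expRD ler_expR -mulrN -mulrDr -mulrN ler_pM2l//.
  by move: dl4; move: (s2 * (1 + dl) ^+ 2 / 2) => y; lra.
have prG : pr (~` G) <= X.
  apply: (le_trans (HE n n1)); rewrite ler_expR lerN2 natrM mulrC ler_pM2r//.
  by move: rs gam3; move: (r%:R) => y; lra.
have : pr S <= pr (event n) + (pr (~` G) + pr U).
  apply: (@le_trans _ _ (pr (event n `|` (~` G `|` U)))).
    by apply: pr_le => //; apply: measurableU => //; apply: measurableU => //; exact: measurableC.
  have mGU : measurable (~` G `|` U) by apply: measurableU => //; exact: measurableC.
  apply: (le_trans (prU_le _ mE mGU)); rewrite lerD2l.
  by apply: prU_le => //; exact: measurableC.
move=> prSE; apply: (@le_trans _ _ X).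
  by rewrite ler_expR lerN2 ler_pM2l// lerD2l.
move: prU prS prSE prG; rewrite -/X mulrDl.
clearbody X.
by move: (K * X) (pr U) (pr S) (pr (event n)) (pr (~` G)) => y1 y2 y3 y4 y5; lra.
Qed.

(** The level is open in the weighted norm and [v t <= C * (1 + t) ^ 2] makes approximation in
    Hilbert norm approximation in that norm, so a kernel combination of nearly the same norm can
    replace [f]. *)
Lemma deviation_lower f (L eta : R) : in_Omega f -> exceeds b c1 c2 f ->
  rkhs_approx v f L -> 0 < eta ->
  \forall n \near \oo, expR (- (n%:R * (L / 2 + eta))) <= pr (event n).
Proof.
move=> Of [beta bb rf] fL eta0; have b0 := b_gt0.
pose beta1 := (b + beta) / 2.
have bb1 : b < beta1 by rewrite /beta1; lra.
have b10 : 0 < beta1 by apply: lt_trans bb1.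
have bb1' : beta1 < beta by rewrite /beta1; lra.
have [e e0 He] := reach_stable c2_gt0 c12 b10 bb1' Of rf.
have [C C0 vC] := v_bound v_cont v_ge0 v_growth.
pose eta1 := Num.min eta (e ^+ 2 / C).
have eta10 : 0 < eta1 by rewrite lt_min eta0 divr_gt0// exprn_gt0.
have eta1l : eta1 <= eta by rewrite ge_min lexx.
have eta1C : eta1 * C <= e ^+ 2 by rewrite -ler_pdivlMr// ge_min lexx orbT.
have [l [lL Hl]] := rkhs_approx_near law_kcov_ge0 eta10 fL.
clearbody eta1.
have rg : reach c1 c2 beta1 (kfun v l).
  apply: He => t t0; have := Hl [:: (- t, 1)].
  rewrite kcov_point// expr1n mul1r normrN ger0_norm// /apply_path !big_seq1/= !mul1r => h.
  have t10 : 0 < 1 + t by rewrite ltr_wpDr.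
  rewrite distrC -(@ler_sqr R) ?nnegrE ?mulr_ge0 ?(ltW e0) ?(ltW t10)//.
  rewrite -normrX ger0_norm ?sqr_ge0//; apply: (le_trans h).
  apply: (@le_trans _ _ (eta1 * (C * (1 + t) ^+ 2))); first by rewrite ler_pM2l// vC.
  by rewrite mulrA exprMn ler_wpM2r// sqr_ge0.
have eta20 : 0 < eta / 2 by rewrite divr_gt0.
apply: filterS (deviation_lower_kfun eta20 bb1 rg) => n; apply: le_trans.
rewrite ler_expR lerN2 ler_wpM2l ?ler0n//.
by move: lL; rewrite knorm2E; move: (kcov l l) => y; lra.
Qed.

End deviation_bounds.

(** * Identification of the rate *)

Lemma cvge_order (R : realType) (u : nat -> \bar R) (x : \bar R) : x != -oo%E ->
  (forall a : R, (a%:E < x)%E -> \forall n \near \oo, (a%:E <= u n)%E) ->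
  (forall a : R, (x < a%:E)%E -> \forall n \near \oo, (u n <= a%:E)%E) ->
  u @ \oo --> x.
Proof.
case: x => [r| |] // _ lo up; last by apply/cvgeyPge => a; apply: lo; rewrite ltry.
have bnd e : 0 < e -> \forall n \near \oo, ((r - e)%:E <= u n <= (r + e)%:E)%E.
  move=> e0; have := lo (r - e); have := up (r + e).
  rewrite !lte_fin ltrDl gtrBl => /(_ e0) h1 /(_ e0) h2.
  by apply: filterS2 h2 h1 => n -> ->.
apply/fine_cvgP; split.
  by apply: filterS (bnd 1 ltr01) => n; case: (u n) => [s|/andP[]|/andP[]].
apply/cvgrPdist_le => e e0; apply: filterS (bnd e e0) => n /=.
case: (u n) => [s|/andP[]|/andP[]]//=; rewrite !lee_fin => /andP[h1 h2].
by rewrite ler_norml; apply/andP; split; lra.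
Qed.

Section decay_rate.
Variables (R : realType) (n : nat) (p a : R).
Hypothesis n_gt0 : (0 < n)%N.

Lemma decay_ge : 0 <= p -> p <= expR (- (n%:R * a)) ->
  (a%:E <= (- (n%:R^-1))%:E * lne p%:E)%E.
Proof.
have n0 : 0 < n%:R :> R by rewrite ltr0n.
(* At [p = 0] the logarithm is [-oo] and its factor negative, so the right side is [+oo]. *)
rewrite le_eqVlt => /predU1P[<- _|p0 pa].
  by rewrite le0_lneNy// lt0_muleNy ?leey// lte_fin oppr_lt0 invr_gt0.
rewrite lne_EFin// lee_fin mulNr lerNr mulrC ler_pdivrMr//.
by rewrite -ler_expR lnK ?posrE// mulNr mulrC.
Qed.

Lemma decay_le : expR (- (n%:R * a)) <= p ->
  ((- (n%:R^-1))%:E * lne p%:E <= a%:E)%E.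
Proof.
have n0 : 0 < n%:R :> R by rewrite ltr0n.
move=> pa; have p0 : 0 < p by apply: lt_le_trans pa; exact: expR_gt0.
rewrite lne_EFin// lee_fin mulNr lerNl mulrC ler_pdivlMr//.
by rewrite -ler_expR lnK ?posrE// mulNr mulrC.
Qed.

End decay_rate.

(** * Equality of the infima of the rate *)

Section rate_infima.
Variables (R : realType) (v : R -> R).
Hypothesis v_cont : {within `[0, +oo[, continuous v}.
Hypothesis v0 : v 0 = 0.
Hypothesis kcov_ge0 : forall l, 0 <= kcov v l l.
Variables (b c1 c2 : R).
Hypotheses (b_gt0 : 0 < b) (c2_gt0 : 0 < c2) (c12 : c2 < c1).

(** The probability bounds are stated against this value; the chain closure, [setS], [cost], closure
    of inequalities then closes up and makes all infima equal. *)
Definition cost : \bar R := ereal_inf [set x | exists f L,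
  [/\ in_Omega f, exceeds b c1 c2 f, rkhs_approx v f L & x = (L / 2)%:E]].

Lemma cost_le f (L : R) : in_Omega f -> exceeds b c1 c2 f -> rkhs_approx v f L ->
  (cost <= (L / 2)%:E)%E.
Proof. by move=> Of ef fL; apply: ereal_inf_lbound; exists f, L. Qed.

Lemma cost_ge0 : (0 <= cost)%E.
Proof.
apply: le_ereal_inf_tmp => _ [f [L [_ _ fL ->]]].
by rewrite lee_fin divr_ge0// (rkhs_approx_ge0 kcov_ge0 fL).
Qed.

Lemma subset_Omega_closure (S : set (R -> R)) : S `<=` @in_Omega R ->
  S `<=` Omega_closure S.
Proof.
move=> SO f Sf; split; first exact: SO.
move=> e e0; exists f; split => //; rewrite /Omega_norm.
rewrite (_ : [set _ | _ in _] = [set 0]) ?sup1//.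
apply/seteqP; split => [_ [t _ <-]|_ ->] /=; first by rewrite subrr normr0 mul0r.
by exists 0 => //; rewrite subrr normr0 mul0r.
Qed.

Lemma inf_rate_setS_le : (ereal_inf (rate v @` setS b c1 c2) <= cost)%E.
Proof.
apply: le_ereal_inf_tmp => _ [f [L [Of [beta bb rf] fL ->]]].
apply: (@le_trans _ _ (rate v f)); last by apply: ereal_inf_lbound; exists L.
by apply: ereal_inf_lbound; exists f => //; exact: reach_setS bb Of rf.
Qed.

Lemma inf_rate_closure_le : (ereal_inf (rate v @` Omega_closure (setS b c1 c2)) <=
  ereal_inf (rate v @` setS b c1 c2))%E.
Proof.
by apply/le_ereal_inf/image_subset/subset_Omega_closure => f [].
Qed.

Lemma cost_le_inf_rate_closure :
  (cost <= ereal_inf (rate v @` Omega_closure (setS b c1 c2)))%E.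
Proof.
apply: le_ereal_inf_tmp => _ [f cf <-]; apply: le_ereal_inf_tmp => _ [L fL <-].
have L0 := rkhs_approx_ge0 kcov_ge0 fL.
apply/lee_addgt0Pr => e e0.
(* Keeps the rise of the rate from [L / 2] to [(1 + dl) ^ 2 * L / 2] within [e]. *)
pose dl := Num.min 1 (e / (2 * L + 1)).
have L10 : 0 < 2 * L + 1 by rewrite ltr_wpDl// mulr_ge0.
have dl0 : 0 < dl by rewrite lt_min ltr01 divr_gt0.
have dl1 : dl <= 1 by rewrite ge_min lexx.
have dl2 : dl * (2 * L + 1) <= e by rewrite -ler_pdivlMr// ge_min lexx orbT.
clearbody dl.
have a0 : 0 <= L / 2 by rewrite divr_ge0.
have lam1 : 1 < 1 + dl by rewrite ltrDl.
have [eps [eps0 epsb H]] := rkhs_improve v_cont v0 kcov_ge0 b_gt0 c2_gt0 c12 a0 lam1.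
have bb : b - eps < b by rewrite gtrBl.
have rf := closure_reach c2_gt0 c12 b_gt0 bb cf.
have LL : L <= 2 * (L / 2) by rewrite mulrC divfK.
have [g [Og eg gL]] := H f L cf.1 fL LL rf.
apply: (le_trans (cost_le Og eg gL)); rewrite -EFinD lee_fin.
have q1 : dl * dl * L <= dl * L by rewrite -mulrA ler_piMl// mulr_ge0// ltW.
have -> : (1 + dl) ^+ 2 * L = L + 2 * (dl * L) + dl * dl * L by ring.
have q2 : 2 * (dl * L) + dl <= e by move: dl2; rewrite mulrDr mulr1 mulrCA.
move: (dl * dl * L) (dl * L) q1 q2 (mulr_ge0 (ltW dl0) L0) => y1 y2 q1 q2 q3; lra.
Qed.

End rate_infima.

Theorem theorem3p1 (R : realType) (v : R -> R)
  (v_cont : {within `[0, +oo[, continuous v})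
  (v_ge0 : forall t : R, 0 <= t -> 0 <= v t)
  (v0 : v 0 = 0)
  (v_growth : exists alpha : R, alpha < 2 /\
      (fun t => v t / t `^ alpha) @ +oo --> (0 : R))
  (d : measure_display) (T : measurableType d) (P : probability T R)
  (A : nat -> T -> R -> R)
  (A_paths : forall (i : nat) (w : T), in_Omega (A i w))
  (A_law : iid_gaussian_family P v A)
  (b c1 c2 : R) (b_gt0 : 0 < b) (c2_gt0 : 0 < c2) (c12 : c2 < c1) :
  exists J : \bar R,
    ((fun n : nat => (- (n%:R^-1))%:E *
        lne (P [set w | (n%:R * b < Q2 A n c1 c2 w)%R])) @ \oo --> J)%E /\
    J = ereal_inf (rate v @` Omega_closure (setS b c1 c2)) /\
    J = ereal_inf (rate v @` setS b c1 c2).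
Proof.
have kcov_ge0 := law_kcov_ge0 A_law.
pose J := cost v b c1 c2.
have JS : (ereal_inf (rate v @` setS b c1 c2) <= J)%E by exact: inf_rate_setS_le.
have SC := inf_rate_closure_le v b c1 c2.
have CJ : (J <= ereal_inf (rate v @` Omega_closure (setS b c1 c2)))%E.
  exact: cost_le_inf_rate_closure.
exists J; split; last first.
  split; apply/le_anti; first by rewrite CJ (le_trans SC JS).
  by rewrite JS (le_trans CJ SC).
pose E n := [set w | exceeds b c1 c2 (mean_path A n w)].
have mE n : measurable (E n) by exact: (measurable_exceeds A_paths A_law).
have PE n : (0 < n)%N -> P [set w | n%:R * b < Q2 A n c1 c2 w] = (pr P (E n))%:E.
  move=> n0; rewrite -prE//; congr (P _); apply/seteqP; split => w /=.
    by move/(Q2_exceeds A_paths b c2_gt0 c12 w n0).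
  by move=> h; apply/(Q2_exceeds A_paths b c2_gt0 c12 w n0).
have J0 : (0 <= J)%E by exact: cost_ge0.
have npos : \forall n \near \oo, (0 < n)%N by exists 1%N.
apply: cvge_order => [|a aJ|a Ja].
- by apply: contraTneq J0 => ->.
- have [a0|a0] := leP a 0.
    apply: filterS npos => n n0; rewrite PE//; apply: decay_ge => //; first exact: pr_ge0.
    apply: (le_trans (pr_le1 P (mE n))).
    by rewrite -expR0 ler_expR oppr_ge0 mulr_ge0_le0.
  have [a2 aa2 a2J] : exists2 a2 : R, a < a2 & (a2%:E < J)%E.
    case: (J) aJ J0 => [r| |] //; last by exists (a + 1); rewrite ?ltry ?ltrDl.
    by rewrite lte_fin => ar _; exists ((a + r) / 2); rewrite ?lte_fin; lra.
  (* In [a < a1 < a2 < J] the first gap absorbs the constant [C] for large [n], and the second pays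
     for the factor [lam ^ 2 = a2 / a1]. *)
  pose a1 := (a + a2) / 2.
  have aa1 : a < a1 by rewrite /a1; lra.
  have a12 : a1 < a2 by rewrite /a1; lra.
  have a10 : 0 < a1 by apply: lt_trans aa1.
  have a20 : 0 < a2 by apply: lt_trans a12.
  pose lam := Num.sqrt (a2 / a1).
  have lam2 : lam ^+ 2 = a2 / a1 by rewrite sqr_sqrtr// divr_ge0// ltW.
  have lam1 : 1 < lam.
    have q0 : 0 < a2 / a1 by rewrite divr_gt0.
    by rewrite -[ltLHS]sqrtr1 ltr_sqrt// ltr_pdivlMr// mul1r.
  have [eps [eps0 epsb H]] :=
    rkhs_improve v_cont v0 kcov_ge0 b_gt0 c2_gt0 c12 (ltW a10) lam1.
  have [|C C0 HC] := deviation_upper v_cont v_ge0 v0 v_growth A_paths A_law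
    b_gt0 c2_gt0 c12 a10.
    (* A kernel combination of squared norm at most [2 * a1] reaching [b - eps] would improve to a
       path in the event of rate at most [a2], below the infimum [J]. *)
    exists eps; split => // l la rl.
    have Ol := in_Omega_kfun v0 kcov_ge0 v_cont v_ge0 v_growth l.
    have [g [Og eg gL]] := H _ _ Ol (rkhs_approx_kfun v l) la rl.
    have := cost_le Og eg gL; apply/negP; rewrite -ltNge; apply: le_lt_trans a2J.
    rewrite lee_fin lam2 -mulrA -[leRHS](@divfK _ a1) ?gt_eqF//.
    apply: ler_wpM2l; first by rewrite divr_ge0// ltW.
    by rewrite ler_pdivrMr// mulrC.
  have a1a : 0 < a1 - a by rewrite subr_gt0.
  apply: filterS2 npos (expR_dominates C ltr01 a1a) => n n0; rewrite mul1r => nC.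
  rewrite PE//; apply: decay_ge => //; first exact: pr_ge0.
  apply: (le_trans (HC n n0)).
  apply: (@le_trans _ _ (expR (n%:R * (a1 - a)) * expR (- (n%:R * a1)))).
    by rewrite ler_pM2r// expR_gt0.
  by rewrite -expRD ler_expR mulrBr addrAC subrr sub0r.
have [_ [f [L [Of ef fL ->]]]] := ereal_inf_lt Ja; rewrite lte_fin => La.
have eta0 : 0 < a - L / 2 by rewrite subr_gt0.
have := deviation_lower v_cont v_ge0 v0 v_growth A_paths A_law b_gt0 c2_gt0 c12 Of ef fL eta0.
apply: filterS2 npos => n n0; rewrite addrC subrK => h.
by rewrite PE//; exact: decay_le.
Qed.
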